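(* Let $N$ be an even positive integer, $c = 4/N$, $r>0$, and let $\Gamma_c := \langle \Lambda_{i,c},\ (0,c/4)\,\mu(i)\rangle \subset \mathbb{H}\rtimes S^1$, assumed to be a Heisenberg Bieberbach group. Let $M = \Gamma_c\backslash\mathbb{H}$, equipped with the CR structure induced from $\mathbb{H}$ and the contact form $r\theta_{\mathbb{H}}$, and let $\Delta_b$ and $T$ be its sub-Laplacian and Reeb vector field. For $n\in\mathbb{Z}\setminus\{0\}$ and $k\in\mathbb{Z}_{\ge 0}$, the multiplicity $m_{n,k}$ of $$\sigma_{n,k} = \left(\frac{(4k+2)\pi|n|}{cr}, \frac{2\pi n}{cr}\right)$$ in the joint spectrum of $\Delta_b$ and $i^{-1}T$ on $M$ is given by $$m_{n,k} = \begin{cases} \frac14\left(|n|N + 2(-1)^{n+k} + 2\cos\frac{\pi(|n|-k)}{2} - 2\sin\frac{\pi(|n|-k)}{2}\right) & \text{if } |n|N\equiv 0 \pmod 4,\\[4pt] \frac14\left(|n|N+2(-1)^{n+k}\right) & \text{if } |n|N\equiv 2 \pmod 4.\end{cases}$$ Moreover, for any $\kappa>0$, the multiplicity of $(\kappa,0)$ in the joint spectrum is equal to $\#E_\kappa/4$, where $E_\kappa = \{\zeta\in L_i' : \pi^2|\zeta|^2/r = \kappa\}$.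
   Context: The Heisenberg group is $\mathbb{H} = \mathbb{C}\times\mathbb{R}$ with multiplication $(z,t)\cdot(z',t') = (z+z', t+t'+2\operatorname{Im}(z\bar z'))$. For $\lambda\in\mathbb{C}^*$ let $\mu(\lambda)(z,t)=(\lambda z,|\lambda|^2t)$. $\mathbb{H}\rtimes\mathbb{C}^*$ has multiplication $(g,\lambda)\cdot(h,\nu)=(g\cdot\mu(\lambda)(h),\lambda\nu)$ and acts on $\mathbb{H}$ by $(g,\lambda)h=g\cdot\mu(\lambda)(h)$; $(g,\lambda)$ is also written $g\,\mu(\lambda)$, $\mathbb{H}$ is identified with the elements $(g,1)$, and $\mathbb{H}\rtimes S^1$ is the subgroup with $|\lambda|=1$. A Heisenberg Bieberbach group is a discrete torsion-free subgroup $\Gamma\subset\mathbb{H}\rtimes S^1$ with $\Gamma\backslash\mathbb{H}$ compact. For $4\operatorname{Im}\tau/c\in\mathbb{Z}_{>0}$, $\Lambda_{\tau,c}=\langle(1,0),(\tau,0),(0,c)\rangle\subset\mathbb{H}$; here $\tau=i$, and $N=4/c=\#(Z(\Lambda_{i,c})/[\Lambda_{i,c},\Lambda_{i,c}])$. $L_i=\mathbb{Z}+\mathbb{Z}i$, and $L_i'=\{\zeta\in\mathbb{C} : \operatorname{Re}(\zeta\bar z)\in\mathbb{Z}\text{ for all }z\in L_i\}$ is its dual lattice. The CR structure on $\mathbb{H}$ is spanned by $Z=\partial_z+i\bar z\,\partial_t$, and $\theta_{\mathbb{H}}=dt+i(z\,d\bar z-\bar z\,dz)$; both are invariant under $\mathbb{H}\rtimes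 S^1$ and so descend to the quotient. Functions on $M$ are identified with $\Gamma_c$-invariant functions on $\mathbb{H}$. With respect to $r\theta_{\mathbb{H}}$, the sub-Laplacian is $\Delta_b=-\frac{1}{2r}(Z\bar Z+\bar ZZ)$ and the Reeb vector field is $T=\frac1r\partial_t$. The multiplicity of $(a,b)\in\mathbb{R}^2$ in the joint spectrum is the complex dimension of $\{f\in C^\infty(M;\mathbb{C}) : \Delta_bf=af,\ i^{-1}Tf=bf\}$ (zero if $(a,b)$ is not a joint eigenvalue). *)

(* Defs.v *)
From HB Require Import structures.
From mathcomp Require Import all_boot all_order all_algebra complex.
From mathcomp Require Import generic_quotient.
From mathcomp Require Import all_classical all_reals all_analysis.
From mathcomp Require Import ring.

Set Implicit Arguments.
Unset Strict Implicit.
Unset Printing Implicit Defensive.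

Import Order.TTheory GRing.Theory Num.Theory.
Import numFieldNormedType.Exports.

Local Open Scope classical_set_scope.
Local Open Scope complex_scope.
Local Open Scope quotient_scope.
Local Open Scope ring_scope.

(* The Heisenberg group C x R in the real coordinates ((x, y), t), z = x + iy,
   so that it is a real normed space; [hpt z t] is the point (z, t). *)
Definition heis (R : realType) : Type := (R * R * R)%type.

HB.instance Definition _ (R : realType) :=
  NormedModule.copy (heis R) (R * R * R)%type.

Definition hpt {R : realType} (z : R[i]) (t : R) : heis R :=
  (complex.Re z, complex.Im z, t).
Definition zpart {R : realType} (p : heis R) : R[i] := p.1.1 +i* p.1.2.
Definition tpart {R : realType} (p : heis R) : R := p.2.

Definition hmul {R : realType} (p q : heis R) : heis R :=
  hpt (zpart p + zpart q)
      (tpart p + tpart q + 2 * complex.Im (zpart p * (zpart q)^*)).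
Definition hone {R : realType} : heis R := hpt 0 0.
Definition hinv {R : realType} (p : heis R) : heis R :=
  hpt (- zpart p) (- tpart p).

Lemma hmulA (R : realType) : associative (@hmul R).
Proof.
move=> [[x y] t] [[x' y'] t'] [[x'' y''] t''].
by rewrite /hmul /hpt /zpart /tpart /=; congr (_, _, _); ring.
Qed.

Lemma hmul1g (R : realType) : left_id hone (@hmul R).
Proof.
move=> [[x y] t].
by rewrite /hmul /hone /hpt /zpart /tpart /=; congr (_, _, _); ring.
Qed.

Lemma hmulg1 (R : realType) : right_id hone (@hmul R).
Proof.
move=> [[x y] t].
by rewrite /hmul /hone /hpt /zpart /tpart /=; congr (_, _, _); ring.
Qed.

Lemma hmulVg (R : realType) : left_inverse hone hinv (@hmul R).
Proof.
move=> [[x y] t].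
by rewrite /hmul /hone /hinv /hpt /zpart /tpart /=; congr (_, _, _); ring.
Qed.

Lemma hmulgV (R : realType) : right_inverse hone hinv (@hmul R).
Proof.
move=> [[x y] t].
by rewrite /hmul /hone /hinv /hpt /zpart /tpart /=; congr (_, _, _); ring.
Qed.

Definition mu {R : realType} (l : R[i]) (p : heis R) : heis R :=
  hpt (l * zpart p) (Normc.normc l ^+ 2 * tpart p).

Lemma normc2E (R : realType) (l : R[i]) :
  Normc.normc l ^+ 2 = complex.Re l ^+ 2 + complex.Im l ^+ 2.
Proof. by case: l => a b; rewrite /= sqr_sqrtr// addr_ge0 ?sqr_ge0. Qed.

Lemma mu1 (R : realType) (p : heis R) : mu 1 p = p.
Proof.
case: p => [[x y] t].
by rewrite /mu normc2E /hpt /zpart /tpart /=; congr (_, _, _); ring.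
Qed.

Lemma muM (R : realType) (l l' : R[i]) (p : heis R) :
  mu (l * l') p = mu l (mu l' p).
Proof.
case: l l' p => [a b] [a' b'] [[x y] t].
by rewrite /mu !normc2E /hpt /zpart /tpart /=; congr (_, _, _); ring.
Qed.

Lemma mu_hmul (R : realType) (l : R[i]) :
  {morph mu l : p q / hmul p q}.
Proof.
case: l => [a b] [[x y] t] [[x' y'] t'].
rewrite /mu !normc2E /hmul /hpt /zpart /tpart /=.
by congr (_, _, _); ring.
Qed.

Lemma mu_one (R : realType) (l : R[i]) : mu l hone = hone.
Proof.
by case: l => [a b]; rewrite /mu normc2E /hone /hpt /zpart /tpart /=; congr (_, _, _); ring.
Qed.

HB.instance Definition _ (R : realType) :=
  isGroup.Build (heis R) (@hmulA R) (@hmul1g R) (@hmulg1 R)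
    (@hmulVg R) (@hmulgV R).

Lemma mu_mulg (R : realType) (l : R[i]) (p q : heis R) :
  mu l (p * q)%g = (mu l p * mu l q)%g.
Proof. exact: mu_hmul. Qed.

Lemma mu_1g (R : realType) (l : R[i]) : mu l (1%g : heis R) = 1%g.
Proof. exact: mu_one. Qed.

(* The semidirect product of the Heisenberg group with C^*. *)
Definition hsim (R : realType) : Type := {p : heis R * R[i] | p.2 != 0}.

HB.instance Definition _ (R : realType) := Choice.on (hsim R).

Definition Hsim {R : realType} (g : heis R) (l : R[i]) (l0 : l != 0) :
  hsim R := exist (fun p : heis R * R[i] => p.2 != 0) (g, l) l0.

Definition htrans {R : realType} (s : hsim R) : heis R := (val s).1.
Definition hdil {R : realType} (s : hsim R) : R[i] := (val s).2.

Lemma hdil_neq0 (R : realType) (s : hsim R) : hdil s != 0.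
Proof. exact: (valP s). Qed.

Lemma hsim_eq (R : realType) (s s' : hsim R) :
  htrans s = htrans s' -> hdil s = hdil s' -> s = s'.
Proof.
move: s s' => [[g l] l0] [[g' l'] l0']; rewrite /htrans /hdil /= => eg el.
by apply: val_inj; rewrite /= eg el.
Qed.

Definition smul {R : realType} (s s' : hsim R) : hsim R :=
  Hsim (htrans s * mu (hdil s) (htrans s'))%g
       (mulf_neq0 (hdil_neq0 s) (hdil_neq0 s')).
Definition sone {R : realType} : hsim R := Hsim 1%g (oner_neq0 R[i]).
Definition sinv {R : realType} (s : hsim R) : hsim R :=
  Hsim (mu (hdil s)^-1 (htrans s)^-1%g) (invr_neq0 (hdil_neq0 s)).

Lemma smulA (R : realType) : associative (@smul R).
Proof.
move=> s s' s''; apply: hsim_eq; rewrite /htrans /hdil /=; last exact: mulrA.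
by rewrite mu_mulg muM mulgA.
Qed.

Lemma smul1g (R : realType) : left_id sone (@smul R).
Proof.
move=> s; apply: hsim_eq; rewrite /htrans /hdil /=; last exact: mul1r.
by rewrite mu1 mul1g.
Qed.

Lemma smulg1 (R : realType) : right_id sone (@smul R).
Proof.
move=> s; apply: hsim_eq; rewrite /htrans /hdil /=; last exact: mulr1.
by rewrite mu_1g mulg1.
Qed.

Lemma smulVg (R : realType) : left_inverse sone sinv (@smul R).
Proof.
move=> s; apply: hsim_eq; rewrite /htrans /hdil /=.
  by rewrite -mu_mulg mulVg mu_1g.
by rewrite mulVf// hdil_neq0.
Qed.

Lemma smulgV (R : realType) : right_inverse sone sinv (@smul R).
Proof.
move=> s; apply: hsim_eq; rewrite /htrans /hdil /=.
  by rewrite -muM mulfV ?mu1 ?mulgV// hdil_neq0.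
by rewrite mulfV// hdil_neq0.
Qed.

HB.instance Definition _ (R : realType) :=
  isGroup.Build (hsim R) (@smulA R) (@smul1g R) (@smulg1 R)
    (@smulVg R) (@smulgV R).

Definition hact {R : realType} (s : hsim R) (p : heis R) : heis R :=
  (htrans s * mu (hdil s) p)%g.

Lemma hact1 (R : realType) (p : heis R) : hact 1%g p = p.
Proof. by rewrite /hact /htrans /hdil /= mu1 mul1g. Qed.

Lemma hactM (R : realType) (s s' : hsim R) (p : heis R) :
  hact (s * s')%g p = hact s (hact s' p).
Proof. by rewrite /hact /htrans /hdil /= muM mu_mulg mulgA. Qed.

Definition hincl {R : realType} (g : heis R) : hsim R :=
  Hsim g (oner_neq0 R[i]).

Definition subgroup {G : groupType} (K : set G) : Prop :=
  K 1%g /\ forall x y, K x -> K y -> K (x * y^-1)%g.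

Definition generated {G : groupType} (A : set G) : set G := smallest subgroup A.

Lemma subgroupV (G : groupType) (K : set G) x :
  subgroup K -> K x -> K x^-1%g.
Proof. by move=> [K1 KD] Kx; rewrite -[x^-1%g]mul1g; exact: KD. Qed.

Lemma subgroupM (G : groupType) (K : set G) x y :
  subgroup K -> K x -> K y -> K (x * y)%g.
Proof.
move=> sK Kx Ky; rewrite -[y]invgK; apply: sK.2 => //.
exact: subgroupV.
Qed.

Definition same_orbit {R : realType} (K : set (hsim R)) : rel (heis R) :=
  fun p q => `[< exists2 s, K s & q = hact s p >].

Lemma same_orbit_equiv (R : realType) (K : set (hsim R)) :
  subgroup K -> equiv_class_of (same_orbit K).
Proof.
move=> sK; split.
- by move=> p; apply/asboolP; exists 1%g; rewrite ?hact1//; exact: sK.1.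
- have sym p q : same_orbit K p q -> same_orbit K q p.
    move=> /asboolP[s Ks ->]; apply/asboolP; exists s^-1%g.
      exact: subgroupV.
    by rewrite -hactM mulVg hact1.
  by move=> p q; apply/idP/idP; exact: sym.
- move=> q p r /asboolP[s Ks ->] /asboolP[s' Ks' ->].
  apply/asboolP; exists (s' * s)%g; first exact: subgroupM.
  by rewrite hactM.
Qed.

Definition orbit_equiv {R : realType} (K : set (hsim R)) (sK : subgroup K) :
  equiv_rel (heis R) := EquivRelPack (same_orbit_equiv sK).

(* The quotient K \ H, with the quotient topology. *)
Definition orbit_space {R : realType} (K : set (hsim R)) (sK : subgroup K) :
  topologicalType := quotient_topology {eq_quot (orbit_equiv sK)}.

(* Each element of K is isolated in K for the topology of H x C^*, a subspace
   of H x C; the exponent ^o selects the usual topology of C. *)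
Definition discrete_subset {R : realType} (K : set (hsim R)) : Prop :=
  forall s, K s ->
    isolated [set (val s' : heis R * (R[i])^o) | s' in K] (val s).

Definition heisenberg_bieberbach {R : realType} (K : set (hsim R)) : Prop :=
  exists sK : subgroup K,
    [/\ forall s, K s -> `|hdil s| = 1,
        discrete_subset K,
        forall s n, K s -> (0 < n)%N -> (s ^+ n)%g = 1%g -> s = 1%g &
        compact [set: orbit_space sK]].

Definition Lambda {R : realType} (tau : R[i]) (c : R) : set (heis R) :=
  generated [set hpt 1 0; hpt tau 0; hpt 0 c].

Lemma imaginary_neq0 (R : realType) : 'i%C != 0 :> R[i].
Proof. by rewrite eq_complex /= oner_eq0 andbF. Qed.

Definition Gamma {R : realType} (c : R) : set (hsim R) :=
  generated (hincl @` Lambda 'i%C c `|`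
             [set Hsim (hpt 0 (c / 4)) (imaginary_neq0 R)]).

Fixpoint C_k {R : realType} (k : nat) (f : heis R -> R) : Prop :=
  if k is k'.+1 then
    (forall p, differentiable f p) /\ (forall v, C_k k' ('D_v f))
  else continuous f.

Definition smooth {R : realType} (f : heis R -> R[i]) : Prop :=
  forall k, C_k k (fun q => complex.Re (f q)) /\ C_k k (fun q => complex.Im (f q)).

(* Directional derivative along v of a complex-valued function. *)
Definition cderive {R : realType} (v : heis R) (f : heis R -> R[i]) :
  heis R -> R[i] :=
  fun p => ('D_v (fun q => complex.Re (f q)) p) +i* ('D_v (fun q => complex.Im (f q)) p).

Definition d_x {R : realType} : (heis R -> R[i]) -> heis R -> R[i] :=
  cderive (hpt 1 0).
Definition d_y {R : realType} : (heis R -> R[i]) -> heis R -> R[i] :=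
  cderive (hpt 'i%C 0).
Definition d_t {R : realType} : (heis R -> R[i]) -> heis R -> R[i] :=
  cderive (hpt 0 1).

Definition d_z {R : realType} (f : heis R -> R[i]) : heis R -> R[i] :=
  fun p => (d_x f p - 'i%C * d_y f p) / 2.
Definition d_zbar {R : realType} (f : heis R -> R[i]) : heis R -> R[i] :=
  fun p => (d_x f p + 'i%C * d_y f p) / 2.

Definition Zop {R : realType} (f : heis R -> R[i]) : heis R -> R[i] :=
  fun p => d_z f p + 'i%C * (zpart p)^* * d_t f p.
Definition Zbarop {R : realType} (f : heis R -> R[i]) : heis R -> R[i] :=
  fun p => d_zbar f p - 'i%C * zpart p * d_t f p.

(* Sub-Laplacian and Reeb vector field of the contact form r theta_H. *)
Definition sublaplacian {R : realType} (r : R) (f : heis R -> R[i]) :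
  heis R -> R[i] :=
  fun p => - (1 / (2 * r))%:C * (Zop (Zbarop f) p + Zbarop (Zop f) p).
Definition reeb {R : realType} (r : R) (f : heis R -> R[i]) :
  heis R -> R[i] :=
  fun p => (1 / r)%:C * d_t f p.

(* Smooth functions on K \ H are the K-invariant smooth functions on H. *)
Definition smooth_on_quotient {R : realType} (K : set (hsim R)) :
  set (heis R -> (R[i])^o) :=
  [set f | smooth f /\ forall s p, K s -> f (hact s p) = f p].

Definition joint_eigenspace {R : realType} (K : set (hsim R)) (r a b : R) :
  set (heis R -> (R[i])^o) :=
  [set f | [/\ smooth_on_quotient K f,
               forall p, sublaplacian r f p = a%:C * f p &
               forall p, 'i%C^-1 * reeb r f p = b%:C * f p]].

Definition has_dim {F : fieldType} {V : lmodType F} (E : set V) (m : nat) :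
  Prop :=
  exists e : 'I_m -> V,
    [/\ forall j, E (e j),
        forall a : 'I_m -> F, \sum_j a j *: e j = 0 -> forall j, a j = 0 &
        forall f, E f -> exists a : 'I_m -> F, f = \sum_j a j *: e j].

(* m is the multiplicity of (a, b) in the joint spectrum of the sub-Laplacian
   and of T / i on K \ H, with contact form r theta_H. *)
Definition multiplicity {R : realType} (K : set (hsim R)) (r a b : R)
  (m : nat) : Prop := has_dim (joint_eigenspace K r a b) m.

Definition gauss_lattice (R : realType) : set R[i] :=
  [set z | exists a b : int, z = a%:~R + b%:~R * 'i%C].

Definition dual_lattice {R : realType} (L : set R[i]) : set R[i] :=
  [set w | forall z, L z -> complex.Re (w * z^*) \is a Num.int].

Definition E_ {R : realType} (r kappa : R) : set R[i] :=
  [set w | dual_lattice (@gauss_lattice R) w /\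
           pi ^+ 2 * Normc.normc w ^+ 2 / r = kappa].

(* Main.v *)
Require Import Defs.
From HB Require Import structures.
From mathcomp Require Import all_boot all_order all_algebra complex.
From mathcomp Require Import all_classical all_reals all_analysis.
From mathcomp Require Import zify ring lra.

(** Invariance under Gamma_c means invariance under the two translations (1, 0) and
    (i, 0) and under the quarter turn g (x, y, t) = (- y, x, t + c / 4), whose fourth
    power is the central translation by c.  A joint eigenfunction is such a function
    f on which d/dt acts as i T and Z Zbar + Zbar Z as a real number
    ([joint_eigenspaceE]).

    Suppose first that n is not 0.  Complex conjugation changes the sign of T, so let
    n > 0; then T = pi D / 2 with D = n N.  On these functions Z and Zbar commute up
    to a constant, so they are the ladder operators of a harmonic oscillator: Z
    maps each level bijectively to the next one and divides the eigenvalue of g by i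
    ([has_dim_landau]).  Hence the k-th level with g = 1 has the dimension of the
    lowest level with g = i^k.  On the lowest level Zbar f is an eigenfunction of
    Z Zbar + Zbar Z for a positive number, so it vanishes by the maximum principle
    ([landau0_Zbar]): up to an explicit factor f is a holomorphic function of x + iy,
    a theta function of degree D.  The Fourier coefficients of f in y are determined
    by D of them, and the theta series with characteristics modulo D form a basis
    ([sections_free], [sections_span]).

    On this basis the translations by 1 / D in y and in x act diagonally and by a
    cyclic shift, and g exchanges them.  This determines the matrix of g up to a
    factor, which is found from the values of the theta series at the origin and
    from g^4 = 1: the matrix is i^n F, where F is the unitary discrete Fourier
    transform of size D ([turn_section]).  So the multiplicity to be computed is
    that of the eigenvalue i^(k - n) of F, where D is even.

    As F^4 = 1, the multiplicities of 1, -1, i and -i add up to D ([mult_sum]), and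
    it is enough to bound each of them from above by numbers that add up to D.  An
    eigenvector of F is even or odd, so if it vanishes outside [- q, q] it is a
    multiple of a cosine or sine polynomial of degree q.  Chebyshev polynomials turn
    this into a polynomial of degree q (q - 1 for sines) in cos th that vanishes at
    all the nodes outside [- q, q].  If there are more nodes than the degree allows,
    the eigenvector is 0; if there are just as many roots as the degree, its sign at
    the next node contradicts the eigenvalues -1 and -i ([eigen_eq0]).  So an
    eigenvector is determined by its coordinates outside [- q, q], which are few up
    to sign ([mult_le], [mult_even], [mult_odd]).

    If n = 0 the function does not depend on t and is a doubly periodic eigenfunction
    of the flat Laplacian.  Integration by parts against plane waves shows that its
    Fourier coefficients are supported on the lattice points (a, b) of the circle
    a^2 + b^2 = kappa r / pi^2.  The quarter turn permutes these points in orbits of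
    length four, and the sums of the plane waves over the orbits form a basis of
    the eigenspace ([has_dim_flat]). *)

Set Implicit Arguments.
Unset Strict Implicit.
Unset Printing Implicit Defensive.

Import Order.TTheory GRing.Theory Num.Theory.
Import numFieldNormedType.Exports.

Local Open Scope classical_set_scope.
Local Open Scope ring_scope.
Local Open Scope complex_scope.


(** * Smooth real functions on the Heisenberg group *)

Section RealSmooth.
Variable R : realType.
Local Notation H := (heis R).
Implicit Types (f g : H -> R) (p v : H) (k : nat).

(** The real case of [smooth]; a complex function is handled through its two
    real parts. *)
Definition rsmooth f := forall k, C_k k f.

Lemma Ck_pred k f : C_k k.+1 f -> C_k k f.
Proof.
elim: k f => [|k IHk] f /= [df Df].
  by move=> p; exact: differentiable_continuous.
by split=> // v; apply: IHk; exact: Df.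
Qed.

Lemma rsmooth_differentiable f : rsmooth f -> forall p, differentiable f p.
Proof. by move=> /(_ 1) /= []. Qed.

Lemma rsmooth_derivable f p v : rsmooth f -> derivable f p v.
Proof. by move=> /rsmooth_differentiable df; exact: diff_derivable. Qed.

Lemma rsmooth_derive f v : rsmooth f -> rsmooth ('D_v f).
Proof. by move=> sf k; have [_] := sf k.+1; exact. Qed.

Lemma rsmooth_continuous f : rsmooth f -> continuous f.
Proof. by move=> /(_ 0). Qed.

Lemma Ck_cst k (a : R) : C_k k (cst a : H -> R).
Proof.
elim: k a => [|k IHk] a /=; first by move=> p; exact: cst_continuous.
split=> [p|v]; first exact: differentiable_cst.
have -> : 'D_v (cst a : H -> R) = cst 0 by apply/funext => p; rewrite derive_cst.
exact: IHk.
Qed.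

Lemma Ck_add k f g : C_k k f -> C_k k g -> C_k k (f \+ g).
Proof.
elim: k f g => [|k IHk] f g /=.
  by move=> cf cg p; apply: continuousD; [exact: cf|exact: cg].
move=> [df Df] [dg Dg]; split=> [p|v]; first exact: differentiableD.
have -> : 'D_v (f \+ g) = 'D_v f \+ 'D_v g.
  by apply/funext => p; rewrite deriveD//; exact: diff_derivable.
by apply: IHk; [exact: Df|exact: Dg].
Qed.

Lemma Ck_mul k f g : C_k k f -> C_k k g -> C_k k (f \* g).
Proof.
elim: k f g => [|k IHk] f g.
  by move=> cf cg p; apply: continuousM; [exact: cf|exact: cg].
move=> Cf Cg; have [df Df] := Cf; have [dg Dg] := Cg.
split=> [p|v]; first exact: differentiableM.
have -> : 'D_v (f \* g) = (f \* 'D_v g) \+ (g \* 'D_v f).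
  by apply/funext => p; rewrite deriveM//; exact: diff_derivable.
by apply: Ck_add; apply: IHk; [exact: Ck_pred|exact: Dg|exact: Ck_pred|exact: Df].
Qed.

Lemma rsmooth_cst (a : R) : rsmooth (cst a : H -> R).
Proof. by move=> k; exact: Ck_cst. Qed.

Lemma rsmooth_add f g : rsmooth f -> rsmooth g -> rsmooth (fun p => f p + g p).
Proof. by move=> sf sg k; exact: Ck_add. Qed.

Lemma rsmooth_mul f g : rsmooth f -> rsmooth g -> rsmooth (fun p => f p * g p).
Proof. by move=> sf sg k; exact: Ck_mul. Qed.

Lemma rsmooth_opp f : rsmooth f -> rsmooth (fun p => - f p).
Proof.
move=> sf; rewrite (_ : (fun p => - f p) = fun p => cst (-1) p * f p).
  by apply: rsmooth_mul => //; exact: rsmooth_cst.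
by apply/funext => p; rewrite mulN1r.
Qed.

Lemma rsmooth_sub f g : rsmooth f -> rsmooth g -> rsmooth (fun p => f p - g p).
Proof. by move=> sf sg; apply: rsmooth_add => //; exact: rsmooth_opp. Qed.

Lemma derive_linear (L : {linear H -> R}) : continuous L ->
  forall p v, 'D_v L p = L v.
Proof.
by move=> cL p v; rewrite deriveE ?diff_lin//; exact: linear_differentiable.
Qed.

Lemma rsmooth_linear (L : {linear H -> R}) : continuous L -> rsmooth L.
Proof.
move=> cL [|k] //=; split=> [p|v]; first exact: linear_differentiable.
rewrite (_ : 'D_v L = cst (L v)); first exact: Ck_cst.
by apply/funext => p; rewrite derive_linear.
Qed.


Definition xcoord (p : H) : R := p.1.1.
Definition ycoord (p : H) : R := p.1.2.
Definition tcoord (p : H) : R := p.2.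

Lemma xcoord_linear : linear xcoord. Proof. by []. Qed.
Lemma ycoord_linear : linear ycoord. Proof. by []. Qed.
Lemma tcoord_linear : linear tcoord. Proof. by []. Qed.
HB.instance Definition _ := GRing.isLinear.Build R H R _ xcoord xcoord_linear.
HB.instance Definition _ := GRing.isLinear.Build R H R _ ycoord ycoord_linear.
HB.instance Definition _ := GRing.isLinear.Build R H R _ tcoord tcoord_linear.

Lemma continuous_xcoord : continuous xcoord.
Proof.
by move=> p; apply: (@cvg_comp _ _ _ fst fst _ (nbhs p.1)); exact: cvg_fst.
Qed.
Lemma continuous_ycoord : continuous ycoord.
Proof.
move=> p; apply: (@cvg_comp _ _ _ fst snd _ (nbhs p.1)); first exact: cvg_fst.
exact: cvg_snd.
Qed.
Lemma continuous_tcoord : continuous tcoord.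
Proof. by move=> p; exact: cvg_snd. Qed.

Lemma rsmooth_x : rsmooth xcoord.
Proof. exact/rsmooth_linear/continuous_xcoord. Qed.
Lemma rsmooth_y : rsmooth ycoord.
Proof. exact/rsmooth_linear/continuous_ycoord. Qed.
Lemma rsmooth_t : rsmooth tcoord.
Proof. exact/rsmooth_linear/continuous_tcoord. Qed.

Lemma derive_x p v : 'D_v xcoord p = v.1.1.
Proof. by rewrite derive_linear//; exact: continuous_xcoord. Qed.
Lemma derive_y p v : 'D_v ycoord p = v.1.2.
Proof. by rewrite derive_linear//; exact: continuous_ycoord. Qed.
Lemma derive_t p v : 'D_v tcoord p = v.2.
Proof. by rewrite derive_linear//; exact: continuous_tcoord. Qed.

(** The chain rule with a function of one real variable on the outside, stated
    with [is_derive] so that the derivatives of exp, cos and sin apply directly. *)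
Lemma derive_comp_real (h : R -> R) (dh : R) f p v :
  differentiable f p -> is_derive (f p) 1 h dh ->
  differentiable (h \o f) p /\ 'D_v (h \o f) p = dh * 'D_v f p.
Proof.
move=> df hdh; have dh1 : derivable h (f p) 1 by exact: ex_derive.
have dhf : differentiable h (f p) by exact/derivable1_diffP.
have dc : differentiable (h \o f) p by exact: differentiable_comp.
split=> //; rewrite deriveE// diff_comp//= deriv1E// derive1E derive_val.
by rewrite -deriveE// mulrC.
Qed.

Lemma Ck_exp k f : C_k k f -> C_k k (expR \o f).
Proof.
elim: k f => [|k IHk] f Cf.
  by move=> p; apply: continuous_comp; [exact: Cf|exact: continuous_expR].
have [df Df] := Cf; have de p v := derive_comp_real v (df p) (is_derive_expR (f p)).
split=> [p|v]; first by have [] := de p 0.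
rewrite (_ : 'D_v (expR \o f) = (expR \o f) \* 'D_v f).
  by apply: Ck_mul; [exact/IHk/Ck_pred|exact: Df].
by apply/funext => p; have [_ ->] := de p v.
Qed.

Lemma Ck_cos_sin k f : C_k k f -> C_k k (cos \o f) /\ C_k k (sin \o f).
Proof.
elim: k f => [|k IHk] f Cf.
  split=> p; (apply: continuous_comp; first exact: Cf).
    exact: continuous_cos.
  exact: continuous_sin.
have [df Df] := Cf; have [Cc Cs] := IHk f (Ck_pred Cf).
have dc p v := derive_comp_real v (df p) (is_derive_cos (f p)).
have ds p v := derive_comp_real v (df p) (is_derive_sin (f p)).
split; split=> [p|v]; [by have [] := dc p 0| |by have [] := ds p 0|].
  rewrite (_ : 'D_v (cos \o f) = (cst (-1) \* (sin \o f)) \* 'D_v f).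
    by apply: Ck_mul; [apply: Ck_mul => //; exact: Ck_cst|exact: Df].
  by apply/funext => p; have [_ ->] := dc p v; rewrite /= mulN1r.
rewrite (_ : 'D_v (sin \o f) = (cos \o f) \* 'D_v f).
  by apply: Ck_mul => //; exact: Df.
by apply/funext => p; have [_ ->] := ds p v.
Qed.

Lemma rsmooth_exp f : rsmooth f -> rsmooth (fun p => expR (f p)).
Proof. by move=> sf k; exact: Ck_exp. Qed.

Lemma rsmooth_cos f : rsmooth f -> rsmooth (fun p => cos (f p)).
Proof. by move=> sf k; have [] := Ck_cos_sin (sf k). Qed.

Lemma rsmooth_sin f : rsmooth f -> rsmooth (fun p => sin (f p)).
Proof. by move=> sf k; have [] := Ck_cos_sin (sf k). Qed.

(** Smooth maps of the group to itself that are affine in the coordinates: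
    left translations and the rotation are of this kind. *)
Definition affine_map (A L : H -> H) :=
  (forall h v p, A (h *: v + p) = h *: L v + A p) /\
  (forall p, differentiable A p).

Lemma derive_affine (W : normedModType R) (f : H -> W) A L p v :
  affine_map A L -> 'D_v (f \o A) p = 'D_(L v) f (A p).
Proof.
move=> [AL _]; rewrite /derive.
have -> // : (fun h : R => h^-1 *: (((f \o A) \o shift p) (h *: v) - (f \o A) p)) =
  fun h => h^-1 *: ((f \o shift (A p)) (h *: L v) - f (A p)).
by apply/funext => h /=; rewrite AL.
Qed.

Lemma Ck_affine k f A L : affine_map A L -> C_k k f -> C_k k (f \o A).
Proof.
move=> hA; have [_ dA] := hA; elim: k f => [|k IHk] f /=.
  move=> cf p; apply: continuous_comp; last exact: cf.
  exact: differentiable_continuous.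
move=> [df Df]; split=> [p|v]; first exact: differentiable_comp.
rewrite (_ : 'D_v (f \o A) = 'D_(L v) f \o A); first exact/IHk/Df.
by apply/funext => p; exact: derive_affine hA.
Qed.

Lemma rsmooth_affine f A L :
  affine_map A L -> rsmooth f -> rsmooth (fun p => f (A p)).
Proof. by move=> hA sf k; exact: Ck_affine hA (sf k). Qed.

(** Differentiability is a condition on the three coordinates, which the
    lemmas on [rsmooth] settle. *)
Lemma affine_mapI (A L : H -> H) :
  (forall h v p, A (h *: v + p) = h *: L v + A p) ->
  rsmooth (fun p => (A p).1.1) -> rsmooth (fun p => (A p).1.2) ->
  rsmooth (fun p => (A p).2) -> affine_map A L.
Proof.
move=> AL s1 s2 s3; split=> // p.
rewrite (_ : A = fun q => (((A q).1.1, (A q).1.2), (A q).2)).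
  have dA := differentiable_pair (rsmooth_differentiable s1 p)
    (rsmooth_differentiable s2 p).
  exact: (differentiable_pair dA (rsmooth_differentiable s3 p)).
by apply/funext => q; case: (A q) => [[]].
Qed.

Lemma is_derive_line f p v (s : R) : rsmooth f ->
  is_derive s 1 (fun s => f (s *: v + p)) ('D_v f (s *: v + p)).
Proof.
move=> sf; have df : derivable f (s *: v + p) v by exact: rsmooth_derivable.
have E : (fun h : R => h^-1 *: (((fun s => f (s *: v + p)) \o shift s) (h *: 1) -
   (fun s => f (s *: v + p)) s)) =
   fun h => h^-1 *: ((f \o shift (s *: v + p)) (h *: v) - f (s *: v + p)).
  apply/funext => h /=; congr (_ *: (f _ - _)).
  by rewrite [h *: 1]mulr1 scalerDl addrA.
by apply: DeriveDef; [rewrite /derivable E|rewrite /derive E].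
Qed.

Lemma derive_dirD f p v w (a b : R) : rsmooth f ->
  'D_(a *: v + b *: w) f p = a * 'D_v f p + b * 'D_w f p.
Proof.
move=> sf; have df := rsmooth_differentiable sf p.
by rewrite !deriveE// linearD !linearZ.
Qed.

End RealSmooth.

Section Schwarz.
Variable R : realType.
Local Notation H := (heis R).
Implicit Types (f g : H -> R) (p v w : H).

(** A mean value theorem without conditions at the end points. *)
Lemma MVT_real (u du : R -> R) (a b : R) : a < b ->
  (forall x : R, is_derive x 1 u (du x)) ->
  exists2 c, a < c < b & u b - u a = du c * (b - a).
Proof.
move=> ab hu; have [c cab e] : exists2 c, c \in `]a, b[ & u b - u a = du c * (b - a).
  apply: MVT => //; apply: derivable_within_continuous => x _.
  exact: ex_derive.
by exists c => //; move: cab; rewrite in_itv.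
Qed.

(** The second difference of f is an increment of an increment in either order,
   so both iterated derivatives have values at points close to p in common. *)
Lemma derive_comm f p v w : rsmooth f -> 'D_v ('D_w f) p = 'D_w ('D_v f) p.
Proof.
move=> sf.
have mean_mixed v' w' (h : R) : 0 < h -> exists s k, [/\ 0 <= s <= h, 0 <= k <= h &
    f (h *: v' + (h *: w' + p)) - f (h *: v' + p) - (f (h *: w' + p) - f p) =
    'D_w' ('D_v' f) (k *: w' + (s *: v' + p)) * h * h].
  move=> h0.
  have d1 (s : R) : is_derive s 1
      (fun s => f (s *: v' + (h *: w' + p)) - f (s *: v' + p))
      ('D_v' f (s *: v' + (h *: w' + p)) - 'D_v' f (s *: v' + p)).
    by apply: is_deriveB; exact: is_derive_line.
  have [s sh /= es] := MVT_real h0 d1.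
  have d2 (k : R) : is_derive k 1 (fun k => 'D_v' f (k *: w' + (s *: v' + p)))
      ('D_w' ('D_v' f) (k *: w' + (s *: v' + p))).
    by apply: is_derive_line; exact: rsmooth_derive.
  have [k kh /= ek] := MVT_real h0 d2.
  exists s, k; split; [by case/andP: sh => *; rewrite !ltW|by case/andP: kh => *; rewrite !ltW|].
  move: es ek; rewrite !scale0r !add0r !subr0 => es ek.
  move: ek; rewrite [h *: w' + (_ + _)]addrCA => ek.
  by rewrite -ek -es; ring.
apply/eqP; rewrite -subr_eq0; apply/negPn/negP => ne.
set a := 'D_v ('D_w f) p in ne; set b := 'D_w ('D_v f) p in ne.
pose e := `|a - b| / 2; have e0 : 0 < e by rewrite divr_gt0 // normr_gt0.
have near1 (g : H -> R) : rsmooth g -> exists2 d : R, 0 < d &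
    forall q, `|q - p| < d -> `|g p - g q| < e.
  move=> /rsmooth_continuous /(_ p) /cvgrPdist_lt /(_ e e0) /nbhs_ballP [d /= d0 hd].
  by exists d => // q qp; apply: hd; rewrite -ball_normE /= distrC.
have [d1 d10 h1] := near1 _ (rsmooth_derive v (rsmooth_derive w sf)).
have [d2 d20 h2] := near1 _ (rsmooth_derive w (rsmooth_derive v sf)).
pose d := Num.min d1 d2; pose M := `|v| + `|w| + 1.
have d0 : 0 < d by rewrite lt_min d10.
have M0 : 0 < M by rewrite ltr_wpDl// addr_ge0.
pose h := d / M; have h0 : 0 < h by rewrite divr_gt0.
have small s k : 0 <= s <= h -> 0 <= k <= h -> forall v' w' : H, `|v'| + `|w'| = `|v| + `|w| ->
    `|k *: w' + (s *: v' + p) - p| < d.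
  move=> /andP[s0 sh] /andP[k0 kh] v' w' vw; rewrite addrA addrK.
  rewrite (le_lt_trans (ler_normD _ _))// !normrZ !ger0_norm//.
  apply: (@le_lt_trans _ _ (h * `|w'| + h * `|v'|)).
    by apply: lerD; apply: ler_wpM2r.
  by rewrite -mulrDr addrC vw /h mulrAC ltr_pdivrMr// ltr_pM2l// ltrDl.
have [s [k [hs hk E1]]] := mean_mixed v w h h0.
have [s' [k' [hs' hk' E2]]] := mean_mixed w v h h0.
have E : 'D_v ('D_w f) (k' *: v + (s' *: w + p)) =
         'D_w ('D_v f) (k *: w + (s *: v + p)).
  apply: (mulIf (lt0r_neq0 h0)); apply: (mulIf (lt0r_neq0 h0)).
  refine (etrans (esym E2) _); refine (etrans _ E1).
  rewrite [h *: w + (h *: v + p)]addrCA.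
  move: (f (h *: v + (h *: w + p))) (f (h *: w + p)) (f (h *: v + p)) (f p).
  by move=> *; ring.
have dd1 : d <= d1 by rewrite ge_min lexx.
have dd2 : d <= d2 by rewrite ge_min lexx orbT.
have A1 := h1 _ (lt_le_trans (small _ _ hs' hk' w v (addrC _ _)) dd1).
have A2 := h2 _ (lt_le_trans (small _ _ hs hk v w erefl) dd2).
rewrite E in A1.
have far (x : R) : `|a - x| < `|a - b| / 2 -> `|b - x| < `|a - b| / 2 -> False.
  move=> ax bx; suff : `|a - b| < `|a - b| / 2 + `|a - b| / 2 by rewrite -splitr ltxx.
  apply: le_lt_trans (ltrD ax bx); apply: le_trans (ler_normB _ _).
  by rewrite opprB addrA subrK.
exact: far A1 A2.
Qed.
End Schwarz.

(** * Smooth complex functions on the Heisenberg group *)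

(** Polynomial identities between complex numbers given by their real and
    imaginary parts. *)
Ltac cring := apply/eqP; rewrite eq_complex /=; apply/andP; split; apply/eqP; ring.

Section ComplexSmooth.
Variable R : realType.
Local Notation H := (heis R).
Implicit Types (f g : H -> R[i]) (p v w : H) (A L : H -> H).

Lemma Re_mul (a b : R[i]) : complex.Re (a * b) = complex.Re a * complex.Re b - complex.Im a * complex.Im b.
Proof. by case: a b => [? ?] []. Qed.

Lemma Im_mul (a b : R[i]) : complex.Im (a * b) = complex.Re a * complex.Im b + complex.Im a * complex.Re b.
Proof. by case: a b => [? ?] [? ?]. Qed.

Lemma Re_add (a b : R[i]) : complex.Re (a + b) = complex.Re a + complex.Re b.
Proof. by case: a b => [? ?] []. Qed.

Lemma Im_add (a b : R[i]) : complex.Im (a + b) = complex.Im a + complex.Im b.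
Proof. by case: a b => [? ?] []. Qed.

Lemma smoothP f : smooth f <->
  rsmooth (fun p => complex.Re (f p)) /\ rsmooth (fun p => complex.Im (f p)).
Proof. by split=> [sf|[s1 s2] k]; [split=> k; have [] := sf k|split; [exact: s1|exact: s2]]. Qed.

Lemma smooth_cst (a : R[i]) : smooth (fun _ : H => a).
Proof. by apply/smoothP; split; exact: rsmooth_cst. Qed.

Lemma smooth_add f g : smooth f -> smooth g -> smooth (fun p => f p + g p).
Proof.
move=> /smoothP[f1 f2] /smoothP[g1 g2]; apply/smoothP; split.
  under eq_fun do rewrite Re_add; exact: rsmooth_add.
under eq_fun do rewrite Im_add; exact: rsmooth_add.
Qed.

Lemma smooth_mul f g : smooth f -> smooth g -> smooth (fun p => f p * g p).
Proof.
move=> /smoothP[f1 f2] /smoothP[g1 g2]; apply/smoothP; split.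
  under eq_fun do rewrite Re_mul.
  by apply: rsmooth_sub; exact: rsmooth_mul.
under eq_fun do rewrite Im_mul.
by apply: rsmooth_add; exact: rsmooth_mul.
Qed.

Lemma smoothZ (a : R[i]) f : smooth f -> smooth (fun p => a * f p).
Proof. by apply: smooth_mul; exact: smooth_cst. Qed.

Lemma smooth_opp f : smooth f -> smooth (fun p => - f p).
Proof. by under [X in _ -> smooth X]eq_fun do rewrite -mulN1r; exact: smoothZ. Qed.

Lemma smooth_sub f g : smooth f -> smooth g -> smooth (fun p => f p - g p).
Proof. by move=> sf /smooth_opp; exact: smooth_add. Qed.

Lemma smooth_sum (I : finType) (F : I -> H -> R[i]) :
  (forall i, smooth (F i)) -> smooth (fun p => \sum_i F i p).
Proof.
move=> sF; elim: (index_enum I) => [|i s IHs].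
  by under eq_fun do rewrite big_nil; exact: smooth_cst.
by under eq_fun do rewrite big_cons; exact: smooth_add.
Qed.

Lemma smooth_conj f : smooth f -> smooth (fun p => (f p)^*).
Proof.
move=> /smoothP[f1 f2]; apply/smoothP; split.
  by rewrite (_ : (fun p => _) = fun p => complex.Re (f p))//; apply/funext => p; case: (f p).
rewrite (_ : (fun p => _) = fun p => - complex.Im (f p)); first exact: rsmooth_opp.
by apply/funext => p; case: (f p).
Qed.

Lemma smooth_cderive v f : smooth f -> smooth (cderive v f).
Proof. by move=> /smoothP[f1 f2]; apply/smoothP; split; exact: rsmooth_derive. Qed.

Lemma smooth_affine A L f : affine_map A L -> smooth f -> smooth (fun p => f (A p)).
Proof.
by move=> hA /smoothP[f1 f2]; apply/smoothP; split;
  [exact: (rsmooth_affine hA f1)|exact: (rsmooth_affine hA f2)].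
Qed.

Lemma smooth_real (u : H -> R) : rsmooth u -> smooth (fun p => (u p)%:C).
Proof. by move=> su; apply/smoothP; split=> //; exact: rsmooth_cst. Qed.

Lemma complex_congr (a b c d : R) : a = c -> b = d -> a +i* b = c +i* d.
Proof. by move=> -> ->. Qed.

Lemma cderive_cst v (a : R[i]) p : cderive v (fun _ => a) p = 0.
Proof. by rewrite /cderive; apply: complex_congr; [exact: (derive_cst (complex.Re a))|exact: (derive_cst (complex.Im a))]. Qed.

Lemma cderive_add v f g p : smooth f -> smooth g ->
  cderive v (fun p => f p + g p) p = cderive v f p + cderive v g p.
Proof.
move=> /smoothP[f1 f2] /smoothP[g1 g2].
apply: complex_congr => /=.
  under eq_fun do rewrite Re_add.
  by rewrite -deriveD//; exact: rsmooth_derivable.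
under eq_fun do rewrite Im_add.
by rewrite -deriveD//; exact: rsmooth_derivable.
Qed.

Lemma derive_mul (u1 u2 : H -> R) p v : rsmooth u1 -> rsmooth u2 ->
  'D_v (fun p => u1 p * u2 p) p = u1 p * 'D_v u2 p + u2 p * 'D_v u1 p.
Proof. by move=> s1 s2; apply: deriveM; exact: rsmooth_derivable. Qed.

Lemma derive_add (u1 u2 : H -> R) p v : rsmooth u1 -> rsmooth u2 ->
  'D_v (fun p => u1 p + u2 p) p = 'D_v u1 p + 'D_v u2 p.
Proof. by move=> s1 s2; apply: deriveD; exact: rsmooth_derivable. Qed.

Lemma derive_sub (u1 u2 : H -> R) p v : rsmooth u1 -> rsmooth u2 ->
  'D_v (fun p => u1 p - u2 p) p = 'D_v u1 p - 'D_v u2 p.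
Proof. by move=> s1 s2; apply: deriveB; exact: rsmooth_derivable. Qed.

Lemma derive_opp (u : H -> R) p v : rsmooth u ->
  'D_v (fun p => - u p) p = - 'D_v u p.
Proof. by move=> s1; apply: deriveN; exact: rsmooth_derivable. Qed.

Lemma cderive_mul v f g p : smooth f -> smooth g ->
  cderive v (fun p => f p * g p) p = cderive v f p * g p + f p * cderive v g p.
Proof.
move=> /smoothP[f1 f2] /smoothP[g1 g2].
have [m1 m2] := (rsmooth_mul f1 g1, rsmooth_mul f2 g2).
have [m3 m4] := (rsmooth_mul f1 g2, rsmooth_mul f2 g1).
rewrite /cderive.
under eq_fun do rewrite Re_mul.
under [X in _ +i* 'D_v X p]eq_fun do rewrite Im_mul.
rewrite derive_sub// derive_add// !derive_mul//.
move: ('D_v _ p) ('D_v _ p) ('D_v _ p) ('D_v _ p) (f p) (g p) => a b c d [f' f''] [g' g''].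
cring.
Qed.

Lemma cderiveZ v (a : R[i]) f p : smooth f ->
  cderive v (fun p => a * f p) p = a * cderive v f p.
Proof.
move=> sf; rewrite cderive_mul//; last exact: smooth_cst.
by rewrite cderive_cst mul0r add0r.
Qed.

Lemma cderive_opp v f p : smooth f ->
  cderive v (fun p => - f p) p = - cderive v f p.
Proof. by move=> sf; under eq_fun do rewrite -mulN1r; rewrite cderiveZ// mulN1r. Qed.

Lemma cderive_sub v f g p : smooth f -> smooth g ->
  cderive v (fun p => f p - g p) p = cderive v f p - cderive v g p.
Proof.
by move=> sf sg; rewrite cderive_add ?cderive_opp//; exact: smooth_opp.
Qed.

Lemma cderive_conj v f p : smooth f ->
  cderive v (fun p => (f p)^*) p = (cderive v f p)^*.
Proof.
move=> /smoothP[f1 f2]; apply: complex_congr.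
  by congr ('D_v _ _); apply/funext => q; case: (f q).
rewrite -derive_opp//; congr ('D_v _ _).
by apply/funext => q; case: (f q).
Qed.

Lemma cderive_affine v f A L p : affine_map A L ->
  cderive v (fun p => f (A p)) p = cderive (L v) f (A p).
Proof. by move=> hA; apply: complex_congr; exact: derive_affine hA. Qed.

Lemma cderive_dir v w (a b : R) f p : smooth f ->
  cderive (a *: v + b *: w) f p = a%:C * cderive v f p + b%:C * cderive w f p.
Proof.
move=> /smoothP[f1 f2]; rewrite /cderive !derive_dirD//.
move: ('D_v _ p) ('D_v _ p) ('D_w _ p) ('D_w _ p) => c d c' d'; cring.
Qed.

Lemma cderive_comm v w f p : smooth f ->
  cderive v (cderive w f) p = cderive w (cderive v f) p.
Proof. by move=> /smoothP[f1 f2]; apply: complex_congr; exact: derive_comm. Qed.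

Definition cexp (w : R[i]) : R[i] :=
  (expR (complex.Re w) * cos (complex.Im w)) +i*
  (expR (complex.Re w) * sin (complex.Im w)).

Lemma cexpD (a b : R[i]) : cexp (a + b) = cexp a * cexp b.
Proof.
rewrite /cexp Re_add Im_add expRD cosD sinD.
by case: a b => [a1 a2] [b1 b2] /=; cring.
Qed.

Lemma cexp0 : cexp 0 = 1.
Proof. by rewrite /cexp /= expR0 cos0 sin0 mulr0 mulr1. Qed.

Lemma cexpNK (a : R[i]) : cexp (- a) * cexp a = 1.
Proof. by rewrite -cexpD addNr cexp0. Qed.

Lemma cexp_neq0 (a : R[i]) : cexp a != 0.
Proof.
apply/eqP => e; have := cexpNK a; rewrite e mulr0 => /eqP.
by rewrite eq_sym oner_eq0.
Qed.

Lemma cexpN (a : R[i]) : cexp (- a) = (cexp a)^-1.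
Proof. by apply: (mulIf (cexp_neq0 a)); rewrite cexpNK mulVf ?cexp_neq0. Qed.

Lemma cexp_real (a : R) : cexp a%:C = (expR a)%:C.
Proof. by rewrite /cexp /= cos0 sin0 mulr0 mulr1. Qed.

Lemma cexpMn (a : R[i]) n : cexp (a *+ n) = cexp a ^+ n.
Proof. by elim: n => [|n IHn]; rewrite ?mulr0n ?cexp0 ?expr0// mulrS cexpD IHn exprS. Qed.

Lemma cexp_2pi : cexp ('i%C * (2 * pi)%:C) = 1.
Proof.
rewrite /cexp /= !mul0r !mul1r subr0 add0r expR0 !mul1r.
by rewrite mulr_natl cos2pi sin2pi.
Qed.

Lemma smooth_cexp f : smooth f -> smooth (fun p => cexp (f p)).
Proof.
by move=> /smoothP[f1 f2]; apply/smoothP; split; apply: rsmooth_mul;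
  [exact: rsmooth_exp|exact: rsmooth_cos|exact: rsmooth_exp|exact: rsmooth_sin].
Qed.

Lemma cderive_cexp v f p : smooth f ->
  cderive v (fun p => cexp (f p)) p = cderive v f p * cexp (f p).
Proof.
move=> /smoothP[f1 f2].
have [e c s] := And3 (rsmooth_exp f1) (rsmooth_cos f2) (rsmooth_sin f2).
have df1 := rsmooth_differentiable f1 p; have df2 := rsmooth_differentiable f2 p.
rewrite /cderive !derive_mul//.
have [_ ->] := derive_comp_real v df1 (is_derive_expR _).
have [_ ->] := derive_comp_real v df2 (is_derive_cos _).
have [_ ->] := derive_comp_real v df2 (is_derive_sin _).
rewrite /cexp; move: ('D_v _ p) ('D_v _ p) (f p) => a b [c' d] /=; cring.
Qed.

End ComplexSmooth.

(** * The invariant vector fields and the symmetries *)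

Section VectorFields.
Variable R : realType.
Local Notation H := (heis R).
Implicit Types (f g : H -> R[i]) (p q v : H) (a b s t : R).

Lemma heis_mulE a b s x y t :
  (((a, b, s) : H) * ((x, y, t) : H))%g =
  (a + x, b + y, s + t + 2 * (b * x - a * y)) :> H.
Proof.
rewrite -[LHS]/(hmul _ _) /hmul /hpt /zpart /tpart /=.
by congr (_, _, _); ring.
Qed.

Lemma affine_ltrans a b s :
  affine_map (fun p : H => (((a, b, s) : H) * p)%g)
    (fun p : H => (p.1.1, p.1.2, p.2 + 2 * (b * p.1.1 - a * p.1.2)) : H).
Proof.
have E (p : H) : (((a, b, s) : H) * p)%g =
  (a + xcoord p, b + ycoord p, s + tcoord p + 2 * (b * xcoord p - a * ycoord p)) :> H.
  by case: p => [[x y] t]; rewrite heis_mulE.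
have [X [Y T]] := (rsmooth_x R, (rsmooth_y R, rsmooth_t R)).
apply: affine_mapI => [h v p|||].
- rewrite !E; case: v p => [[v1 v2] v3] [[x y] t].
  rewrite /xcoord /ycoord /tcoord /=.
  by congr (_, _, _); rewrite /= /GRing.scale /=; ring.
- under eq_fun do rewrite E; apply: rsmooth_add => //; exact: rsmooth_cst.
- under eq_fun do rewrite E; apply: rsmooth_add => //; exact: rsmooth_cst.
- under eq_fun do rewrite E.
  apply: rsmooth_add; first by apply: rsmooth_add => //; exact: rsmooth_cst.
  apply: rsmooth_mul; first exact: rsmooth_cst.
  by apply: rsmooth_sub; apply: rsmooth_mul => //; exact: rsmooth_cst.
Qed.

(** The action of the element (0, s) mu(i) of the similarity group. *)
Definition turn (s : R) (p : H) : H := (- p.1.2, p.1.1, s + p.2).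

Lemma affine_turn s : affine_map (turn s) (turn 0).
Proof.
have [X [Y T]] := (rsmooth_x R, (rsmooth_y R, rsmooth_t R)).
apply: affine_mapI => [h [[v1 v2] v3] [[x y] t]|||].
- by rewrite /turn /=; congr (_, _, _); rewrite /= /GRing.scale /=; ring.
- exact: rsmooth_opp.
- exact: X.
- by apply: rsmooth_add => //; exact: rsmooth_cst.
Qed.

Definition e_x : H := hpt 1 0.
Definition e_y : H := hpt 'i%C 0.
Definition e_t : H := hpt 0 1.

(** X and Y are the real left-invariant fields with Z = (X - i Y) / 2. *)
Definition Xop f : H -> R[i] := fun p => cderive e_x f p + (2 * p.1.2)%:C * cderive e_t f p.
Definition Yop f : H -> R[i] := fun p => cderive e_y f p - (2 * p.1.1)%:C * cderive e_t f p.

Lemma smooth_2x : smooth (fun p : H => (2 * p.1.1)%:C : R[i]).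
Proof.
apply: smooth_real; apply: rsmooth_mul; first exact: rsmooth_cst.
exact: rsmooth_x.
Qed.

Lemma smooth_2y : smooth (fun p : H => (2 * p.1.2)%:C : R[i]).
Proof.
apply: smooth_real; apply: rsmooth_mul; first exact: rsmooth_cst.
exact: rsmooth_y.
Qed.

Lemma smooth_X f : smooth f -> smooth (Xop f).
Proof.
move=> sf; apply: smooth_add; first exact: smooth_cderive.
by apply: smooth_mul; [exact: smooth_2y|exact: smooth_cderive].
Qed.

Lemma smooth_Y f : smooth f -> smooth (Yop f).
Proof.
move=> sf; apply: smooth_sub; first exact: smooth_cderive.
by apply: smooth_mul; [exact: smooth_2x|exact: smooth_cderive].
Qed.

Lemma cderive_2x v p : cderive v (fun p : H => (2 * p.1.1)%:C : R[i]) p = (2 * v.1.1)%:C.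
Proof.
rewrite /cderive /= -[RHS]/((2 * v.1.1) +i* 0). apply: complex_congr; last exact: (derive_cst (0:R)).
by rewrite derive_mul ?derive_x ?(derive_cst (2:R)) ?mulr0 ?addr0//;
  [exact: rsmooth_cst|exact: rsmooth_x].
Qed.

Lemma cderive_2y v p : cderive v (fun p : H => (2 * p.1.2)%:C : R[i]) p = (2 * v.1.2)%:C.
Proof.
rewrite /cderive /= -[RHS]/((2 * v.1.2) +i* 0); apply: complex_congr; last exact: (derive_cst (0:R)).
by rewrite derive_mul ?derive_y ?(derive_cst (2:R)) ?mulr0 ?addr0//;
  [exact: rsmooth_cst|exact: rsmooth_y].
Qed.

Lemma Xop_comb (a b : R[i]) f g p : smooth f -> smooth g ->
  Xop (fun p => a * f p + b * g p) p = a * Xop f p + b * Xop g p.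
Proof.
move=> sf sg; have [saf sbg] := (smoothZ a sf, smoothZ b sg).
by rewrite /Xop !cderive_add// !cderiveZ//; ring.
Qed.

Lemma Yop_comb (a b : R[i]) f g p : smooth f -> smooth g ->
  Yop (fun p => a * f p + b * g p) p = a * Yop f p + b * Yop g p.
Proof.
move=> sf sg; have [saf sbg] := (smoothZ a sf, smoothZ b sg).
by rewrite /Yop !cderive_add// !cderiveZ//; ring.
Qed.

Lemma ZopE f : Zop f = fun p => 2^-1 * Xop f p + (- ('i%C / 2)) * Yop f p.
Proof.
apply/funext => p; rewrite /Zop /d_z /d_x /d_y /d_t /Xop /Yop -/e_x -/e_y -/e_t.
rewrite /zpart; move: (cderive _ _ _) (cderive _ _ _) (cderive _ _ _) => [a a'] [b b'] [c c'].
case: p => [[x y] t]; have -> : (2 : R[i]) = (2 : R)%:C by rewrite rmorph_nat.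
by rewrite -fmorphV /=; apply/eqP; rewrite eq_complex /=; apply/andP; split; apply/eqP; field.
Qed.

Lemma ZbaropE f : Zbarop f = fun p => 2^-1 * Xop f p + ('i%C / 2) * Yop f p.
Proof.
apply/funext => p; rewrite /Zbarop /d_zbar /d_x /d_y /d_t /Xop /Yop -/e_x -/e_y -/e_t.
rewrite /zpart; move: (cderive _ _ _) (cderive _ _ _) (cderive _ _ _) => [a a'] [b b'] [c c'].
case: p => [[x y] t]; have -> : (2 : R[i]) = (2 : R)%:C by rewrite rmorph_nat.
by rewrite -fmorphV /=; apply/eqP; rewrite eq_complex /=; apply/andP; split; apply/eqP; field.
Qed.

Lemma smooth_Z f : smooth f -> smooth (Zop f).
Proof.
by move=> sf; rewrite ZopE; apply: smooth_add; apply: smoothZ;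
  [exact: smooth_X|exact: smooth_Y].
Qed.

Lemma smooth_Zbar f : smooth f -> smooth (Zbarop f).
Proof.
by move=> sf; rewrite ZbaropE; apply: smooth_add; apply: smoothZ;
  [exact: smooth_X|exact: smooth_Y].
Qed.

Lemma Zop_comb (a b : R[i]) f g p : smooth f -> smooth g ->
  Zop (fun p => a * f p + b * g p) p = a * Zop f p + b * Zop g p.
Proof. by move=> sf sg; rewrite !ZopE Xop_comb// Yop_comb//; ring. Qed.

Lemma Zbarop_comb (a b : R[i]) f g p : smooth f -> smooth g ->
  Zbarop (fun p => a * f p + b * g p) p = a * Zbarop f p + b * Zbarop g p.
Proof. by move=> sf sg; rewrite !ZbaropE Xop_comb// Yop_comb//; ring. Qed.

Lemma ZopZ (a : R[i]) f p : smooth f -> Zop (fun p => a * f p) p = a * Zop f p.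
Proof.
move=> sf; have := Zop_comb a 0 p sf sf.
by under eq_fun do rewrite mul0r addr0; rewrite mul0r addr0.
Qed.

Lemma ZbaropZ (a : R[i]) f p : smooth f -> Zbarop (fun p => a * f p) p = a * Zbarop f p.
Proof.
move=> sf; have := Zbarop_comb a 0 p sf sf.
by under eq_fun do rewrite mul0r addr0; rewrite mul0r addr0.
Qed.

Lemma e_xP : e_x = (1, 0, 0). Proof. by []. Qed.
Lemma e_yP : e_y = (0, 1, 0). Proof. by []. Qed.
Lemma e_tP : e_t = (0, 0, 1). Proof. by []. Qed.
Lemma e_xE : (e_x.1.1 = 1) * (e_x.1.2 = 0). Proof. by []. Qed.
Lemma e_yE : (e_y.1.1 = 0) * (e_y.1.2 = 1). Proof. by []. Qed.
Lemma e_tE : (e_t.1.1 = 0) * (e_t.1.2 = 0). Proof. by []. Qed.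

(* Otherwise unification tells the three directions apart by unfolding the real
   numbers 0 and 1, here and in all later sections. *)
Local Opaque e_x e_y e_t cderive.

Lemma XopX f p : smooth f ->
  Xop (Xop f) p = cderive e_x (cderive e_x f) p +
    (4 * p.1.2)%:C * cderive e_x (cderive e_t f) p +
    (4 * p.1.2 ^+ 2)%:C * cderive e_t (cderive e_t f) p.
Proof.
move=> sf; have [sx st] := (smooth_cderive e_x sf, smooth_cderive e_t sf).
have syt := smooth_mul smooth_2y st.
rewrite {1}/Xop !cderive_add// !cderive_mul//; try exact: smooth_2y.
rewrite !cderive_2y [cderive e_t (cderive e_x f) p]cderive_comm// e_xE e_tE !mulr0.
move: (cderive e_x _ p) (cderive e_x _ p) (cderive e_t _ p) (cderive e_t _ p).
by move=> [? ?] [? ?] [? ?] [? ?]; cring.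
Qed.

Lemma YopY f p : smooth f ->
  Yop (Yop f) p = cderive e_y (cderive e_y f) p -
    (4 * p.1.1)%:C * cderive e_y (cderive e_t f) p +
    (4 * p.1.1 ^+ 2)%:C * cderive e_t (cderive e_t f) p.
Proof.
move=> sf; have [sx st] := (smooth_cderive e_y sf, smooth_cderive e_t sf).
have syt := smooth_mul smooth_2x st.
rewrite {1}/Yop !cderive_sub// !cderive_mul//; try exact: smooth_2x.
rewrite !cderive_2x [cderive e_t (cderive e_y f) p]cderive_comm// e_yE e_tE !mulr0.
move: (cderive e_y _ p) (cderive e_y _ p) (cderive e_t _ p) (cderive e_t _ p).
by move=> [? ?] [? ?] [? ?] [? ?]; cring.
Qed.

(** The Heisenberg relation, the source of the ladder of levels. *)
Lemma XY_comm f p : smooth f ->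
  Xop (Yop f) p - Yop (Xop f) p = - 4 * cderive e_t f p.
Proof.
move=> sf; have [sx st] := (smooth_cderive e_x sf, smooth_cderive e_t sf).
have sy := smooth_cderive e_y sf.
have [sxt syt] := (smooth_mul smooth_2x st, smooth_mul smooth_2y st).
have [s2x s2y] := (smooth_2x, smooth_2y).
rewrite {1}/Xop {3}/Yop !cderive_sub// !cderive_add// !cderive_mul//.
rewrite !cderive_2x !cderive_2y e_xE e_yE e_tE.
rewrite ![cderive e_t (cderive e_y f) p]cderive_comm//.
rewrite ![cderive e_t (cderive e_x f) p]cderive_comm//.
rewrite ![cderive e_y (cderive e_x f) p]cderive_comm// !mulr0 !mulr1.
rewrite (_ : - 4 = (- 4 : R)%:C :> R[i]); last by rewrite rmorphN rmorph_nat.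
move: (cderive e_x _ p) (cderive e_x _ p) => [? ?] [? ?].
move: (cderive e_y _ p) (cderive e_t _ p) (cderive e_t _ p) => [? ?] [? ?] [? ?].
by cring.
Qed.

End VectorFields.

Local Opaque e_x e_y e_t cderive.

Section Symmetries.
Variable R : realType.
Local Notation H := (heis R).
Implicit Types (f g : H -> R[i]) (p q v : H) (a b s t : R).
Local Notation e_x := (e_x R).
Local Notation e_y := (e_y R).
Local Notation e_t := (e_t R).

(** The operator proportional to the sub-Laplacian; by [sumsqE] it is half the
    sum of the squares of X and Y. *)
Definition sumsq f : H -> R[i] := fun p => Zop (Zbarop f) p + Zbarop (Zop f) p.

Lemma dt_X f p : smooth f -> cderive e_t (Xop f) p = Xop (cderive e_t f) p.
Proof.
move=> sf; have [sx st] := (smooth_cderive e_x sf, smooth_cderive e_t sf).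
have syt := smooth_mul (smooth_2y R) st.
rewrite /Xop !cderive_add// !cderive_mul//; last exact: smooth_2y.
rewrite !cderive_2y e_tE mulr0 [cderive e_t (cderive e_x f) p]cderive_comm//.
by congr (_ + _); rewrite -[RHS]add0r; congr (_ + _); rewrite -[0%:C]/(0 : R[i]) mul0r.
Qed.

Lemma dt_Y f p : smooth f -> cderive e_t (Yop f) p = Yop (cderive e_t f) p.
Proof.
move=> sf; have [sx st] := (smooth_cderive e_y sf, smooth_cderive e_t sf).
have syt := smooth_mul (smooth_2x R) st.
rewrite /Yop !cderive_sub// !cderive_mul//; last exact: smooth_2x.
rewrite !cderive_2x e_tE mulr0 [cderive e_t (cderive e_y f) p]cderive_comm//.
by congr (_ - _); rewrite -[RHS]add0r; congr (_ + _); rewrite -[0%:C]/(0 : R[i]) mul0r.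
Qed.

Lemma dt_Z f p : smooth f -> cderive e_t (Zop f) p = Zop (cderive e_t f) p.
Proof.
move=> sf; have [sX sY] := (smooth_X sf, smooth_Y sf).
rewrite (ZopE f) (cderive_add _ _ (smoothZ _ sX) (smoothZ _ sY)).
by rewrite (cderiveZ _ _ _ sX) (cderiveZ _ _ _ sY) (dt_X _ sf) (dt_Y _ sf) ZopE.
Qed.

Lemma dt_Zbar f p : smooth f -> cderive e_t (Zbarop f) p = Zbarop (cderive e_t f) p.
Proof.
move=> sf; have [sX sY] := (smooth_X sf, smooth_Y sf).
rewrite (ZbaropE f) (cderive_add _ _ (smoothZ _ sX) (smoothZ _ sY)).
by rewrite (cderiveZ _ _ _ sX) (cderiveZ _ _ _ sY) (dt_X _ sf) (dt_Y _ sf) ZbaropE.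
Qed.

Lemma mulii : 'i%C * 'i%C = -1 :> R[i].
Proof. by cring. Qed.

Lemma Zop_Zbarop f p : smooth f -> Zop (Zbarop f) p =
  (Xop (Xop f) p + Yop (Yop f) p) / 4 - 'i%C * cderive e_t f p.
Proof.
move=> sf; have [sX sY] := (smooth_X sf, smooth_Y sf).
rewrite ZopE ZbaropE !(Xop_comb _ _ _ sX sY) !(Yop_comb _ _ _ sX sY).
have := XY_comm p sf; move: (Xop _ p) (Xop _ p) (Yop _ p) (Yop _ p) (cderive _ _ _).
move=> a b c d e /eqP; rewrite subr_eq => /eqP ->.
rewrite [LHS](_ : _ = a / 4 + 'i%C * (- 4 * e) / 4 - ('i%C * 'i%C) * c / 4); last by field.
by rewrite mulii; field.
Qed.

Lemma Zbarop_Zop f p : smooth f -> Zbarop (Zop f) p =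
  (Xop (Xop f) p + Yop (Yop f) p) / 4 + 'i%C * cderive e_t f p.
Proof.
move=> sf; have [sX sY] := (smooth_X sf, smooth_Y sf).
rewrite ZopE ZbaropE !(Xop_comb _ _ _ sX sY) !(Yop_comb _ _ _ sX sY).
have := XY_comm p sf; move: (Xop _ p) (Xop _ p) (Yop _ p) (Yop _ p) (cderive _ _ _).
move=> a b c d e /eqP; rewrite subr_eq => /eqP ->.
rewrite [LHS](_ : _ = a / 4 - 'i%C * (- 4 * e) / 4 - ('i%C * 'i%C) * c / 4); last by field.
by rewrite mulii; field.
Qed.

Lemma sumsqE f p : smooth f -> sumsq f p = (Xop (Xop f) p + Yop (Yop f) p) / 2.
Proof. by move=> sf; rewrite /sumsq Zop_Zbarop// Zbarop_Zop//; field. Qed.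

Lemma Zop_Zbarop_sumsq f p : smooth f ->
  Zop (Zbarop f) p = sumsq f p / 2 - 'i%C * cderive e_t f p.
Proof. by move=> sf; rewrite sumsqE// Zop_Zbarop//; field. Qed.

Lemma Zbarop_Zop_sumsq f p : smooth f ->
  Zbarop (Zop f) p = sumsq f p / 2 + 'i%C * cderive e_t f p.
Proof. by move=> sf; rewrite sumsqE// Zbarop_Zop//; field. Qed.

Lemma cderive_along v w (L : H -> H) A f p : affine_map A L -> L v = w ->
  cderive v (fun p => f (A p)) p = cderive w f (A p).
Proof. by move=> hA <-; exact: cderive_affine. Qed.

Lemma dt_ltrans f q p : cderive e_t (fun p => f (q * p)%g) p = cderive e_t f (q * p)%g.
Proof.
case: q => [[a b] s]; apply: (cderive_along _ _ (affine_ltrans a b s)).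
by rewrite e_tP; congr (_, _, _); rewrite /=; ring.
Qed.

Lemma Xop_ltrans f q p : smooth f -> Xop (fun p => f (q * p)%g) p = Xop f (q * p)%g.
Proof.
move=> sf; rewrite /Xop dt_ltrans; case: q p => [[a b] s] [[x y] t].
rewrite (cderive_along (w := 1 *: e_x + (2 * b) *: e_t) _ _ (affine_ltrans a b s)).
  rewrite cderive_dir// heis_mulE /=.
  by move: (cderive e_x f _) (cderive e_t f _) => [? ?] [? ?]; cring.
by rewrite e_xP e_tP; congr (_, _, _); rewrite /= /GRing.scale /=; ring.
Qed.

Lemma Yop_ltrans f q p : smooth f -> Yop (fun p => f (q * p)%g) p = Yop f (q * p)%g.
Proof.
move=> sf; rewrite /Yop dt_ltrans; case: q p => [[a b] s] [[x y] t].
rewrite (cderive_along (w := 1 *: e_y + (- (2 * a)) *: e_t) _ _ (affine_ltrans a b s)).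
  rewrite cderive_dir// heis_mulE /=.
  by move: (cderive e_y f _) (cderive e_t f _) => [? ?] [? ?]; cring.
by rewrite e_yP e_tP; congr (_, _, _); rewrite /= /GRing.scale /=; ring.
Qed.

Lemma smooth_ltrans f q : smooth f -> smooth (fun p => f (q * p)%g).
Proof. by case: q => [[a b] s]; exact: smooth_affine (affine_ltrans a b s). Qed.

Lemma Zop_ltrans f q p : smooth f -> Zop (fun p => f (q * p)%g) p = Zop f (q * p)%g.
Proof. by move=> sf; rewrite !ZopE (Xop_ltrans q p sf) (Yop_ltrans q p sf). Qed.

Lemma Zbarop_ltrans f q p : smooth f -> Zbarop (fun p => f (q * p)%g) p = Zbarop f (q * p)%g.
Proof. by move=> sf; rewrite !ZbaropE (Xop_ltrans q p sf) (Yop_ltrans q p sf). Qed.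

Lemma dt_turn f s p : cderive e_t (fun p => f (turn s p)) p = cderive e_t f (turn s p).
Proof.
apply: (cderive_along _ _ (affine_turn s)).
by rewrite e_tP; congr (_, _, _); rewrite /=; ring.
Qed.

(** The turn rotates the frame (X, Y) by a right angle; this is why it multiplies
    Z by i in [Zop_turn]. *)
Lemma Xop_turn f s p : smooth f -> Xop (fun p => f (turn s p)) p = Yop f (turn s p).
Proof.
move=> sf; rewrite /Xop /Yop dt_turn.
rewrite (cderive_along (w := e_y) _ _ (affine_turn s)).
  rewrite /turn /=.
  by move: (cderive e_y f _) (cderive e_t f _) => [? ?] [? ?]; cring.
by rewrite e_xP e_yP; congr (_, _, _); rewrite /=; ring.
Qed.

Lemma Yop_turn f s p : smooth f -> Yop (fun p => f (turn s p)) p = - Xop f (turn s p).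
Proof.
move=> sf; rewrite /Xop /Yop dt_turn.
rewrite (cderive_along (w := (-1) *: e_x + 0 *: e_t) _ _ (affine_turn s)).
  rewrite cderive_dir// /turn /=.
  by move: (cderive e_x f _) (cderive e_t f _) => [? ?] [? ?]; cring.
by rewrite e_xP e_yP e_tP; congr (_, _, _); rewrite /= /GRing.scale /=; ring.
Qed.

Lemma smooth_turn f s : smooth f -> smooth (fun p => f (turn s p)).
Proof. exact: smooth_affine (affine_turn s). Qed.

Lemma Zop_turn f s p : smooth f -> Zop (fun p => f (turn s p)) p = 'i%C * Zop f (turn s p).
Proof.
move=> sf; rewrite !ZopE (Xop_turn s p sf) (Yop_turn s p sf).
move: (Xop _ _) (Yop _ _) => a b.
rewrite [RHS](_ : _ = 'i%C * a / 2 - ('i%C * 'i%C) * b / 2); last by field.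
by rewrite mulii; field.
Qed.

Lemma Zbarop_turn f s p : smooth f ->
  Zbarop (fun p => f (turn s p)) p = - 'i%C * Zbarop f (turn s p).
Proof.
move=> sf; rewrite !ZbaropE (Xop_turn s p sf) (Yop_turn s p sf).
move: (Xop _ _) (Yop _ _) => a b.
rewrite [RHS](_ : _ = - 'i%C * a / 2 - ('i%C * 'i%C) * b / 2); last by field.
by rewrite mulii; field.
Qed.

Lemma Zop_conj f p : smooth f -> Zop (fun p => (f p)^*) p = (Zbarop f p)^*.
Proof.
move=> sf; rewrite ZopE ZbaropE /Xop /Yop !cderive_conj//.
move: (cderive _ _ _) (cderive _ _ _) (cderive _ _ _) => [a a'] [b b'] [d d'].
have -> : (2 : R[i])^-1 = (2^-1 : R)%:C by rewrite fmorphV rmorph_nat.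
by cring.
Qed.

Lemma Zbarop_conj f p : smooth f -> Zbarop (fun p => (f p)^*) p = (Zop f p)^*.
Proof.
move=> sf; rewrite ZopE ZbaropE /Xop /Yop !cderive_conj//.
move: (cderive _ _ _) (cderive _ _ _) (cderive _ _ _) => [a a'] [b b'] [d d'].
have -> : (2 : R[i])^-1 = (2^-1 : R)%:C by rewrite fmorphV rmorph_nat.
by cring.
Qed.

Lemma sumsq_conj f p : smooth f -> sumsq (fun p => (f p)^*) p = (sumsq f p)^*.
Proof.
move=> sf; rewrite /sumsq.
have -> : Zbarop (fun p => (f p)^*) = fun p => (Zop f p)^*.
  by apply/funext => q; exact: Zbarop_conj.
have -> : Zop (fun p => (f p)^*) = fun p => (Zbarop f p)^*.
  by apply/funext => q; exact: Zop_conj.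
rewrite (Zop_conj _ (smooth_Z sf)) (Zbarop_conj _ (smooth_Zbar sf)).
by move: (Zop _ p) (Zbarop _ p) => [? ?] [? ?]; cring.
Qed.

Lemma sumsq_comb (a b : R[i]) f g p : smooth f -> smooth g ->
  sumsq (fun p => a * f p + b * g p) p = a * sumsq f p + b * sumsq g p.
Proof.
move=> sf sg; rewrite /sumsq.
have -> : Zop (fun p => a * f p + b * g p) = fun p => a * Zop f p + b * Zop g p.
  by apply/funext => q; exact: Zop_comb.
have -> : Zbarop (fun p => a * f p + b * g p) = fun p => a * Zbarop f p + b * Zbarop g p.
  by apply/funext => q; exact: Zbarop_comb.
have [zf zg] := (smooth_Z sf, smooth_Z sg).
have [bf bg] := (smooth_Zbar sf, smooth_Zbar sg).
rewrite (Zop_comb a b p bf bg) (Zbarop_comb a b p zf zg).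
move: (Zop (Zbarop f) p) (Zop (Zbarop g) p) (Zbarop (Zop f) p) (Zbarop (Zop g) p).
by move=> *; ring.
Qed.

End Symmetries.

Local Opaque e_x e_y e_t cderive Xop Yop Zop Zbarop sumsq.

(** * A maximum principle *)

Section MaximumPrinciple.
Variable R : realType.
Local Notation H := (heis R).
Implicit Types (f g : H -> R[i]) (p q v : H) (a b s t : R).
Local Notation e_x := (e_x R).
Local Notation e_y := (e_y R).
Local Notation e_t := (e_t R).

(** The slopes of u along the line have the wrong signs on the two sides of the
   maximum, so the mean value theorem produces points close to p where the
   second derivative is nonpositive. *)
Lemma derive2_max_le0 (u : H -> R) v p :
  rsmooth u -> (forall q, u q <= u p) -> 'D_v ('D_v u) p <= 0.
Proof.
move=> su umax; rewrite leNgt; apply/negP => u2.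
pose g : R -> R := fun s => 'D_v ('D_v u) (s *: v + p).
have su1 := rsmooth_derive v su.
have gc : {for 0, continuous g}.
  apply: differentiable_continuous; apply/derivable1_diffP.
  by case: (is_derive_line p v 0 (rsmooth_derive v su1)).
have g0 : 0 < g 0 by rewrite /g scale0r add0r.
have /nbhs_ballP[d /= d0 hd] := gc _ (open_nbhs_nbhs (conj (@open_gt R 0) g0)).
pose h := d / 2; have h0 : 0 < h by rewrite divr_gt0.
have dU (s : R) := is_derive_line p v s su.
have dU1 (s : R) := is_derive_line p v s su1.
have [s1 /andP[s10 s1h] E1] := MVT_real h0 dU.
have mh0 : - h < 0 by rewrite oppr_lt0.
have [s2 /andP[s2h s20] E2] := MVT_real mh0 dU.
have [s3 /andP[s23 s31] E3] := MVT_real (lt_trans s20 s10) dU1.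
have : 0 < g s3.
  apply: hd; rewrite -ball_normE /= sub0r normrN ltr_norml.
  have hd2 : h + h = d by rewrite /h; field.
  move: s1h s2h s23 s31 h0 hd2; clear; move: h => h *; apply/andP; split; lra.
move: E1 E2 E3; rewrite /g scale0r add0r subr0 sub0r opprK => E1 E2 E3.
have F1 : 'D_v u (s1 *: v + p) <= 0.
  by rewrite -(pmulr_lle0 _ h0) -E1 subr_le0 umax.
have F2 : 0 <= 'D_v u (s2 *: v + p).
  by rewrite -(pmulr_lge0 _ h0) -E2 subr_ge0 umax.
rewrite -(pmulr_lgt0 (x := s1 - s2)); last by rewrite subr_gt0 (lt_trans s20).
by rewrite -E3 subr_gt0 ltNge (le_trans F1).
Qed.

Definition normsq (z : R[i]) : R := complex.Re z ^+ 2 + complex.Im z ^+ 2.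

Lemma normsq_eq0 (z : R[i]) : normsq z <= 0 -> z = 0.
Proof.
case: z => x y; rewrite /normsq /= => h.
have x0 := sqr_ge0 x; have y0 := sqr_ge0 y.
have /eqP -> : x == 0 by rewrite -sqrf_eq0; apply/eqP; lra.
have /eqP -> : y == 0 by rewrite -sqrf_eq0; apply/eqP; lra.
by [].
Qed.

Lemma normsqM (z w : R[i]) : normsq (z * w) = normsq z * normsq w.
Proof. by case: z w => [a b] [c d]; rewrite /normsq /=; ring. Qed.

Lemma rsmooth_normsq g : smooth g -> rsmooth (fun p => normsq (g p)).
Proof.
move=> /smoothP[g1 g2]; rewrite /normsq; under eq_fun do rewrite !expr2.
by apply: rsmooth_add; exact: rsmooth_mul.
Qed.

(** At a maximum of |g|^2 the first derivatives contribute squares to the second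
    derivative, which can be dropped. *)
Lemma normsq_max_le0 g v p : smooth g -> (forall q, normsq (g q) <= normsq (g p)) ->
  complex.Re ((g p)^* * cderive v (cderive v g) p) <= 0.
Proof.
move=> sg gmax; have := derive2_max_le0 v (rsmooth_normsq sg) gmax.
have [g1 g2] := (smoothP g).1 sg.
have [dg1 dg2] := (rsmooth_derive v g1, rsmooth_derive v g2).
have E q : 'D_v (fun p => normsq (g p)) q =
  2 * (complex.Re (g q) * 'D_v (fun p => complex.Re (g p)) q +
       complex.Im (g q) * 'D_v (fun p => complex.Im (g p)) q).
  rewrite /normsq; under eq_fun do rewrite !expr2.
  rewrite (derive_add _ _ (rsmooth_mul g1 g1) (rsmooth_mul g2 g2)).
  by rewrite (derive_mul _ _ g1 g1) (derive_mul _ _ g2 g2); ring.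
have -> : 'D_v (fun p => normsq (g p)) = fun q =>
  2 * (complex.Re (g q) * 'D_v (fun p => complex.Re (g p)) q +
       complex.Im (g q) * 'D_v (fun p => complex.Im (g p)) q).
  by apply/funext => q; exact: E.
have m1 := rsmooth_mul g1 dg1; have m2 := rsmooth_mul g2 dg2.
rewrite (derive_mul _ _ (rsmooth_cst (2 : R)) (rsmooth_add m1 m2)).
rewrite (derive_add _ _ m1 m2) (derive_cst (2 : R)) mulr0 addr0.
rewrite (derive_mul _ _ g1 dg1) (derive_mul _ _ g2 dg2).
Transparent cderive.
set c := 'D_v ('D_v (fun q => complex.Re (g q))) p.
set d := 'D_v ('D_v (fun q => complex.Im (g q))) p.
move: ('D_v (fun q => complex.Re (g q)) p) ('D_v (fun q => complex.Im (g q)) p).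
have -> : cderive v (cderive v g) p = c +i* d by [].
move: (g p) c d => [a b] c d a' b' /= h.
have a2 := sqr_ge0 a'; have b2 := sqr_ge0 b'.
have -> : a * c - - b * d = a * c + b * d by ring.
by move: h a2 b2; rewrite !expr2; lra.
Qed.
Opaque cderive.

Lemma cderive2_dir v w a b f p : smooth f ->
  cderive (a *: v + b *: w) (cderive (a *: v + b *: w) f) p =
  (a ^+ 2)%:C * cderive v (cderive v f) p +
  (2 * a * b)%:C * cderive v (cderive w f) p +
  (b ^+ 2)%:C * cderive w (cderive w f) p.
Proof.
move=> sf; have [sv sw] := (smooth_cderive v sf, smooth_cderive w sf).
have -> : cderive (a *: v + b *: w) f =
    fun p => a%:C * cderive v f p + b%:C * cderive w f p.
  by apply/funext => q; exact: cderive_dir.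
have [av bw] := (smoothZ a%:C sv, smoothZ b%:C sw).
rewrite (cderive_add _ _ av bw) (cderiveZ _ _ _ sv) (cderiveZ _ _ _ sw).
rewrite !cderive_dir// (cderive_comm w v p sf).
move: (cderive v (cderive v f) p) (cderive v (cderive w f) p) (cderive w (cderive w f) p).
by move=> [? ?] [? ?] [? ?]; cring.
Qed.

(** At a maximum of |g|, the operator Z Zbar + Zbar Z, half the sum of the second
    derivatives along two lines, cannot increase |g|; hence a bounded g that it
    multiplies by a positive number vanishes. *)
Lemma maximum_principle g (w : R) : smooth g -> 0 < w ->
  (forall p, sumsq g p = w%:C * g p) ->
  (exists p, forall q, normsq (g q) <= normsq (g p)) -> forall p, g p = 0.
Proof.
move=> sg w0 gE [p gmax] q; apply: normsq_eq0; apply: le_trans (gmax q) _.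
have := normsq_max_le0 (1 *: e_x + (2 * p.1.2) *: e_t) sg gmax.
have := normsq_max_le0 (1 *: e_y + (- (2 * p.1.1)) *: e_t) sg gmax.
have := gE p; rewrite (sumsqE _ sg) (XopX _ sg) (YopY _ sg) !cderive2_dir//.
move: (cderive _ _ p) (cderive _ _ p) (cderive _ _ p) (cderive _ _ p) (cderive _ _ p).
move=> [a a'] [b b'] [c c'] [d d'] [e e'].
have -> : (2 : R[i])^-1 = (2^-1 : R)%:C by rewrite fmorphV rmorph_nat.
case: (g p) => [x x'] /eqP; rewrite eq_complex /= => /andP[/eqP E1 /eqP E2] I1 I2.
rewrite /normsq /=; nra.
Qed.

Lemma const_along g v p s : smooth g -> (forall q, cderive v g q = 0) ->
  g (s *: v + p) = g p.
Proof.
move=> /smoothP[g1 g2] g0.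
Transparent cderive.
have g10 q : 'D_v (fun p => complex.Re (g p)) q = 0.
  by have /eqP := g0 q; rewrite eq_complex /= => /andP[/eqP].
have g20 q : 'D_v (fun p => complex.Im (g p)) q = 0.
  by have /eqP := g0 q; rewrite eq_complex /= => /andP[_ /eqP].
Opaque cderive.
have const (u : H -> R) : rsmooth u -> (forall q, 'D_v u q = 0) ->
    u (s *: v + p) = u p.
  move=> su u0; have dU (x : R) := is_derive_line p v x su.
  have [s0|s0|->] := ltgtP s 0; last by rewrite scale0r add0r.
    have [c _] := MVT_real s0 dU; rewrite u0 mul0r scale0r add0r => /eqP.
    by rewrite subr_eq0 => /eqP.
  have [c _] := MVT_real s0 dU; rewrite u0 mul0r scale0r add0r => /eqP.
  by rewrite subr_eq0 => /eqP.
apply/eqP; rewrite eq_complex; apply/andP; split; apply/eqP.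
  exact: (const _ g1).
exact: (const _ g2).
Qed.

End MaximumPrinciple.

Local Opaque e_x e_y e_t cderive Xop Yop Zop Zbarop sumsq.

(** * The ladder of Landau levels *)

Section HasDim.

(** The scalars may be twisted by s, as they are under complex conjugation. *)
Lemma has_dim_transfer (F : fieldType) (V W : lmodType F) (E : set V) (E' : set W)
    (s s' : F -> F) (Phi : V -> W) (m : nat) :
  cancel s s' -> cancel s' s -> s 0 = 0 ->
  (forall (a : 'I_m -> F) e, (forall j, E (e j)) ->
    E (\sum_j a j *: e j) /\
    Phi (\sum_j a j *: e j) = \sum_j s (a j) *: Phi (e j)) ->
  (forall f, E f -> E' (Phi f)) ->
  (forall f, E f -> Phi f = 0 -> f = 0) ->
  (forall g, E' g -> exists2 f, E f & g = Phi f) ->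
  has_dim E m -> has_dim E' m.
Proof.
move=> ss' s's s0 lin EE' inj surj [e [Ee ef eg]]; exists (Phi \o e); split.
- by move=> j; exact: EE'.
- move=> a a0 j; have [Ea Ha] := lin (s' \o a) e Ee.
  rewrite -[a j]s's -s0; congr (s _); apply: (ef (s' \o a)) => //; apply: inj => //.
  by rewrite Ha -[RHS]a0; apply: eq_bigr => i _ /=; rewrite s's.
- move=> g /surj[f Ef ->]; have [a fa] := eg _ Ef; exists (s \o a).
  by have [_ Ha] := lin a e Ee; rewrite fa Ha.
Qed.

End HasDim.

Section Ladder.
Variable R : realType.
Local Notation H := (heis R).
Implicit Types (f g : H -> R[i]) (p q v : H) (a b s t : R).
Local Notation e_x := (e_x R).
Local Notation e_y := (e_y R).
Local Notation e_t := (e_t R).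

Lemma smooth_tcoord : smooth (fun p : H => (p.2)%:C : R[i]).
Proof. by apply: smooth_real; exact: rsmooth_t. Qed.

Lemma cderive_tcoord v p : cderive v (fun p : H => (p.2)%:C : R[i]) p = (v.2)%:C.
Proof.
Transparent cderive.
rewrite /cderive /= -[RHS]/(v.2 +i* 0); apply: complex_congr.
  exact: derive_t.
exact: (derive_cst (0:R)).
Opaque cderive.
Qed.

Definition t_eigen (T : R) f := forall p, cderive e_t f p = 'i%C * T%:C * f p.

(** The equation in t is an ordinary differential equation with constant
    coefficients on each fibre. *)
Lemma t_eigenP (T : R) f x y t s : smooth f -> t_eigen T f ->
  f (x, y, s + t) = cexp ('i%C * (T * s)%:C) * f (x, y, t).
Proof.
move=> sf fT; pose w := fun p : H => (- ('i%C * T%:C)) * (p.2)%:C : R[i].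
have sw : smooth w by apply: smoothZ; exact: smooth_tcoord.
have K0 q : cderive e_t (fun p => f p * cexp (w p)) q = 0.
  rewrite (cderive_mul _ _ sf (smooth_cexp sw)) fT (cderive_cexp _ _ sw).
  rewrite (cderiveZ _ _ _ smooth_tcoord) cderive_tcoord e_tP /=.
  by rewrite -[1%:C]/(1 : R[i]); ring.
have := const_along (x, y, t) s (smooth_mul sf (smooth_cexp sw)) K0.
rewrite (_ : s *: e_t + (x, y, t) = (x, y, s + t)); last first.
  by rewrite e_tP; congr (_, _, _); rewrite /= /GRing.scale /=; ring.
rewrite /w /= => E.
apply: (mulIf (cexp_neq0 (- ('i%C * T%:C) * (s + t)%:C))).
rewrite E [RHS]mulrAC -cexpD [RHS]mulrC; congr (_ * cexp _).
by rewrite rmorphD rmorphM; ring.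
Qed.

Lemma normsq_cexpi (s : R) : normsq (cexp ('i%C * s%:C)) = 1.
Proof.
rewrite /normsq /cexp /= !mul0r !mul1r subr0 add0r expR0 !mul1r.
exact: cos2Dsin2.
Qed.

Definition g_x : H := (1, 0, 0).
Definition g_y : H := (0, 1, 0).
Definition lattice_invariant f :=
  (forall p, f (g_x * p)%g = f p) /\ (forall p, f (g_y * p)%g = f p).
Definition turn_eigen (c : R) (chi : R[i]) f := forall p, f (turn (c / 4) p) = chi * f p.

Lemma periodic_int (T : Type) (F : R -> T) (m : int) x :
  (forall x, F (1 + x) = F x) -> F (m%:~R + x) = F x.
Proof.
move=> F1; have Fn (n : nat) y : F (n%:R + y) = F y.
  by elim: n => [|n IHn]; rewrite ?add0r// -natr1 addrAC addrC F1.
case: m => n; first by rewrite -pmulrn Fn.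
by rewrite NegzE mulrNz -pmulrn -[LHS](Fn n.+1); congr F; ring.
Qed.

(** The modulus |f| does not depend on t and is doubly periodic in (x, y), so it
    is a continuous function on a torus. *)
Lemma normsq_max f (T : R) : smooth f -> t_eigen T f -> lattice_invariant f ->
  exists p, forall q, normsq (f q) <= normsq (f p).
Proof.
move=> sf fT [f1 f2]; pose u (z : R * R) : R := normsq (f (z, 0)).
have ut x y t : normsq (f (x, y, t)) = u (x, y).
  by rewrite -[t]addr0 (t_eigenP _ _ _ _ sf fT) normsqM normsq_cexpi mul1r.
have u1 x y : u (1 + x, y) = u (x, y).
  by rewrite -(ut x y 0) -f1 heis_mulE add0r -(ut _ _ (0 + 2 * (0 * x - 1 * y))) !add0r.
have u2 x y : u (x, 1 + y) = u (x, y).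
  by rewrite -(ut x y 0) -f2 heis_mulE -(ut _ _ (0 + 2 * (1 * x - 0 * y))) !add0r.
have uc : continuous u.
  move=> z; apply: (@continuous_comp _ _ _ (fun z : R * R => (z, 0) : H)
    (fun p => normsq (f p))).
    have c0 : (fun z : R * R => (z, (0 : R))) @ z --> (z, (0 : R)).
      apply: (@cvg_pair _ _ _ _ (nbhs z) (nbhs (0 : R)) _ _ _ id (fun=> 0)).
        exact: cvg_id.
      exact: cvg_cst.
    exact: c0.
  exact: (rsmooth_continuous (rsmooth_normsq sf)).
have cB : compact ((`[0, 1] : set R) `*` (`[0, 1] : set R)).
  by apply: compact_setX; exact: segment_compact.
have [|[x0 y0] _ m0] := compact_EVT_max _ cB (continuous_subspaceT uc).
  by exists (0, 0); split; rewrite /= in_itv /= lexx ler01.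
exists (x0, y0, 0) => -[[x y] t]; rewrite !ut.
have -> : u (x, y) = u (x - (Num.floor x)%:~R, y - (Num.floor y)%:~R).
  rewrite (addrC x) (addrC y) -!mulrNz.
  rewrite (periodic_int (F := fun x => u (x, _)) _ _ (fun x => u1 x _)).
  by rewrite (periodic_int (F := fun y => u (_, y)) _ _ (fun y => u2 _ y)).
have fl (z : R) : 0 <= z - (Num.floor z)%:~R <= 1.
  have := floor_le z; have := floorD1_gt z; rewrite intrD => h1 h2.
  by apply/andP; split; [rewrite subr_ge0|rewrite lerBlDl ltW].
by apply: m0; rewrite inE; split; rewrite /= in_itv /=; exact: fl.
Qed.

End Ladder.

Local Opaque e_x e_y e_t cderive Xop Yop Zop Zbarop sumsq.

Section Levels.
Variable R : realType.
Local Notation H := (heis R).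
Implicit Types (f g : H -> R[i]) (p q v : H) (a b s t : R) (k : nat).
Local Notation e_t := (e_t R).
Variables (c T : R).

Record level (S : R) (chi : R[i]) f : Prop := Level {
  level_smooth : smooth f;
  level_t : t_eigen T f;
  level_sumsq : forall p, sumsq f p = S%:C * f p;
  level_lattice : lattice_invariant f;
  level_turn : turn_eigen c chi f }.

(** The Landau levels of the character of frequency T: level k of the
    quantised oscillator [Z Zbar + Zbar Z]. *)
Definition landau k chi f := level (- (2 * (2 * k%:R + 1) * T)) chi f.

(** Linearity of an operator on smooth functions passes from combinations of
    two functions to finite sums. *)
Lemma comb_sum (O : (H -> R[i]) -> H -> R[i]) m (a : 'I_m -> R[i]) (e : 'I_m -> H -> R[i]) :
  (forall (u u' : R[i]) f g p, smooth f -> smooth g ->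
    O (fun q => u * f q + u' * g q) p = u * O f p + u' * O g p) ->
  (forall j, smooth (e j)) ->
  smooth (fun q => \sum_j a j * e j q) /\
  forall p, O (fun q => \sum_j a j * e j q) p = \sum_j a j * O (e j) p.
Proof.
move=> Oc se; split; first by apply: smooth_sum => j; exact: smoothZ.
have O0 p : O (fun=> 0) p = 0.
  have := Oc 0 0 (fun=> 0) (fun=> 0) p (smooth_cst 0) (smooth_cst 0).
  by under [in O _]eq_fun do rewrite mul0r addr0; rewrite !mul0r addr0.
elim: (index_enum _) => [|i s IHs] p.
  by under [in O _]eq_fun do rewrite big_nil; rewrite big_nil.
under [in O _]eq_fun do rewrite big_cons -[X in _ + X]mul1r.
rewrite Oc ?IHs ?mul1r ?big_cons//.
elim: s {IHs} => [|i' s IHs].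
  by under eq_fun do rewrite big_nil; exact: smooth_cst.
by under eq_fun do rewrite big_cons; apply: smooth_add => //; exact: smoothZ.
Qed.

Lemma comb_cderive v (u u' : R[i]) f g p : smooth f -> smooth g ->
  cderive v (fun q => u * f q + u' * g q) p = u * cderive v f p + u' * cderive v g p.
Proof.
move=> sf sg; have [sf' sg'] := (smoothZ u sf, smoothZ u' sg).
by rewrite (cderive_add _ _ sf' sg') (cderiveZ _ _ _ sf) (cderiveZ _ _ _ sg).
Qed.

Lemma level_comb S chi m (a : 'I_m -> R[i]) (e : 'I_m -> H -> R[i]) :
  (forall j, level S chi (e j)) -> level S chi (fun p => \sum_j a j * e j p).
Proof.
move=> he; have se j := level_smooth (he j).
have [sm st] := comb_sum a (comb_cderive e_t) se.
have [_ ss] := comb_sum a (@sumsq_comb R) se.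
split=> //.
- move=> p; rewrite st mulr_sumr; apply: eq_bigr => j _.
  by rewrite (level_t (he j)) mulrCA.
- move=> p; rewrite ss mulr_sumr; apply: eq_bigr => j _.
  by rewrite (level_sumsq (he j)) mulrCA.
- by split=> p; apply: eq_bigr => j _; have [e1 e2] := level_lattice (he j);
    rewrite ?e1 ?e2.
- move=> p; rewrite mulr_sumr; apply: eq_bigr => j _.
  by rewrite (level_turn (he j)) mulrCA.
Qed.

Lemma idt f : t_eigen T f -> forall p, 'i%C * cderive e_t f p = - (T%:C * f p).
Proof. by move=> fT p; rewrite fT !mulrA mulii; ring. Qed.

Lemma lattice_Z f : smooth f -> lattice_invariant f -> lattice_invariant (Zop f).
Proof.
move=> sf [f1 f2]; split=> p; rewrite -(Zop_ltrans _ _ sf).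
  by congr (Zop _ p); apply/funext => q; exact: f1.
by congr (Zop _ p); apply/funext => q; exact: f2.
Qed.

Lemma lattice_Zbar f : smooth f -> lattice_invariant f -> lattice_invariant (Zbarop f).
Proof.
move=> sf [f1 f2]; split=> p; rewrite -(Zbarop_ltrans _ _ sf).
  by congr (Zbarop _ p); apply/funext => q; exact: f1.
by congr (Zbarop _ p); apply/funext => q; exact: f2.
Qed.

Lemma turn_Z chi f : smooth f -> turn_eigen c ('i%C * chi) f -> turn_eigen c chi (Zop f).
Proof.
move=> sf fc p; have := Zop_turn (c / 4) p sf.
have -> : (fun p => f (turn (c / 4) p)) = fun p => 'i%C * chi * f p.
  by apply/funext => q; exact: fc.
rewrite (ZopZ _ _ sf) -mulrA => /(mulfI _) -> //.
exact: imaginary_neq0.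
Qed.

Lemma turn_Zbar chi f : smooth f -> turn_eigen c chi f -> turn_eigen c ('i%C * chi) (Zbarop f).
Proof.
move=> sf fc p; have := Zbarop_turn (c / 4) p sf.
have -> : (fun p => f (turn (c / 4) p)) = fun p => chi * f p.
  by apply/funext => q; exact: fc.
rewrite (ZbaropZ _ _ sf) => E.
by rewrite -mulrA E mulrA mulrN mulii opprK mul1r.
Qed.

Lemma t_eigen_Z f : smooth f -> t_eigen T f -> t_eigen T (Zop f).
Proof.
move=> sf fT p; rewrite (dt_Z _ sf).
have -> : cderive e_t f = fun p => 'i%C * T%:C * f p by apply/funext.
by rewrite (ZopZ _ _ sf).
Qed.

Lemma t_eigen_Zbar f : smooth f -> t_eigen T f -> t_eigen T (Zbarop f).
Proof.
move=> sf fT p; rewrite (dt_Zbar _ sf).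
have -> : cderive e_t f = fun p => 'i%C * T%:C * f p by apply/funext.
by rewrite (ZbaropZ _ _ sf).
Qed.

Lemma landau_ZZbar k chi f p : landau k chi f ->
  Zop (Zbarop f) p = (- (2 * k%:R * T))%:C * f p.
Proof.
move=> hf; rewrite (Zop_Zbarop_sumsq _ (level_smooth hf)) (level_sumsq hf).
rewrite (idt (level_t hf)) !(rmorphN, rmorphM, rmorphD) rmorph1 !rmorph_nat.
by field.
Qed.

Lemma landau_ZbarZ k chi f p : landau k chi f ->
  Zbarop (Zop f) p = (- (2 * k.+1%:R * T))%:C * f p.
Proof.
move=> hf; rewrite (Zbarop_Zop_sumsq _ (level_smooth hf)) (level_sumsq hf).
rewrite (idt (level_t hf)) -natr1 !(rmorphN, rmorphM, rmorphD) rmorph1 !rmorph_nat.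
by field.
Qed.

Lemma landau_Z k chi f : landau k ('i%C * chi) f -> landau k.+1 chi (Zop f).
Proof.
move=> hf; have sf := level_smooth hf; split.
- exact: smooth_Z.
- exact: t_eigen_Z (level_t hf).
- move=> p; have := Zop_Zbarop_sumsq p (smooth_Z sf).
  have -> : Zbarop (Zop f) = fun p => (- (2 * k.+1%:R * T))%:C * f p.
    by apply/funext => q; exact: landau_ZbarZ hf.
  rewrite (ZopZ _ _ sf) (idt (t_eigen_Z sf (level_t hf))) => /eqP.
  rewrite eq_sym subr_eq => /eqP E.
  rewrite -[LHS](divfK (_ : 2 != 0)) ?pnatr_eq0// E.
  rewrite -natr1 !(rmorphN, rmorphM, rmorphD) rmorph1 !rmorph_nat.
  by ring.
- exact: lattice_Z (level_lattice hf).
- exact: turn_Z (level_turn hf).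
Qed.

Lemma landau_Zbar k chi f : landau k.+1 chi f -> landau k ('i%C * chi) (Zbarop f).
Proof.
move=> hf; have sf := level_smooth hf; split.
- exact: smooth_Zbar.
- exact: t_eigen_Zbar (level_t hf).
- move=> p; have := Zbarop_Zop_sumsq p (smooth_Zbar sf).
  have -> : Zop (Zbarop f) = fun p => (- (2 * k.+1%:R * T))%:C * f p.
    by apply/funext => q; exact: landau_ZZbar hf.
  rewrite (ZbaropZ _ _ sf) (idt (t_eigen_Zbar sf (level_t hf))) => /eqP.
  rewrite eq_sym addrC addrC subr_eq => /eqP E.
  rewrite -[LHS](divfK (_ : 2 != 0)) ?pnatr_eq0// E.
  rewrite -natr1 !(rmorphN, rmorphM, rmorphD) rmorph1 !rmorph_nat.
  by ring.
- exact: lattice_Zbar (level_lattice hf).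
- exact: turn_Zbar (level_turn hf).
Qed.

(** There is no level below the lowest one: Zbar f would be an eigenfunction
    of Z Zbar + Zbar Z with positive eigenvalue. *)
Lemma landau0_Zbar chi f : 0 < T -> landau 0 chi f -> forall p, Zbarop f p = 0.
Proof.
move=> T0 hf; have sf := level_smooth hf; have sb := smooth_Zbar sf.
have tb := t_eigen_Zbar sf (level_t hf).
apply: (maximum_principle (w := 2 * T)) => //; first by rewrite mulr_gt0.
  move=> p; have := Zbarop_Zop_sumsq p sb.
  have -> : Zop (Zbarop f) = fun p => 0 * f p.
    by apply/funext => q; rewrite (landau_ZZbar _ hf) mulr0 mul0r oppr0.
  rewrite (ZbaropZ _ _ sf) mul0r (idt tb) => /esym/eqP.
  rewrite subr_eq add0r => /eqP E; rewrite -[LHS](divfK (_ : 2 != 0)) ?pnatr_eq0// E.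
  by rewrite rmorphM rmorph_nat; ring.
exact: normsq_max sb tb (lattice_Zbar sf (level_lattice hf)).
Qed.

Lemma Zbar0_landau chi f : smooth f -> t_eigen T f -> lattice_invariant f ->
  turn_eigen c chi f -> (forall p, Zbarop f p = 0) -> landau 0 chi f.
Proof.
move=> sf fT fl fc f0; split=> // p; have := Zop_Zbarop_sumsq p sf.
have -> : Zbarop f = fun q => 0 * f q by apply/funext => q; rewrite mul0r f0.
rewrite (ZopZ _ _ sf) mul0r (idt fT) => /esym/eqP.
rewrite opprK addr_eq0 => /eqP E; rewrite -[LHS](divfK (_ : 2 != 0)) ?pnatr_eq0// E.
by rewrite !(rmorphN, rmorphM, rmorphD) rmorph1 !rmorph_nat; ring.
Qed.

Lemma sum_funE m (a : 'I_m -> R[i]) (e : 'I_m -> H -> (R[i])^o) :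
  \sum_j a j *: e j = (fun p => \sum_j a j * e j p) :> (H -> (R[i])^o).
Proof. by apply/funext => p; rewrite fct_sumE. Qed.

(** The raising operator Z is a bijection between consecutive levels, its
    inverse being a multiple of Zbar; it shifts the eigenvalue of the turn. *)
Lemma has_dim_landauS k chi m : 0 < T ->
  has_dim (landau k ('i%C * chi) : set (H -> (R[i])^o)) m ->
  has_dim (landau k.+1 chi : set (H -> (R[i])^o)) m.
Proof.
move=> T0; have w0 : (- (2 * k.+1%:R * T))%:C != 0 :> R[i].
  by rewrite fmorph_eq0 oppr_eq0 !mulf_neq0// ?pnatr_eq0// lt0r_neq0.
apply: (has_dim_transfer (s := id) (s' := id) (Phi := @Zop R)) => //.
- move=> a e he; rewrite !sum_funE; split; first exact: level_comb.
  have [_ sz] := comb_sum a (@Zop_comb R) (fun j => level_smooth (he j)).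
  by apply/funext => p; exact: sz.
- by move=> f; exact: landau_Z.
- move=> f hf f0; apply/funext => p; have := landau_ZbarZ p hf.
  rewrite f0 -[X in Zbarop X](_ : (fun p => 0 * f p) = _); last first.
    by apply/funext => q; rewrite mul0r.
  rewrite (ZbaropZ _ _ (level_smooth hf)) mul0r => /esym/eqP.
  by rewrite mulf_eq0 (negbTE w0) => /eqP.
- move=> g hg; have sb := smooth_Zbar (level_smooth hg).
  exists (fun p => (- (2 * k.+1%:R * T))%:C^-1 * Zbarop g p).
    have := level_comb (m := 1) (fun=> (- (2 * k.+1%:R * T))%:C^-1)
      (fun=> landau_Zbar hg).
    by congr (level _ _ _); apply/funext => p; rewrite big_ord1.
  by apply/funext => p; rewrite (ZopZ _ _ sb) (landau_ZZbar _ hg) mulKf.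
Qed.

Lemma has_dim_landau k chi m : 0 < T ->
  has_dim (landau 0 ('i%C ^+ k * chi) : set (H -> (R[i])^o)) m ->
  has_dim (landau k chi : set (H -> (R[i])^o)) m.
Proof.
move=> T0; elim: k chi => [|k IHk] chi; first by rewrite expr0 mul1r.
by rewrite exprSr -mulrA => /IHk; exact: has_dim_landauS.
Qed.

End Levels.

Local Opaque e_x e_y e_t cderive Xop Yop Zop Zbarop sumsq.

(** * Invariance under the crystallographic group *)

Section GammaInvariance.
Variable R : realType.
Local Notation H := (heis R).
Implicit Types (p q v : H).
Variable c : R.

Lemma generated_sub (G : groupType) (A K : set G) :
  subgroup K -> A `<=` K -> generated A `<=` K.
Proof. by move=> sK AK x gx; exact: gx. Qed.

Lemma sub_generated (G : groupType) (A : set G) : A `<=` generated A.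
Proof. by move=> x Ax K [_ AK]; exact: AK. Qed.

Lemma stabilizer_subgroup (G : groupType) (X Y : Type) (act : G -> X -> X) (f : X -> Y) :
  (forall x, act 1%g x = x) -> (forall g h x, act (g * h)%g x = act g (act h x)) ->
  subgroup [set g | forall x, f (act g x) = f x].
Proof.
move=> a1 aM; split=> [x|g h fg fh x] /=; first by rewrite a1.
by rewrite aM fg -[LHS]fh -aM mulgV a1.
Qed.

Lemma turn4 (f : H -> R[i]) p : turn_eigen c 1 f -> f (((0, 0, c) : H) * p)%g = f p.
Proof.
move=> fc; rewrite -[RHS]mul1r -fc -[RHS]mul1r -fc -[RHS]mul1r -fc -[RHS]mul1r -fc.
case: p => [[x y] t]; rewrite heis_mulE /turn /=; congr (f (_, _, _)); try ring.
by field.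
Qed.

Lemma Gamma_invariantP (f : H -> R[i]) : (forall s p, Gamma c s -> f (hact s p) = f p) <->
  lattice_invariant f /\ turn_eigen c 1 f.
Proof.
have actE g p : hact (hincl g) p = (g * p)%g by rewrite /hact /htrans /hdil /= mu1.
have turnE p : hact (Hsim (hpt 0 (c / 4)) (imaginary_neq0 R)) p = turn (c / 4) p.
  case: p => [[x y] t]; rewrite /hact /htrans /hdil /= heis_mulE /mu normc2E /turn /=.
  by congr (_, _, _); rewrite /zpart /tpart /=; ring.
split=> [finv|[[f1 f2] fc] s p Gs].
  have linv g : Lambda 'i%C c g -> forall p, f (g * p)%g = f p.
    move=> Lg p; rewrite -actE; apply: finv; apply: sub_generated; left.
    by exists g.
  split; first split.
  - by apply: linv; apply: sub_generated; left; left.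
  - by apply: linv; apply: sub_generated; left; right.
  - move=> p; rewrite -turnE finv ?mul1r//.
    by apply: sub_generated; right.
have sK := stabilizer_subgroup (X := H) f (@hact1 R) (@hactM R).
apply: (generated_sub sK) Gs p => s' [[g Lg <-]|->] p /=; last by rewrite turnE fc mul1r.
rewrite actE.
have sK' := stabilizer_subgroup (X := H) f (@mul1g _) (fun g h x => esym (mulgA g h x)).
apply: (generated_sub sK') Lg p => g' [[->|->]|->] p.
- exact: f1.
- exact: f2.
- by rewrite -[hpt 0 c]/((0, 0, c) : H); exact: turn4.
Qed.

(** The fourth power of the quarter turn is the central translation by c, so
    the joint eigenspaces only involve the two horizontal translations and the
    turn. *)
Lemma joint_eigenspaceE (r a b : R) : r != 0 ->
  joint_eigenspace (Gamma c) r a b = level c (r * b) (- (2 * r * a)) 1.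
Proof.
move=> r0; have rC0 : r%:C != 0 :> R[i] by rewrite fmorph_eq0.
have i0 := imaginary_neq0 R.
have rV : (1 / r)%:C = r%:C^-1 :> R[i] by rewrite div1r fmorphV.
have r2V : (1 / (2 * r))%:C = (2 * r%:C)^-1 :> R[i].
  by rewrite div1r fmorphV rmorphM rmorph_nat.
apply/seteqP; split=> f.
  move=> [[sf /Gamma_invariantP[fl fc]] fS fT]; split=> // p.
    have := fT p; rewrite /reeb /d_t -[hpt 0 1]/(e_t R) rV rmorphM.
    move: (cderive _ f p) => d E.
    transitivity ('i%C * r%:C * (b%:C * f p)); last by ring.
    by rewrite -E; field; rewrite i0 rC0.
  have := fS p; rewrite /sublaplacian -[Zop _ _ + _]/(sumsq f p) r2V.
  move: (sumsq f p) => d E.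
  transitivity (- (2 * r%:C) * (a%:C * f p)); first by rewrite -E; field.
  by rewrite rmorphN !rmorphM rmorph_nat; ring.
move=> [sf fT fS fl fc]; split.
- by split=> //; exact/Gamma_invariantP.
- move=> p; rewrite /sublaplacian -[Zop _ _ + _]/(sumsq f p) fS r2V.
  by rewrite rmorphN !rmorphM rmorph_nat; field.
- move=> p; rewrite /reeb /d_t -[hpt 0 1]/(e_t R) fT rV rmorphM.
  by field; rewrite i0 rC0.
Qed.

End GammaInvariance.

Local Opaque e_x e_y e_t cderive Xop Yop Zop Zbarop sumsq.

(** * Fourier coefficients of smooth periodic functions *)

Section Mean.
Variable R : realType.
Implicit Types (g h u : R -> R) (x y s a b : R).

Lemma continuous_addf g h : continuous g -> continuous h -> continuous (fun x => g x + h x).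
Proof. by move=> cg ch x; exact: (continuousD (cg x) (ch x)). Qed.

Lemma continuous_subf g h : continuous g -> continuous h -> continuous (fun x => g x - h x).
Proof. by move=> cg ch x; exact: (continuousB (cg x) (ch x)). Qed.

Lemma continuous_mulf g h : continuous g -> continuous h -> continuous (fun x => g x * h x).
Proof. by move=> cg ch x; exact: (continuousM (cg x) (ch x)). Qed.

Lemma continuous_cstf a : continuous (fun _ : R => a).
Proof. by move=> x; exact: cst_continuous. Qed.

Lemma continuous_scalef a g : continuous g -> continuous (fun x => a * g x).
Proof. by move=> cg; exact: (continuous_mulf (@continuous_cstf a) cg). Qed.

Definition primitive g x : R := (\int[@lebesgue_measure R]_(t in `[(- 1)%R, x]) (g t))%R.

Lemma primitiveP g x : continuous g -> -1 < x -> is_derive x 1 (primitive g) (g x).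
Proof.
move=> cg x1; have xx1 : x < x + 1 by rewrite ltrDl.
have ig : (@lebesgue_measure R).-integrable `[(- 1)%R, x + 1] (EFin \o g).
  apply: continuous_compact_integrable; first exact: segment_compact.
  exact: continuous_subspaceT.
have [d e] := continuous_FTC1_closed xx1 ig x1 (cg x).
by rewrite -e derive1E; apply: derivableP.
Qed.

(** The integral over [0, 1], written with a primitive so that its properties
    follow from the mean value theorem. *)
Definition mean g : R := primitive g 1 - primitive g 0.

Lemma MVT_ge0 u g a b : 0 <= a -> a < b ->
  (forall x, 0 <= x -> is_derive x 1 u (g x)) ->
  exists2 c, a < c < b & u b - u a = g c * (b - a).
Proof.
move=> a0 ab hu; have [c cab e] : exists2 c, c \in `]a, b[ & u b - u a = g c * (b - a).
  apply: MVT => // [x|]; first by rewrite in_itv /= => /andP[ax _]; apply: hu; lra.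
  apply: derivable_within_continuous => x; rewrite in_itv /= => /andP[ax _].
  by have [|//] := hu x; lra.
by exists c => //; move: cab; rewrite in_itv.
Qed.

Lemma meanE u g : continuous g -> (forall x, 0 <= x -> is_derive x 1 u (g x)) ->
  mean g = u 1 - u 0.
Proof.
move=> cg hu; have hd x : 0 <= x -> is_derive x 1 (primitive g \- u) (g x - g x).
  move=> x0; apply: is_deriveB; last exact: hu.
  by apply: primitiveP => //; lra.
have [c _] := MVT_ge0 (lexx 0) (ltr01) hd.
by rewrite subrr mul0r /= /mean; lra.
Qed.

Lemma mean_deriv u g : continuous g -> (forall x, is_derive x 1 u (g x)) ->
  mean g = u 1 - u 0.
Proof. by move=> cg hu; apply: meanE. Qed.

Lemma primitive_ge0 g x : continuous g -> 0 <= x -> is_derive x 1 (primitive g) (g x).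
Proof. by move=> cg x0; apply: primitiveP => //; lra. Qed.

Lemma mean_comb a b g h : continuous g -> continuous h ->
  mean (fun x => a * g x + b * h x) = a * mean g + b * mean h.
Proof.
move=> cg ch; have cgh : continuous (fun x => a * g x + b * h x).
  by apply: continuous_addf; exact: continuous_scalef.
have D x : 0 <= x -> is_derive x 1 (fun x => a * primitive g x + b * primitive h x)
    (a * g x + b * h x).
  move=> x0; have Dg := primitive_ge0 cg x0; have Dh := primitive_ge0 ch x0.
  exact: (is_deriveD (is_deriveZ a Dg) (is_deriveZ b Dh)).
by rewrite (meanE cgh D) /mean; ring.
Qed.

Lemma mean_cst a : mean (fun=> a) = a.
Proof.
have ca := @continuous_cstf a.
have D (x : R) : is_derive x 1 (fun x => a * x) a.
  by have := is_deriveZ a (is_derive_id x (1 : R)); rewrite /GRing.scale /= mulr1.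
by rewrite (mean_deriv ca D); ring.
Qed.

Lemma mean_ge0 g : continuous g -> (forall x, 0 <= x <= 1 -> 0 <= g x) -> 0 <= mean g.
Proof.
move=> cg g0; have [c /andP[c0 c1]] := MVT_ge0 (lexx 0) ltr01 (fun x => @primitive_ge0 g x cg).
by rewrite /mean => ->; rewrite subr0 mulr1 g0// !ltW.
Qed.

Lemma mean_le g h : continuous g -> continuous h ->
  (forall x, 0 <= x <= 1 -> g x <= h x) -> mean g <= mean h.
Proof.
move=> cg ch gh; rewrite -subr_ge0.
have -> : mean h - mean g = mean (fun x => 1 * h x + (-1) * g x).
  by rewrite mean_comb//; ring.
apply: mean_ge0 => [|x x01]; last by rewrite mul1r mulN1r subr_ge0 gh.
by apply: continuous_addf; exact: continuous_scalef.
Qed.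

Lemma mean_gt0 g a b : continuous g -> 0 <= a -> a < b -> b <= 1 ->
  (forall x, 0 <= x <= 1 -> 0 <= g x) -> (forall x, a < x < b -> 0 < g x) ->
  0 < mean g.
Proof.
move=> cg a0 ab b1 g0 gab.
have P x y : 0 <= x -> x <= y -> y <= 1 -> primitive g x <= primitive g y.
  move=> x0; rewrite le_eqVlt => /orP[/eqP -> //|xy] y1; rewrite -subr_ge0.
  have [c /andP[cx cy] ->] := MVT_ge0 x0 xy (fun x => @primitive_ge0 g x cg).
  by rewrite mulr_ge0 ?subr_ge0 ?(ltW xy)//; apply: g0; lra.
have [c /andP[cx cy] E] := MVT_ge0 a0 ab (fun x => @primitive_ge0 g x cg).
have : 0 < primitive g b - primitive g a.
  by rewrite E mulr_gt0 ?subr_gt0//; apply: gab; rewrite cx.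
have b0 : 0 <= b by lra.
have := P 0 a (lexx 0) a0; have := P b 1 b0 b1 (lexx 1); rewrite /mean.
have -> : a <= 1 by lra.
by move=> h1 /(_ isT) h2; lra.
Qed.

(** The lower bound on s keeps the arguments inside the half-line on which the
    primitive, an integral from -1, is differentiable. *)
Lemma mean_shift g s : continuous g -> (forall x, g (1 + x) = g x) -> 0 <= s ->
  mean (fun x => g (s + x)) = mean g.
Proof.
move=> cg g1 s0; have cgs : continuous (fun x => g (s + x)).
  move=> x; apply: continuous_comp; last exact: cg.
  by apply: (continuous_addf (@continuous_cstf s)) => z; exact: cvg_id.
have sh a x : 0 <= a + x -> is_derive x 1 (fun y => primitive g (a + y)) (g (a + x)).
  move=> ax; have D := primitive_ge0 cg ax.
  have E : is_derive x 1 (fun y : R => a + y) 1.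
    by rewrite -[X in is_derive _ _ _ X]add0r; apply: is_deriveD.
  have := is_derive1_comp (f := primitive g) D E.
  by rewrite mulr1.
have Ds x : 0 <= x -> is_derive x 1 (fun y => primitive g (s + y)) (g (s + x)).
  by move=> x0; apply: sh; rewrite addr_ge0.
rewrite (meanE cgs Ds).
have D x : 0 <= x -> is_derive x 1 (fun y => primitive g (1 + y) - primitive g y) (g (1 + x) - g x).
  move=> x0; have x1 : 0 <= 1 + x by lra.
  exact: (is_deriveB (sh _ _ x1) (primitive_ge0 cg x0)).
rewrite addr0 (addrC s); move: s0; rewrite le_eqVlt => /orP[/eqP <-|s0].
  by rewrite addr0 /mean.
have [c /andP[c0 _]] := MVT_ge0 (lexx 0) s0 D.
by rewrite g1 subrr mul0r addr0 /mean => /eqP; rewrite subr_eq0 => /eqP.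
Qed.

End Mean.

Local Opaque e_x e_y e_t cderive Xop Yop Zop Zbarop sumsq primitive mean.

Section FourierUniqueness.
Variable R : realType.
Implicit Types (g h u : R -> R) (x y s a b th : R) (m : int) (n : nat).

(** Cosines with an arbitrary phase: they include the sines and are stable under
    products up to sums. *)
Definition wave m th y : R := cos (2 * pi * m%:~R * y + th).

Lemma continuous_wave m th : continuous (wave m th).
Proof.
move=> y; apply: continuous_comp; last exact: continuous_cos.
apply: (@continuous_addf R (fun y => 2 * pi * m%:~R * y) (fun=> th)).
  by apply: continuous_scalef => z; exact: cvg_id.
exact: continuous_cstf.
Qed.

Lemma mulr_cos a b : cos a * cos b = (cos (a + b) + cos (a - b)) / 2.
Proof. by rewrite cosD cosB; field. Qed.

(** The powers of this trigonometric polynomial concentrate at y0. *)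
Definition peak y0 y : R := (1 + wave 1 (- (2 * pi * y0)) y) / 2.

Lemma continuous_peak y0 : continuous (peak y0).
Proof.
have -> : peak y0 = fun y => 2^-1 * (1 + wave 1 (- (2 * pi * y0)) y).
  by apply/funext => y; rewrite /peak mulrC.
apply: continuous_scalef; apply: continuous_addf; first exact: continuous_cstf.
exact: continuous_wave.
Qed.

Lemma peakE y0 y : peak y0 y = (1 + cos (2 * pi * (y - y0))) / 2.
Proof. by rewrite /peak /wave; congr ((1 + cos _) / 2); ring. Qed.

Lemma peak_ge0 y0 y : 0 <= peak y0 y.
Proof. by rewrite peakE; have := cos_geN1 (2 * pi * (y - y0)); lra. Qed.

Lemma cos2pi_lt a b : 0 <= a -> a < b -> b <= 1 / 2 -> cos (2 * pi * b) < cos (2 * pi * a).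
Proof.
move=> a0 ab b1; have p0 := pi_gt0 R.
rewrite ltr_cos ?in_itv /= ?ltr_pM2l ?mulr_gt0//; apply/andP; split; nra.
Qed.

Lemma peak_inside y0 y d : d <= 1 / 2 -> `|y - y0| < d -> peak y0 (y0 + d) < peak y0 y.
Proof.
move=> d2 yd; rewrite !peakE addrAC subrr add0r.
rewrite -[cos (2 * pi * (y - y0))]cos_norm normrM gtr0_norm; last first.
  by rewrite mulr_gt0// pi_gt0.
have := cos2pi_lt (normr_ge0 (y - y0)) yd d2; lra.
Qed.

Lemma peak_outside y0 y d : 0 < d -> d <= 1 / 2 -> d <= `|y - y0| <= 1 - d ->
  peak y0 y <= peak y0 (y0 + d).
Proof.
move=> d0 d2 /andP[yd dy]; rewrite !peakE addrAC subrr add0r.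
rewrite -[cos (2 * pi * (y - y0))]cos_norm normrM gtr0_norm; last first.
  by rewrite mulr_gt0// pi_gt0.
set a := `|y - y0| in yd dy *.
have mono b : d <= b -> b <= 1 / 2 -> cos (2 * pi * b) <= cos (2 * pi * d).
  rewrite le_eqVlt => /orP[/eqP -> //|db b2].
  by apply: ltW; apply: cos2pi_lt => //; exact: ltW.
have [a2|a2] := leP a (1 / 2); first by have := mono a yd a2; lra.
have : cos (2 * pi * (1 - a)) <= cos (2 * pi * d) by apply: mono; lra.
have -> : cos (2 * pi * (1 - a)) = cos (2 * pi * a).
  by rewrite -[RHS]cosN -[RHS]cosD2pi -mulr_natl; congr cos; ring.
by move=> h; rewrite ler_pM2r// lerD2l.
Qed.

Definition fourier_null g := forall m th, mean (fun y => g y * wave m th y) = 0.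

Lemma fourier_null_peak g y0 : continuous g -> fourier_null g ->
  fourier_null (fun y => g y * peak y0 y).
Proof.
move=> cg g0 m th; pose ph := 2 * pi * y0.
have c m' th' : continuous (fun y => g y * wave m' th' y).
  by apply: continuous_mulf => //; exact: continuous_wave.
have -> : (fun y => g y * peak y0 y * wave m th y) = fun y =>
   2^-1 * (g y * wave m th y) + 1 * (4^-1 * (g y * wave (m + 1) (th - ph) y) +
   4^-1 * (g y * wave (m - 1) (th + ph) y)).
  apply/funext => y; rewrite /peak.
  have : wave (m + 1) (th - ph) y + wave (m - 1) (th + ph) y =
      2 * (wave 1 (- ph) y * wave m th y).
    rewrite /wave mulr_cos intrD intrB; set c1 := cos _; set c2 := cos _.
    rewrite (_ : cos (_ + _ + (_ + th)) = c1); last by rewrite /c1; congr cos; ring.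
    rewrite (_ : cos (_ - _) = c2); first by field.
    by rewrite -[LHS]cosN /c2; congr cos; ring.
  by rewrite -/ph mul1r => E; rewrite -mulrDr -mulrDr E; field.
have [c0 [c1 c2]] := (c m th, (c (m + 1) (th - ph), c (m - 1) (th + ph))).
have c12 := continuous_addf (continuous_scalef (a := 4^-1) c1) (continuous_scalef (a := 4^-1) c2).
move: (mean_comb 2^-1 1 c0 c12) (mean_comb 4^-1 4^-1 c1 c2) => /= -> ->.
by rewrite !g0 !mulr0 addr0 mulr0 addr0.
Qed.

Local Opaque peak.

Lemma scaled_power a b c n : c ^- n * (a * b ^+ n) = a * (b / c) ^+ n.
Proof. by rewrite expr_div_n mulrC mulrA. Qed.

(** Otherwise g would be at least some e > 0 on a window around y0, while its mean
    against every power of the peak vanishes.  On the window Bernoulli's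
    inequality makes the powers of the peak grow linearly relative to their size
    elsewhere. *)
Lemma fourier_null_le0 g y0 : continuous g -> fourier_null g -> 0 < y0 < 1 ->
  g y0 <= 0.
Proof.
move=> cg g0 /andP[y00 y01]; rewrite leNgt; apply/negP => gy0.
pose e := g y0 / 2; have e0 : 0 < e by rewrite divr_gt0.
have [d0 d00 hd0] : exists2 d : R, 0 < d & forall y, `|y - y0| < d -> e <= g y.
  have ey : e < g y0 by rewrite /e ltr_pdivrMr// ltr_pMr// ltr1n.
  have /nbhs_ballP[d /= d0 hd] := cg y0 _ (open_nbhs_nbhs (conj (@open_gt R e) ey)).
  exists d => // y yd; apply/ltW/hd.
  by rewrite -ball_normE /= distrC.
pose d := Num.min (Num.min d0 (1 / 4)) (Num.min y0 (1 - y0)).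
have d_gt0 : 0 < d by rewrite !lt_min d00 y00 subr_gt0 y01; lra.
have dd0 : d <= d0 by rewrite /d !ge_min lexx.
have d4 : d <= 1 / 4 by rewrite /d !ge_min lexx !orbT.
have dy0 : d <= y0 by rewrite /d !ge_min lexx !orbT.
have dy1 : d <= 1 - y0 by rewrite /d !ge_min lexx !orbT.
have d2 : d <= 1 / 2 by lra.
pose q := peak y0 (y0 + d).
have q0 : 0 < q.
  rewrite /q peakE addrAC subrr add0r.
  have : cos (2 * pi * (1 / 2)) < cos (2 * pi * d) :> R by apply: cos2pi_lt; lra.
  by rewrite (_ : 2 * pi * (1 / 2) = pi :> R) ?cospi; [lra|field].
pose w y := Num.max (peak y0 y / q - 1) 0.
have cw : continuous w.
  have -> : w = (fun y => q^-1 * peak y0 y + (-1)) \max cst 0.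
    by apply/funext => y; rewrite /w /= mulrC.
  move=> y; apply: continuous_max; last exact: cst_continuous.
  apply: (continuous_addf (continuous_scalef (continuous_peak (y0 := y0)))).
  exact: continuous_cstf.
have [B hB] : exists B, forall y, 0 <= y <= 1 -> - B <= g y.
  have [z _ hz] := EVT_min (ler01) (continuous_subspaceT cg).
  by exists (- g z) => y y01'; rewrite opprK; apply: hz; rewrite in_itv.
have gK n : fourier_null (fun y => g y * peak y0 y ^+ n) /\
    continuous (fun y => g y * peak y0 y ^+ n).
  elim: n => [|n [IH1 IH2]].
    by under eq_fun do rewrite expr0 mulr1.
  under eq_fun do rewrite exprSr mulrA; split; first exact: fourier_null_peak.
  by apply: continuous_mulf => //; exact: continuous_peak.
have B0 : 0 <= Num.max B 0 by rewrite le_max lexx orbT.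
have bound n y : 0 <= y <= 1 ->
    (n%:R * e) * w y + (- Num.max B 0) * 1 <= (q ^- n) * (g y * peak y0 y ^+ n).
  move=> y01'; have -> : q ^- n * (g y * peak y0 y ^+ n) = g y * (peak y0 y / q) ^+ n.
    exact: scaled_power.
  set k := peak y0 y / q; have k0 : 0 <= k by rewrite divr_ge0 ?peak_ge0// ltW.
  have [yd|yd] := ltP `|y - y0| d.
    have k1 : 1 < k by rewrite ltr_pdivlMr// mul1r; exact: peak_inside.
    have -> : w y = k - 1 by rewrite /w; apply: max_l; rewrite subr_ge0 ltW.
    have ge : e <= g y by apply: hd0; exact: lt_le_trans yd dd0.
    have bern : 1 + n%:R * (k - 1) <= k ^+ n.
      elim: n => [|n IHn]; first by rewrite mul0r addr0 expr0.
      rewrite exprS -natr1; have n0 : 0 <= n%:R :> R by [].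
      have : k * (1 + n%:R * (k - 1)) <= k * k ^+ n by rewrite ler_wpM2l.
      have : 0 <= n%:R * (k - 1) * (k - 1) by rewrite !mulr_ge0// subr_ge0 ltW.
      lra.
    have kn : 0 <= k ^+ n by rewrite exprn_ge0.
    have : e * k ^+ n <= g y * k ^+ n by rewrite ler_wpM2r.
    have : e * (1 + n%:R * (k - 1)) <= e * k ^+ n by rewrite ler_wpM2l// ltW.
    lra.
  have k1 : k <= 1.
    rewrite ler_pdivrMr// mul1r; apply: peak_outside => //.
    by rewrite yd ler_norml; move/andP: y01' => [? ?]; apply/andP; split; lra.
  have -> : w y = 0 by rewrite /w; apply: max_r; rewrite subr_le0.
  have kn : 0 <= k ^+ n <= 1 by rewrite exprn_ge0// exprn_ile1.
  have gB : - Num.max B 0 <= g y.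
    by apply: le_trans (hB y y01'); rewrite lerN2 le_max lexx.
  rewrite mulr0 add0r mulr1; move/andP: kn => [kn0 kn1].
  have := ler_wpM2r kn0 gB; have := ler_wpM2l B0 kn1; lra.
have mw : 0 < mean w.
  apply: (mean_gt0 (a := y0 - d) (b := y0 + d)) => //; try lra.
    by move=> y _; rewrite /w le_max lexx orbT.
  move=> y /andP[y1 y2]; rewrite /w lt_max; apply/orP; left.
  rewrite subr_gt0 ltr_pdivlMr// mul1r; apply: peak_inside => //.
  by rewrite ltr_norml; apply/andP; split; lra.
have main n : n%:R * e * mean w <= Num.max B 0.
  have [G1 G2] := gK n.
  have := mean_le _ _ (bound n).
  rewrite mean_comb//; last exact: continuous_cstf.
  have -> : mean (fun y => q ^- n * (g y * peak y0 y ^+ n)) = 0.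
    have := G1 0 0; rewrite /wave; under eq_fun do rewrite mulr0 mul0r addr0 cos0 mulr1.
    have := mean_comb (q ^- n) 0 G2 G2.
    by under eq_fun do rewrite mul0r addr0; move=> -> ->; rewrite mulr0 mul0r addr0.
  rewrite mean_cst mulr1 => H; rewrite -subr_le0; apply: H.
    exact: (continuous_addf (continuous_scalef cw) (@continuous_cstf R _)).
  exact: continuous_scalef.
have ew : 0 < e * mean w by rewrite mulr_gt0.
have := archi_boundP (divr_ge0 B0 (ltW ew)).
rewrite ltr_pdivrMr// mulrA => /lt_le_trans /(_ (main _)).
by rewrite ltxx.
Qed.

(** [fourier_null_le0] applies to g and to its opposite at the interior points of
    a period; the end points follow by continuity. *)
Lemma fourier_null_eq0 g : continuous g -> (forall y, g (1 + y) = g y) ->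
  fourier_null g -> forall y, g y = 0.
Proof.
move=> cg g1 gn.
have gN : fourier_null (fun y => - g y).
  move=> m th; have := mean_comb (-1) 0 (continuous_mulf cg (continuous_wave (m := m) (th := th)))
    (continuous_mulf cg (continuous_wave (m := m) (th := th))).
  under eq_fun do rewrite mul0r addr0 mulN1r -mulNr.
  by move=> ->; rewrite gn mulr0 mul0r addr0.
have cgN : continuous (fun y => - g y) by move=> y; exact: (continuousN (cg y)).
have g01 y : 0 < y < 1 -> g y = 0.
  move=> y01; apply/eqP; rewrite eq_le (fourier_null_le0 cg)//=.
  by rewrite -oppr_le0 (fourier_null_le0 cgN).
have g00 : g 0 = 0.
  apply/eqP; apply: contraT => ne0.
  have cn : {for 0, continuous (fun y => `|g y|)}.
    by apply: continuous_comp; [exact: cg|exact: norm_continuous].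
  have n0 : 0 < `|g 0| by rewrite normr_gt0.
  have /nbhs_ballP[d /= d0 hd] := cn _ (open_nbhs_nbhs (conj (@open_gt R 0) n0)).
  pose z := Num.min (d / 2) (1 / 2).
  have z0 : 0 < z by rewrite lt_min divr_gt0//=; lra.
  have zd : z < d.
    by rewrite gt_min ltr_pdivrMr// ltr_pMr// ltr1n.
  have z1 : z < 1 by rewrite gt_min orbC; apply/orP; left; lra.
  have := hd z; rewrite -ball_normE /= sub0r normrN gtr0_norm// g01 ?z0//.
  by rewrite normr0 ltxx => /(_ zd).
move=> y; rewrite -[y](subrK (Num.floor y)%:~R) addrC.
rewrite (periodic_int (F := g))//.
have := floor_le y; have := floorD1_gt y; rewrite intrD => h1 h2.
have [->//|ne] := eqVneq (y - (Num.floor y)%:~R) 0.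
apply: g01; rewrite lt_neqAle eq_sym ne subr_ge0 h2 /=; lra.
Qed.

End FourierUniqueness.

Local Opaque e_x e_y e_t cderive Xop Yop Zop Zbarop sumsq primitive mean.

Section ComplexMean.
Variable R : realType.
Local Notation H := (heis R).
Implicit Types (f : H -> R[i]) (u : H -> R) (g h : R -> R[i]) (p v : H).
Implicit Types (x y s t : R) (m : int).
Local Notation e_x := (e_x R).
Local Notation e_y := (e_y R).
Local Notation e_t := (e_t R).

Lemma line_x s x y t : s *: e_x + (x, y, t) = (s + x, y, t) :> H.
Proof. by rewrite e_xP; congr (_, _, _); rewrite /= /GRing.scale /=; ring. Qed.
Lemma line_y s x y t : s *: e_y + (x, y, t) = (x, s + y, t) :> H.
Proof. by rewrite e_yP; congr (_, _, _); rewrite /= /GRing.scale /=; ring. Qed.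

Lemma is_derive_x u x y t : rsmooth u ->
  is_derive x 1 (fun x => u (x, y, t)) ('D_e_x u (x, y, t)).
Proof.
move=> su; have := is_derive_line (0, y, t) e_x x su.
by under eq_fun do rewrite line_x addr0; rewrite line_x addr0.
Qed.

Lemma is_derive_y u x y t : rsmooth u ->
  is_derive y 1 (fun y => u (x, y, t)) ('D_e_y u (x, y, t)).
Proof.
move=> su; have := is_derive_line (x, 0, t) e_y y su.
by under eq_fun do rewrite line_y addr0; rewrite line_y addr0.
Qed.

Lemma is_derive_continuous (F dF : R -> R) :
  (forall x : R, is_derive x 1 F (dF x)) -> continuous F.
Proof.
move=> hF x; apply: differentiable_continuous; apply/derivable1_diffP.
by case: (hF x).
Qed.

Lemma continuous_slice_y u x t : rsmooth u -> continuous (fun y => u (x, y, t)).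
Proof. by move=> su; apply: is_derive_continuous => y; exact: is_derive_y. Qed.

Lemma MVT_abs (F dF : R -> R) a b : (forall x : R, is_derive x 1 F (dF x)) ->
  exists2 c, `|c - a| <= `|b - a| & F b - F a = dF c * (b - a).
Proof.
move=> hF; have [ab|ba|<-] := ltgtP a b.
- have [c /andP[c1 c2] E] := MVT_real ab hF; exists c => //.
  by rewrite !ger0_norm ?subr_ge0 ?lerD2r ?(ltW c1) ?(ltW c2) ?(ltW ab).
- have [c /andP[c1 c2] E] := MVT_real ba hF; exists c.
    rewrite distrC [X in _ <= X]distrC.
    by rewrite !ger0_norm ?subr_ge0 ?lerD2l ?lerN2 ?(ltW c1) ?(ltW c2) ?(ltW ba).
  by rewrite -[LHS]opprB E -mulrN opprB.
- by exists a => //; rewrite !subrr mulr0.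
Qed.

Lemma taylor2 (F dF ddF : R -> R) x s B :
  (forall x : R, is_derive x 1 F (dF x)) -> (forall x : R, is_derive x 1 dF (ddF x)) ->
  (forall z, `|z - x| <= `|s| -> `|ddF z| <= B) ->
  `|F (s + x) - F x - s * dF x| <= B * s ^+ 2.
Proof.
move=> h1 h2 hB; have [c cs E1] := MVT_abs x (s + x) h1.
have [d dc E2] := MVT_abs x c h2; rewrite addrK in cs E1.
rewrite E1 [s * _]mulrC -mulrBl E2 !normrM -[s ^+ 2]real_normK ?num_real// expr2 mulrA.
apply: ler_wpM2r => //; apply: ler_pM => //; apply: hB.
exact: le_trans dc cs.
Qed.

(** A quadratic bound on the error of the linear approximation identifies the
    derivative; the bound is what survives under a mean or a series. *)
Lemma is_derive_quadratic (F : R -> R) x d B :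
  (forall s, `|s| <= 1 -> `|F (s + x) - F x - s * d| <= B * s ^+ 2) ->
  is_derive x 1 F d.
Proof.
move=> hF; have lim : (fun h : R => h^-1 *: ((F \o shift x) (h *: 1) - F x)) @ 0^' --> d.
  apply/cvgrPdist_le => e e0; near=> h.
  have h0 : h != 0 by near: h; exact: nbhs_dnbhs_neq.
  have h1 : `|h| <= 1.
    near: h; apply: dnbhs0_le; exact: ltr01.
  have hB : `|h| <= e / (`|B| + 1).
    near: h; apply: dnbhs0_le; rewrite divr_gt0// ltr_wpDl//.
  have := hF h h1; rewrite /= [h *: 1]mulr1.
  rewrite (_ : d - h^-1 *: (F (h + x) - F x) = - h^-1 * (F (h + x) - F x - h * d)); last first.
    by rewrite /GRing.scale /=; field.
  rewrite normrM normrN normfV => hb.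
  have nh : 0 < `|h| by rewrite normr_gt0.
  rewrite mulrC ler_pdivrMr//; apply: (le_trans hb).
  rewrite -[h ^+ 2]real_normK ?num_real// expr2 mulrA ler_pM2r//.
  apply: (@le_trans _ _ ((`|B| + 1) * `|h|)).
    by apply: ler_wpM2r => //; apply: (le_trans (ler_norm B)); rewrite lerDl.
  by rewrite mulrC -ler_pdivlMr// ltr_wpDl.
apply: DeriveDef; first by apply/cvg_ex; exists d.
by apply/cvg_lim => //.
Unshelve. all: by end_near. Qed.

(** Differentiation under the mean: the second derivative is bounded on a compact
    strip, which gives a quadratic bound uniform in y. *)
Lemma is_derive_mean u x : rsmooth u ->
  is_derive x 1 (fun x => mean (fun y => u (x, y, 0)))
    (mean (fun y => 'D_e_x u (x, y, 0))).
Proof.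
move=> su; have su1 := rsmooth_derive e_x su; have su2 := rsmooth_derive e_x su1.
have cB : compact ((`[x - 1, x + 1] : set R) `*` (`[0, 1] : set R)).
  by apply: compact_setX; exact: segment_compact.
pose N (z : R * R) : R := `|'D_e_x ('D_e_x u) (z, 0)|.
have cN : continuous N.
  move=> z; apply: (@continuous_comp _ _ _ (fun z : R * R => (z, 0) : H)
    (fun p => `|'D_e_x ('D_e_x u) p|)).
    have c0 : (fun z : R * R => (z, (0 : R))) @ z --> (z, (0 : R)).
      apply: (@cvg_pair _ _ _ _ (nbhs z) (nbhs (0 : R)) _ _ _ id (fun=> 0)).
        exact: cvg_id.
      exact: cvg_cst.
    exact: c0.
  apply: continuous_comp; [exact: (rsmooth_continuous su2)|exact: norm_continuous].
have [|z0 _ hz] := compact_EVT_max _ cB (continuous_subspaceT cN).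
  exists (x, 0); split; rewrite /= in_itv /= ?lexx ?ler01//.
  by apply/andP; split; lra.
apply: (is_derive_quadratic (B := N z0)) => s s1.
have bound y : 0 <= y <= 1 ->
    `|u (s + x, y, 0) - u (x, y, 0) - s * 'D_e_x u (x, y, 0)| <= N z0 * s ^+ 2.
  move=> y01; apply: (taylor2 (fun x => is_derive_x x y 0 su) (fun x => is_derive_x x y 0 su1)).
  move=> z zs; apply: (hz (z, y)); rewrite inE; split; rewrite /= in_itv//=.
  by have := le_trans zs s1; rewrite ler_distlC => /andP[? ?]; apply/andP; split; lra.
have c0 := @continuous_slice_y u (s + x) 0 su.
have c1 := @continuous_slice_y u x 0 su.
have c2 := @continuous_slice_y _ x 0 su1.
have cs := continuous_scalef (a := s) c2.
have -> : mean (fun y => u (s + x, y, 0)) - mean (fun y => u (x, y, 0)) -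
    s * mean (fun y => 'D_e_x u (x, y, 0)) =
    mean (fun y => u (s + x, y, 0) - u (x, y, 0) - s * 'D_e_x u (x, y, 0)).
  have E1 := mean_comb 1 (- 1) c0 c1.
  have E2 := mean_comb 1 (- s) (continuous_addf (continuous_scalef (a := 1) c0)
    (continuous_scalef (a := - 1) c1)) c2.
  move: E2; rewrite /= E1.
  have -> : (fun y => 1 * (1 * u (s + x, y, 0) + -1 * u (x, y, 0)) +
     - s * 'D_e_x u (x, y, 0)) =
     fun y => u (s + x, y, 0) - u (x, y, 0) - s * 'D_e_x u (x, y, 0).
    by apply/funext => y; rewrite !mul1r mulN1r mulNr.
  by move=> ->; rewrite !mul1r mulN1r mulNr.
have cd := continuous_subf (continuous_subf c0 c1) cs.
have cB2 := @continuous_cstf R (N z0 * s ^+ 2).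
have cB3 := @continuous_cstf R (- (N z0 * s ^+ 2)).
rewrite ler_norml -{1}[- _](mean_cst (- (N z0 * s ^+ 2))) -[X in _ && (_ <= X)](mean_cst (N z0 * s ^+ 2)).
by apply/andP; split; apply: mean_le => // y /bound; rewrite ler_norml => /andP[].
Qed.


Definition cmean g : R[i] :=
  mean (fun y => complex.Re (g y)) +i* mean (fun y => complex.Im (g y)).

Definition ccontinuous g :=
  continuous (fun y => complex.Re (g y)) /\ continuous (fun y => complex.Im (g y)).

Lemma ccontinuous_mul g h : ccontinuous g -> ccontinuous h ->
  ccontinuous (fun y => g y * h y).
Proof.
move=> [g1 g2] [h1 h2]; split.
  under eq_fun do rewrite Re_mul.
  by apply: continuous_subf; exact: continuous_mulf.
under eq_fun do rewrite Im_mul.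
by apply: continuous_addf; exact: continuous_mulf.
Qed.

Lemma cmean_comb (a b : R[i]) g h : ccontinuous g -> ccontinuous h ->
  cmean (fun y => a * g y + b * h y) = a * cmean g + b * cmean h.
Proof.
move=> [g1 g2] [h1 h2].
have E (a1 a2 b1 b2 : R) : mean (fun y => (a1 * complex.Re (g y) + a2 * complex.Im (g y)) +
    (b1 * complex.Re (h y) + b2 * complex.Im (h y))) =
    (a1 * mean (fun y => complex.Re (g y)) + a2 * mean (fun y => complex.Im (g y))) +
    (b1 * mean (fun y => complex.Re (h y)) + b2 * mean (fun y => complex.Im (h y))).
  have cg := continuous_addf (continuous_scalef (a := a1) g1) (continuous_scalef (a := a2) g2).
  have ch := continuous_addf (continuous_scalef (a := b1) h1) (continuous_scalef (a := b2) h2).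
  have := mean_comb 1 1 cg ch; under eq_fun do rewrite !mul1r.
  by move=> ->; rewrite !mul1r (mean_comb a1 a2 g1 g2) (mean_comb b1 b2 h1 h2).
case: a b => [a1 a2] [b1 b2]; rewrite /cmean.
have -> : (fun y => complex.Re ((a1 +i* a2) * g y + (b1 +i* b2) * h y)) =
    fun y => (a1 * complex.Re (g y) + (- a2) * complex.Im (g y)) +
    (b1 * complex.Re (h y) + (- b2) * complex.Im (h y)).
  by apply/funext => y; rewrite Re_add !Re_mul /=; ring.
have -> : (fun y => complex.Im ((a1 +i* a2) * g y + (b1 +i* b2) * h y)) =
    fun y => (a2 * complex.Re (g y) + a1 * complex.Im (g y)) +
    (b2 * complex.Re (h y) + b1 * complex.Im (h y)).
  by apply/funext => y; rewrite Im_add !Im_mul /=; ring.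
by rewrite !E; cring.
Qed.

Lemma cmeanZ (a : R[i]) g : ccontinuous g -> cmean (fun y => a * g y) = a * cmean g.
Proof.
move=> cg; have := cmean_comb a 0 cg cg.
by under eq_fun do rewrite mul0r addr0; rewrite mul0r addr0.
Qed.

Lemma cmean_shift g s : ccontinuous g -> (forall y, g (1 + y) = g y) -> 0 <= s ->
  cmean (fun y => g (s + y)) = cmean g.
Proof.
move=> [g1 g2] gp s0; apply: complex_congr; apply: mean_shift => // y.
  by rewrite gp.
by rewrite gp.
Qed.

Lemma ccontinuous_slice_y f x t : smooth f -> ccontinuous (fun y => f (x, y, t)).
Proof. by move=> /smoothP[f1 f2]; split;
  [exact: (@continuous_slice_y _ x t f1)|exact: (@continuous_slice_y _ x t f2)]. Qed.

(** The characters of the circle R / Z. *)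
Definition wavec m y : R[i] := cexp ('i%C * (2 * pi * m%:~R * y)%:C).

Lemma wavecE m y : wavec m y = cos (2 * pi * m%:~R * y) +i* sin (2 * pi * m%:~R * y).
Proof. by rewrite /wavec /cexp /= !mul0r !mul1r subr0 add0r expR0 !mul1r. Qed.

Lemma ccontinuous_wavec m : ccontinuous (wavec m).
Proof.
have -> : wavec m = fun y => wave m 0 y +i* wave m (- (pi / 2)) y.
  by apply/funext => y; rewrite wavecE /wave addr0 cosBpihalf.
by split; exact: continuous_wave.
Qed.

Lemma wavecD m y s : wavec m (y + s) = wavec m y * wavec m s.
Proof. by rewrite /wavec -cexpD; congr cexp; rewrite mulrDr rmorphD; ring. Qed.

Lemma wavec_int m : wavec m 1 = 1.
Proof.
rewrite /wavec mulr1; have n1 n : cexp ('i%C * (2 * pi * n%:R)%:C) = 1 :> R[i].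
  rewrite -[LHS](_ : cexp (('i%C * (2 * pi)%:C) *+ n) = _).
    by rewrite cexpMn cexp_2pi expr1n.
  by congr cexp; rewrite -mulr_natr !rmorphM !rmorph_nat; ring.
case: m => n; first by rewrite -pmulrn n1.
rewrite NegzE mulrNz -pmulrn mulrN rmorphN mulrN cexpN n1 invr1.
by [].
Qed.

Lemma wavec1 m y : wavec m (1 + y) = wavec m y.
Proof. by rewrite wavecD wavec_int mul1r. Qed.

(** The coefficients of the real and imaginary parts are recovered from those of
    g at m and - m. *)
Lemma cfourier_eq0 g : ccontinuous g -> (forall y, g (1 + y) = g y) ->
  (forall m, cmean (fun y => g y * wavec m y) = 0) -> forall y, g y = 0.
Proof.
move=> [g1 g2] gp g0.
pose A (u : R -> R) m := mean (fun y => u y * cos (2 * pi * m%:~R * y)).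
pose B (u : R -> R) m := mean (fun y => u y * sin (2 * pi * m%:~R * y)).
have cc m : continuous (fun y : R => cos (2 * pi * m%:~R * y)).
  by have := @continuous_wave R m 0; rewrite /wave; under eq_fun do rewrite addr0.
have cs m : continuous (fun y : R => sin (2 * pi * m%:~R * y)).
  have := @continuous_wave R m (- (pi / 2)); rewrite /wave.
  by under eq_fun do rewrite cosBpihalf.
have AB (u : R -> R) m th : continuous u -> A u m = 0 -> B u m = 0 ->
    mean (fun y => u y * wave m th y) = 0.
  move=> cu A0 B0.
  have := mean_comb (cos th) (- sin th) (continuous_mulf cu (cc m)) (continuous_mulf cu (cs m)).
  rewrite -/(A u m) -/(B u m) A0 B0 !mulr0 addr0 => <-; congr mean; apply/funext => y.
  by rewrite /wave cosD; ring.
have AN (u : R -> R) m : A u (- m) = A u m.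
  by congr mean; apply/funext => y; rewrite mulrNz mulrN mulNr cosN.
have BN (u : R -> R) m : continuous u -> B u (- m) = - B u m.
  move=> cu; have := mean_comb (- 1) 0 (continuous_mulf cu (cs m)) (continuous_mulf cu (cs m)).
  rewrite mul0r addr0 mulN1r => <-; congr mean; apply/funext => y.
  by rewrite mulrNz mulrN mulNr sinN; ring.
pose a := fun y => complex.Re (g y); pose b := fun y => complex.Im (g y).
have E m : A a m - B b m = 0 /\ B a m + A b m = 0.
  have := g0 m; rewrite /cmean => /eqP; rewrite eq_complex /= => /andP[/eqP R0 /eqP I0].
  split; [rewrite -[RHS]R0|rewrite -[RHS]I0].
    have := mean_comb 1 (- 1) (continuous_mulf g1 (cc m)) (continuous_mulf g2 (cs m)).
    rewrite mul1r mulN1r => <-; congr mean; apply/funext => y.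
    by rewrite wavecE Re_mul /=; ring.
  have := mean_comb 1 1 (continuous_mulf g1 (cs m)) (continuous_mulf g2 (cc m)).
  rewrite !mul1r => <-; congr mean; apply/funext => y.
  by rewrite wavecE Im_mul /=; ring.
have Z m : [/\ A a m = 0, B a m = 0, A b m = 0 & B b m = 0].
  have [E1 E2] := E m; have [] := E (- m); rewrite !AN !BN// => E3 E4.
  by split; lra.
have a0 : forall y, a y = 0.
  apply: fourier_null_eq0 => // [y|m th]; first by rewrite /a gp.
  by have [? ? _ _] := Z m; exact: AB.
have b0 : forall y, b y = 0.
  apply: fourier_null_eq0 => // [y|m th]; first by rewrite /b gp.
  by have [_ _ ? ?] := Z m; exact: AB.
by move=> y; apply/eqP; rewrite eq_complex -/(a y) -/(b y) a0 b0 !eqxx.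
Qed.

Lemma is_derive_cmean f x : smooth f ->
  is_derive x 1 (fun x => complex.Re (cmean (fun y => f (x, y, 0))))
    (complex.Re (cmean (fun y => cderive e_x f (x, y, 0)))) /\
  is_derive x 1 (fun x => complex.Im (cmean (fun y => f (x, y, 0))))
    (complex.Im (cmean (fun y => cderive e_x f (x, y, 0)))).
Proof. by move=> /smoothP[f1 f2]; split; exact: is_derive_mean. Qed.

Lemma cmean_dy f x : smooth f -> (forall y, f (x, 1 + y, 0) = f (x, y, 0)) ->
  cmean (fun y => cderive e_y f (x, y, 0)) = 0.
Proof.
move=> /smoothP[f1 f2] fp; rewrite /cmean.
Transparent cderive.
have per u : rsmooth u -> u (x, 1 + 0, 0) = u (x, 0, 0) ->
    mean (fun y => 'D_e_y u (x, y, 0)) = 0.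
  move=> su; rewrite addr0 => u1.
  have cu := @continuous_slice_y _ x 0 (rsmooth_derive e_y su).
  by rewrite (mean_deriv cu (fun y => is_derive_y x y 0 su)) u1 subrr.
by apply: complex_congr; apply: per => //; rewrite fp.
Opaque cderive.
Qed.

Lemma is_derive0_cst (F : R -> R) : (forall x : R, is_derive x 1 F 0) -> forall x y, F x = F y.
Proof.
move=> hF x y; have [c _] := MVT_abs y x hF; rewrite mul0r => /eqP.
by rewrite subr_eq0 => /eqP.
Qed.

Lemma cmean_const f : smooth f ->
  (forall x, cmean (fun y => cderive e_x f (x, y, 0)) = 0) ->
  forall x x', cmean (fun y => f (x, y, 0)) = cmean (fun y => f (x', y, 0)).
Proof.
move=> sf f0 x x'.
have D x := is_derive_cmean x sf.
apply/eqP; rewrite eq_complex; apply/andP; split; apply/eqP.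
  by apply: (is_derive0_cst (F := fun x => complex.Re (cmean (fun y => f (x, y, 0))))) => z;
    have [+ _] := D z; rewrite f0.
by apply: (is_derive0_cst (F := fun x => complex.Im (cmean (fun y => f (x, y, 0))))) => z;
    have [_ +] := D z; rewrite f0.
Qed.

End ComplexMean.

Local Opaque e_x e_y e_t cderive Xop Yop Zop Zbarop sumsq primitive mean.

(** * Rapidly convergent sums over the integers *)

Section IntegerSums.
Variable R : realType.
Implicit Types (u v c : int -> R) (B : R) (m : int).

Definition zabs m : R := `|m|%N%:R.

(** The geometric rate 1/e is enough, since the coefficients to be summed decay
    faster than any exponential. *)
Definition fast B u := forall m, `|u m| <= B * expR (- zabs m).
Definition fold u : R^nat := fun k => u (Posz k) + u (Negz k).

Definition zsum u : R := limn (series (fold u)).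

Local Notation q := (expR (- 1) : R).

Lemma q_lt1 : `|q| < 1.
Proof. by rewrite ger0_norm ?expR_ge0// -(@expR0 R) ltr_expR ltrN10. Qed.

Lemma fast_fold B u : fast B u -> forall k, `|fold u k| <= geometric (2 * B) q k.
Proof.
move=> hu k; rewrite /geometric /=.
have E : q ^+ k = expR (- k%:R) by rewrite -expRM_natl mulrN1.
have B0 : 0 <= B by have := hu 0; rewrite /zabs oppr0 expR0 mulr1; exact: le_trans.
have u1 := hu (Posz k); have u2 := hu (Negz k).
have e2 : expR (- zabs (Negz k)) <= expR (- k%:R).
  by rewrite ler_expR lerN2 /zabs ler_nat /= leqnSn.
apply: (le_trans (ler_normD _ _)); rewrite E mulr_natl mulr2n mulrDl.
by apply: lerD => //; apply: (le_trans u2); apply: ler_wpM2l.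
Qed.

Lemma fast_norm_cvg B u : fast B u -> cvgn (series (fun k => `|fold u k|)).
Proof.
move=> hu; apply: (series_le_cvg _ _ (fast_fold hu)) => // [k|].
  by apply: le_trans (fast_fold hu k).
exact: is_cvg_geometric_series q_lt1.
Qed.

Lemma fast_cvg B u : fast B u -> cvgn (series (fold u)).
Proof. by move=> /fast_norm_cvg; exact: normed_cvg. Qed.

Definition zsum_cst : R := 2 / (1 - q).

Lemma zsum_bound B u : fast B u -> `|zsum u| <= B * zsum_cst.
Proof.
move=> hu; apply: le_trans (lim_series_norm (fast_norm_cvg hu)) _.
have -> : B * zsum_cst = limn (series (geometric (2 * B) q)).
  rewrite (cvg_lim _ (cvg_geometric_series q_lt1)) //.
  by rewrite /zsum_cst; ring.
apply: lim_series_le; [exact: fast_norm_cvg hu| |exact: fast_fold].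
exact: is_cvg_geometric_series q_lt1.
Qed.

Lemma zsum_comb a b B B' u v : fast B u -> fast B' v ->
  zsum (fun m => a * u m + b * v m) = a * zsum u + b * zsum v.
Proof.
move=> hu hv; have cu := fast_cvg hu; have cv := fast_cvg hv.
have -> : zsum (fun m => a * u m + b * v m) = limn (series (a *: fold u + b *: fold v)).
  rewrite /zsum; congr (limn (series _)); apply/funext => k.
  by rewrite /fold !fctE /GRing.scale /=; ring.
rewrite lim_seriesD; [|exact: is_cvg_seriesZ|exact: is_cvg_seriesZ].
by rewrite !lim_seriesZ.
Qed.

Lemma fast_cvg0 B u : fast B u ->
  (fun k : nat => u (Posz k)) @ \oo --> (0 : R) /\ (fun k : nat => u (Negz k)) @ \oo --> (0 : R).
Proof.
move=> hu; have B0 : 0 <= B by have := hu 0; rewrite /zabs oppr0 expR0 mulr1; exact: le_trans.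
have g0 : (fun k => geometric B q k) @ \oo --> (0 : R) := cvg_geometric B q_lt1.
have gN0 : (fun k => - geometric B q k) @ \oo --> (0 : R).
  by rewrite -oppr0; exact: cvgN.
have E k : q ^+ k = expR (- k%:R) :> R by rewrite -expRM_natl mulrN1.
split; apply: (squeeze_cvgr _ gN0 g0); near=> k; rewrite -ler_norml /geometric /= E.
  exact: hu.
apply: (le_trans (hu (Negz k))); apply: ler_wpM2l => //.
by rewrite ler_expR lerN2 /zabs ler_nat /= leqnSn.
Unshelve. all: by end_near. Qed.

(** Shifting the index changes the symmetric partial sums by two boundary terms. *)
Lemma zsum_shift B u : fast B u -> zsum (fun m => u (m + 1)) = zsum u.
Proof.
move=> hu; have cu := fast_cvg hu; have [u1 u2] := fast_cvg0 hu.
have E (n : nat) : series (fold (fun m => u (m + 1))) n = series (fold u) n + u (Posz n) - u (- Posz n).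
  rewrite /series /=; elim: n => [|n IHn].
    by rewrite !big_nil oppr0 add0r subrr.
  rewrite !big_nat_recr//= IHn /fold.
  have -> : Posz n + 1 = Posz n.+1 by rewrite intS addrC.
  have -> : Negz n + 1 = - Posz n by rewrite NegzE intS; ring.
  by rewrite -NegzE; ring.
rewrite /zsum (_ : series _ = (fun n => series (fold u) n + u (Posz n) - u (- Posz n))); last first.
  by apply/funext => n; exact: E.
apply/cvg_lim => //; rewrite -[X in _ --> X]addr0 -[X in _ --> X]subr0.
apply: cvgB; first exact: cvgD.
rewrite -(cvg_shiftS (fun n : nat => u (- Posz n))) /=.
by under eq_fun do rewrite -NegzE.
Qed.

Lemma zsum_ge0 B u : fast B u -> (forall m, 0 <= u m) -> forall m, u m <= zsum u.
Proof.
move=> hu u0 m; have cu := fast_cvg hu.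
have f0 k : 0 <= fold u k by rewrite addr_ge0.
have le k : fold u k <= zsum u.
  apply: (@le_trans _ _ (series (fold u) k.+1)).
    by rewrite /series /= big_nat_recr//= lerDr sumr_ge0.
  apply: nondecreasing_cvgn_le => //.
  by apply/nondecreasing_seqP => n; rewrite /series /= big_nat_recr//= lerDl.
by case: m => k; apply: le_trans (le k); rewrite /fold ?lerDl ?lerDr.
Qed.

End IntegerSums.

Local Opaque e_x e_y e_t cderive Xop Yop Zop Zbarop sumsq primitive mean zsum.

(** * Series of harmonic functions *)

Section HarmonicSeries.
Variable R : realType.
Local Notation H := (heis R).
Implicit Types (c : int -> R) (B th a rho : R) (m : int) (p h v : H).

Lemma near0_norm_le a : 0 < a -> \forall h \near (0 : H), `|h| <= a.
Proof.
move=> a0; apply/nbhs_ballP; exists a => //= h.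
by rewrite -ball_normE /= sub0r normrN => /ltW.
Qed.

Lemma differentiable_quadratic (f : H -> R) (L : {linear H -> R}) p B :
  continuous L ->
  (forall h : H, `|h| <= 1 -> `|f (h + p) - f p - L h| <= B * `|h| ^+ 2) ->
  differentiable f p /\ forall v, 'D_v f p = L v.
Proof.
move=> cL hf.
have lo : f \o shift p = cst (f p) + L +o_ (0 : H) id.
  apply/eqaddoP => e e0; near=> h.
  have h1 : `|h| <= 1 by near: h; exact: near0_norm_le.
  have hB : `|h| <= e / (`|B| + 1).
    by near: h; apply: near0_norm_le; rewrite divr_gt0// ltr_wpDl.
  rewrite /= opprD addrA; apply: (le_trans (hf h h1)).
  rewrite expr2 mulrA ler_wpM2r//.
  apply: (@le_trans _ _ ((`|B| + 1) * `|h|)).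
    by apply: ler_wpM2r => //; apply: (le_trans (ler_norm B)); rewrite lerDl.
  by rewrite mulrC -ler_pdivlMr// ltr_wpDl.
have dL := diff_unique cL lo.
have df : differentiable f p by apply/diff_locallyP; rewrite dL.
by split=> // v; rewrite deriveE// dL.
Unshelve. all: by end_near. Qed.

(** The harmonic function [Re (exp (a z + i th))] of z = x + iy. *)
Definition harm a th p : R := expR (a * p.1.1) * cos (a * p.1.2 + th).

Lemma rsmooth_harm a th : rsmooth (harm a th).
Proof.
have X := rsmooth_x R; have Y := rsmooth_y R.
apply: rsmooth_mul; [apply: rsmooth_exp|apply: rsmooth_cos].
  by apply: rsmooth_mul => //; exact: rsmooth_cst.
apply: rsmooth_add; last exact: rsmooth_cst.
by apply: rsmooth_mul => //; exact: rsmooth_cst.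
Qed.

(** Differentiation only shifts the phase, so one family of functions contains all
    the derivatives. *)
Lemma derive_harm a th v p :
  'D_v (harm a th) p = a * (v.1.1 * harm a th p + v.1.2 * harm a (th + pi / 2) p).
Proof.
have X := rsmooth_x R; have Y := rsmooth_y R.
have aX := rsmooth_mul (rsmooth_cst a) X.
have aY := rsmooth_mul (rsmooth_cst a) Y.
have aYt := rsmooth_add aY (rsmooth_cst th).
rewrite /harm (derive_mul _ _ (rsmooth_exp aX) (rsmooth_cos aYt)).
have [_ ->] := derive_comp_real v (rsmooth_differentiable aX p) (is_derive_expR _).
have [_ ->] := derive_comp_real v (rsmooth_differentiable aYt p) (is_derive_cos _).
rewrite (derive_add _ _ aY (rsmooth_cst th)) !(derive_mul _ _ (rsmooth_cst a) X).
rewrite (derive_mul _ _ (rsmooth_cst a) Y) derive_x derive_y !(derive_cst a) (derive_cst th).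
by rewrite addrA cosDpihalf /xcoord /ycoord /=; ring.
Qed.

Lemma harm_le a th p : `|harm a th p| <= expR (`|a| * `|p.1.1|).
Proof.
rewrite normrM -[leRHS]mulr1; apply: ler_pM => //; last exact: cos_max.
by rewrite ger0_norm ?expR_ge0// ler_expR -normrM ler_norm.
Qed.

Local Opaque harm.

Lemma xnorm_le h : `|h.1.1| <= `|h|. Proof. by case: h => [[x y] t]; rewrite !prod_normE /= !le_max lexx. Qed.
Lemma ynorm_le h : `|h.1.2| <= `|h|. Proof. by case: h => [[x y] t]; rewrite !prod_normE /= !le_max lexx orbT. Qed.

Lemma derive_harm_le a th h p :
  `|'D_h (harm a th) p| <= 2 * `|a| * `|h| * expR (`|a| * `|p.1.1|).
Proof.
set E := expR (`|a| * _); rewrite derive_harm normrM.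
have -> : 2 * `|a| * `|h| * E = `|a| * (`|h| * E + `|h| * E) by ring.
rewrite ler_wpM2l//; apply: (le_trans (ler_normD _ _)); rewrite (normrM h.1.1) (normrM h.1.2).
have H1 : `|harm a th p| <= E := harm_le a th p.
have H2 : `|harm a (th + pi / 2) p| <= E := harm_le a _ p.
apply: lerD.
  exact: (ler_pM (normr_ge0 _) (normr_ge0 _) (xnorm_le h) H1).
exact: (ler_pM (normr_ge0 _) (normr_ge0 _) (ynorm_le h) H2).
Qed.

Lemma derive2_harm_le a th h p :
  `|'D_h ('D_h (harm a th)) p| <= 4 * a ^+ 2 * `|h| ^+ 2 * expR (`|a| * `|p.1.1|).
Proof.
have -> : 'D_h (harm a th) = fun p => (a * h.1.1) * harm a th p + (a * h.1.2) * harm a (th + pi / 2) p.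
  by apply/funext => q; rewrite derive_harm; ring.
have [s1 s2] := (rsmooth_harm a th, rsmooth_harm a (th + pi / 2)).
rewrite (derive_add _ _ (rsmooth_mul (rsmooth_cst _) s1) (rsmooth_mul (rsmooth_cst _) s2)).
rewrite (derive_mul _ _ (rsmooth_cst _) s1) (derive_mul _ _ (rsmooth_cst _) s2).
rewrite !(derive_cst (_ : R)) !mulr0 !addr0.
apply: (le_trans (ler_normD _ _)); rewrite !normrM.
have A0 : `|a| * (`|h| * `|'D_h (harm a th) p|) <= `|a| * (`|h| * (2 * `|a| * `|h| * expR (`|a| * `|p.1.1|))).
  by do 2 apply: ler_wpM2l => //; exact: derive_harm_le.
have A1 : `|a| * (`|h| * `|'D_h (harm a (th + pi / 2)) p|) <= `|a| * (`|h| * (2 * `|a| * `|h| * expR (`|a| * `|p.1.1|))).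
  by do 2 apply: ler_wpM2l => //; exact: derive_harm_le.
have -> : 4 * a ^+ 2 * `|h| ^+ 2 * expR (`|a| * `|p.1.1|) =
  `|a| * (`|h| * (2 * `|a| * `|h| * expR (`|a| * `|p.1.1|))) + `|a| * (`|h| * (2 * `|a| * `|h| * expR (`|a| * `|p.1.1|))).
  by rewrite -[a ^+ 2]real_normK ?num_real//; ring.
apply: lerD; rewrite -mulrA; [apply: le_trans A0|apply: le_trans A1];
  by rewrite ler_wpM2l// ler_wpM2r// ?xnorm_le ?ynorm_le.
Qed.

Lemma harm_taylor a th h p : `|h| <= 1 ->
  `|harm a th (h + p) - harm a th p - 'D_h (harm a th) p| <=
   4 * a ^+ 2 * expR (`|a| * (`|p.1.1| + 1)) * `|h| ^+ 2.
Proof.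
move=> h1; have s0 := rsmooth_harm a th; have s1 := rsmooth_derive h s0.
have := taylor2 (x := 0) (s := 1) (B := 4 * a ^+ 2 * expR (`|a| * (`|p.1.1| + 1)) * `|h| ^+ 2)
   (fun s => is_derive_line p h s s0) (fun s => is_derive_line p h s s1).
rewrite addr0 scale1r scale0r add0r mul1r expr1n mulr1; apply.
move=> z; rewrite subr0 normr1 => z1; apply: (le_trans (derive2_harm_le _ _ _ _)).
rewrite [leRHS]mulrAC; apply: ler_wpM2l.
  by apply: mulr_ge0; [apply: mulr_ge0 => //; exact: sqr_ge0|exact: exprn_ge0].
rewrite ler_expR ler_wpM2l//= (le_trans (ler_normD _ _))// addrC lerD2l.
rewrite normrM -[leRHS]mulr1; apply: ler_pM => //.
exact: le_trans (xnorm_le h) h1.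
Qed.

Definition rapid c := forall rho, 0 <= rho ->
  exists2 B, 0 <= B & forall m, `|c m| * expR (rho * zabs R m) <= B.

Definition freq m : R := 2 * pi * m%:~R.

Lemma freq_abs m : `|freq m| = 2 * pi * zabs R m.
Proof. by rewrite normrM ger0_norm ?mulr_ge0 ?pi_ge0// /zabs -intr_norm -abszE. Qed.

Lemma le_expR_id (x : R) : x <= expR x.
Proof. by have := expR_ge1Dx x; lra. Qed.

Lemma rapid_freq c : rapid c -> rapid (fun m => freq m * c m).
Proof.
move=> hc rho rho0; have r1 : 0 <= rho + 2 * pi by rewrite addr_ge0// mulr_ge0// pi_ge0.
have [B B0 hB] := hc _ r1; exists B => // m.
apply: le_trans (hB m); rewrite normrM freq_abs [in leRHS]mulrDl expRD.
have h1 := le_expR_id (2 * pi * zabs R m).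
have -> : `|c m| * (expR (rho * zabs R m) * expR (2 * pi * zabs R m)) =
  expR (2 * pi * zabs R m) * `|c m| * expR (rho * zabs R m) by ring.
by apply: ler_wpM2r; [exact: expR_ge0|exact: ler_wpM2r].
Qed.

Definition harm_series c th p : R := zsum (fun m => c m * harm (freq m) th p).

Lemma fast_harm c th p : rapid c -> exists B, fast B (fun m => c m * harm (freq m) th p).
Proof.
move=> hc; have r0 : 0 <= 2 * pi * `|p.1.1| + 1.
  by rewrite addr_ge0// !mulr_ge0// pi_ge0.
have [B B0 hB] := hc _ r0; exists B => m.
rewrite normrM expRN ler_pdivlMr ?expR_gt0//.
apply: le_trans (hB m); have := harm_le (freq m) th p.
rewrite freq_abs [2 * pi * _ * _]mulrAC => h1.
rewrite [X in _ <= _ * expR X]mulrDl mul1r expRD mulrA.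
by apply: ler_wpM2r; [exact: expR_ge0|exact: ler_wpM2l].
Qed.

Definition harm_series_diff c th p h : R :=
  h.1.1 * harm_series (fun m => freq m * c m) th p +
  h.1.2 * harm_series (fun m => freq m * c m) (th + pi / 2) p.

Lemma harm_series_diff_linear c th p : linear (harm_series_diff c th p).
Proof.
move=> k [[x y] t] [[x' y'] t']; rewrite /harm_series_diff /= /GRing.scale /=; ring.
Qed.

(** Term by term differentiation, from the quadratic Taylor bounds of the terms. *)
Lemma harm_series_derive c th p : rapid c -> differentiable (harm_series c th) p /\
  forall v, 'D_v (harm_series c th) p = harm_series_diff c th p v.
Proof.
move=> hc.
pose Lm := GRing.isLinear.Build R H R _ _ (harm_series_diff_linear c th p).
pose L : {linear H -> R} := HB.pack (harm_series_diff c th p) Lm.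
have cL : continuous L.
  move=> h; rewrite /= /harm_series_diff.
  set a := harm_series _ _ _; set b := harm_series _ _ _.
  apply: (@continuousD _ _ _ (fun h : H => h.1.1 * a) (fun h : H => h.1.2 * b)).
    by apply: continuousM; [exact: continuous_xcoord|exact: cst_continuous].
  by apply: continuousM; [exact: continuous_ycoord|exact: cst_continuous].
have [r1 r2] := (rapid_freq hc, rapid_freq (rapid_freq hc)).
have r0 : 0 <= 2 * pi * (`|p.1.1| + 1) + 1.
  by rewrite addr_ge0// mulr_ge0 ?mulr_ge0 ?pi_ge0// addr_ge0.
have [B B0 hB] := r2 _ r0.
apply: (differentiable_quadratic (L := L) (B := 4 * B * zsum_cst R)) => // h h1 /=.
have [B1 f1] := fast_harm th (h + p) hc; have [B2 f2] := fast_harm th p hc.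
have [B3 f3] := fast_harm th p r1; have [B4 f4] := fast_harm (th + pi / 2) p r1.
have E0 := zsum_comb 1 (-1) f1 f2; have E1 := zsum_comb h.1.1 h.1.2 f3 f4.
have fastD b1 b2 C1 C2 (u v : int -> R) : fast C1 u -> fast C2 v ->
    fast (`|b1| * C1 + `|b2| * C2) (fun m => b1 * u m + b2 * v m).
  move=> hu hv m; apply: (le_trans (ler_normD _ _)); rewrite !normrM mulrDl -!mulrA.
  by apply: lerD; apply: ler_wpM2l.
have E2 := zsum_comb 1 (-1) (fastD 1 (-1) _ _ _ _ f1 f2) (fastD h.1.1 h.1.2 _ _ _ _ f3 f4).
have -> : harm_series c th (h + p) - harm_series c th p - harm_series_diff c th p h =
   zsum (fun m => c m * (harm (freq m) th (h + p) - harm (freq m) th p - 'D_h (harm (freq m) th) p)).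
  move: E0 E1 E2; rewrite -![zsum (fun m => c m * _)]/(harm_series c th _).
  rewrite -![zsum (fun m => freq m * c m * _)]/(harm_series _ _ p) => E0 E1 E2.
  transitivity (1 * (1 * harm_series c th (h + p) + -1 * harm_series c th p) +
    -1 * harm_series_diff c th p h).
    by move: (harm_series c th _) (harm_series c th _) (harm_series_diff c th p h) => *; ring.
  refine (etrans (congr1 (fun z => 1 * z + _) (esym E0)) _).
  refine (etrans (congr1 (fun z => _ + -1 * z) (esym E1)) _).
  refine (etrans (esym E2) _); congr zsum; apply/funext => m.
  rewrite derive_harm.
  move: (harm (freq m) th (h + p)) (harm (freq m) th p) (harm (freq m) (th + pi / 2) p).
  by move: (c m) (freq m) => *; ring.
have fB : fast (4 * B * `|h| ^+ 2) (fun m => c m * (harm (freq m) th (h + p) - harm (freq m) th p - 'D_h (harm (freq m) th) p)).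
  move=> m; rewrite normrM.
  have := harm_taylor (freq m) th p h1 => T.
  apply: (le_trans (ler_wpM2l (normr_ge0 (c m)) T)).
  have hBm : `|freq m| * (`|freq m| * `|c m|) *
      (expR (2 * pi * (`|p.1.1| + 1) * zabs R m) * expR (zabs R m)) <= B.
    by rewrite -expRD -!(normrM (freq m)) -[X in _ + X]mul1r -mulrDl; exact: hB.
  rewrite expRN ler_pdivlMr ?expR_gt0//.
  pose W := expR (`|freq m| * (`|p.1.1| + 1)); rewrite -/W.
  have K : `|c m| * (4 * freq m ^+ 2 * W) * expR (zabs R m) <= 4 * B.
    have -> : `|c m| * (4 * freq m ^+ 2 * W) * expR (zabs R m) =
        4 * (`|freq m| * (`|freq m| * `|c m|) * (W * expR (zabs R m))).
      by rewrite -[freq m ^+ 2]real_normK ?num_real//; ring.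
    apply: ler_wpM2l => //; apply: le_trans hBm; rewrite /W freq_abs.
    by rewrite [2 * pi * (_ + 1) * _]mulrAC.
  have -> : `|c m| * (4 * freq m ^+ 2 * W * `|h| ^+ 2) * expR (zabs R m) =
    `|c m| * (4 * freq m ^+ 2 * W) * expR (zabs R m) * `|h| ^+ 2 by ring.
  by apply: ler_wpM2r => //; exact: exprn_ge0.
apply: (le_trans (zsum_bound fB)).
by rewrite mulrAC.
Qed.

(** Derivatives of such a series are combinations of two series of the same kind,
    with coefficients that still decay rapidly. *)
Lemma rsmooth_harm_series c th : rapid c -> rsmooth (harm_series c th).
Proof.
move=> hc k; elim: k c th hc => [|k IHk] c th hc.
  move=> p; apply: differentiable_continuous.
  by have [] := harm_series_derive th p hc.
split=> [p|v]; first by have [] := harm_series_derive th p hc.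
have -> : 'D_v (harm_series c th) =
    ((cst v.1.1) \* harm_series (fun m => freq m * c m) th) \+
    ((cst v.1.2) \* harm_series (fun m => freq m * c m) (th + pi / 2)).
  by apply/funext => p; have [_ ->] := harm_series_derive th p hc.
by apply: Ck_add; apply: Ck_mul; try exact: Ck_cst; apply: IHk; exact: rapid_freq.
Qed.

End HarmonicSeries.

Local Opaque e_x e_y e_t cderive Xop Yop Zop Zbarop sumsq primitive mean zsum harm_series.

(** * Theta functions *)

(** The analogue of [cring] for expressions with real denominators. *)
Ltac cfield := apply/eqP; rewrite eq_complex /=; apply/andP; split; apply/eqP; field.

Section ComplexIntegerSums.
Variable R : realType.
Implicit Types (u v : int -> R[i]) (m : int) (B : R).

Definition cfast u := exists B, fast B (fun m => complex.Re (u m)) /\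
  fast B (fun m => complex.Im (u m)).

Definition czsum u : R[i] :=
  zsum (fun m => complex.Re (u m)) +i* zsum (fun m => complex.Im (u m)).

Lemma czsumZ (a : R[i]) u : cfast u -> czsum (fun m => a * u m) = a * czsum u.
Proof.
move=> [B [h1 h2]]; case: a => [a1 a2]; rewrite /czsum.
rewrite -[RHS]/((a1 * zsum (fun m => complex.Re (u m)) - a2 * zsum (fun m => complex.Im (u m))) +i*
  (a1 * zsum (fun m => complex.Im (u m)) + a2 * zsum (fun m => complex.Re (u m)))).
apply: complex_congr.
  rewrite -mulNr -(zsum_comb a1 (- a2) h1 h2); congr zsum; apply/funext => m.
  by rewrite Re_mul /= mulNr.
rewrite -(zsum_comb a1 a2 h2 h1); congr zsum; apply/funext => m.
by rewrite Im_mul.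
Qed.

Lemma fast_shift1 B (u : int -> R) : fast B u -> fast (B * expR 1) (fun m => u (m + 1)).
Proof.
move=> hu m; have B0 : 0 <= B by have := hu 0; rewrite /zabs oppr0 expR0 mulr1; exact: le_trans.
apply: (le_trans (hu (m + 1))); rewrite -mulrA ler_wpM2l// -expRD ler_expR.
have : zabs R m <= zabs R (m + 1) + 1 by rewrite /zabs natr1 ler_nat; lia.
by lra.
Qed.

Lemma cfast_shift u (j : nat) : cfast u -> cfast (fun m => u (m + j%:Z)).
Proof.
move=> hu; elim: j => [|j [B [h1 h2]]]; first by under eq_fun do rewrite addr0.
have E m : m + j.+1%:Z = m + 1 + j%:Z by rewrite intS addrA.
exists (B * expR 1); split.
  by under eq_fun do rewrite E; exact: (fast_shift1 h1).
by under eq_fun do rewrite E; exact: (fast_shift1 h2).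
Qed.

Lemma czsum_shift u (j : nat) : cfast u -> czsum (fun m => u (m + j%:Z)) = czsum u.
Proof.
move=> hu; elim: j => [|j IHj]; first by congr czsum; apply/funext => m; rewrite addr0.
rewrite -IHj; have [B [h1 h2]] := cfast_shift j hu; rewrite /czsum; apply: complex_congr.
  rewrite -(zsum_shift h1); congr zsum; apply/funext => m.
  by congr (complex.Re (u _)); rewrite -addrA intS.
rewrite -(zsum_shift h2); congr zsum; apply/funext => m.
by congr (complex.Im (u _)); rewrite -addrA intS.
Qed.

End ComplexIntegerSums.

Section Theta.
Variable R : realType.
Variable D : nat.
Hypothesis D_gt0 : (0 < D)%N.
Local Notation H := (heis R).
Implicit Types (x y t : R) (l m : int) (p : H).
Local Notation e_x := (e_x R).
Local Notation e_y := (e_y R).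
Local Notation e_t := (e_t R).

Let D0 : D%:R != 0 :> R. Proof. by rewrite pnatr_eq0 -lt0n. Qed.
Let Dp : 0 < D%:R :> R. Proof. by rewrite ltr0n. Qed.

Definition tcoef l m : R :=
  if (m == l %[mod D])%Z then expR (- (pi * m%:~R ^+ 2 / D%:R)) else 0.

Lemma zabs2 m : zabs R m ^+ 2 = m%:~R ^+ 2.
Proof. by rewrite -[RHS]real_normK ?num_real// /zabs -intr_norm -abszE. Qed.

(** Complete the square in [rho |m| - pi m^2 / D]. *)
Lemma rapid_tcoef l : rapid (tcoef l).
Proof.
move=> rho rho0; exists (expR (rho ^+ 2 * D%:R / (4 * pi))); first exact: expR_ge0.
move=> m; rewrite /tcoef; case: ifP => _; last by rewrite normr0 mul0r expR_ge0.
rewrite ger0_norm ?expR_ge0// -expRD ler_expR -zabs2 -subr_ge0.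
have p0 := pi_gt0 R; have pn0 : pi != 0 :> R by rewrite gt_eqF.
move: (pi : R) p0 pn0 => P p0 pn0.
have -> : rho ^+ 2 * D%:R / (4 * P) - (- (P * zabs R m ^+ 2 / D%:R) + rho * zabs R m) =
  P / D%:R * (zabs R m - rho * D%:R / (2 * P)) ^+ 2.
  by field; rewrite pn0 D0.
by rewrite mulr_ge0 ?sqr_ge0// divr_ge0 ?ltW.
Qed.

Definition tterm l x y m : R[i] := (tcoef l m)%:C * cexp ((freq R m)%:C * (x +i* y)).

Lemma ttermE l x y t m : tterm l x y m =
  (tcoef l m * harm (freq R m) 0 (x, y, t)) +i* (tcoef l m * harm (freq R m) (- (pi / 2)) (x, y, t)).
Proof.
rewrite /tterm /cexp /harm cosBpihalf addr0 /=.
rewrite (_ : freq R m * x - 0 * y = freq R m * x); last by ring.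
rewrite (_ : freq R m * y + 0 * x = freq R m * y); last by ring.
by apply: complex_congr; ring.
Qed.

Lemma cfast_tterm l x y : cfast (tterm l x y).
Proof.
have [B1 h1] := fast_harm 0 (x, y, 0) (rapid_tcoef l).
have [B2 h2] := fast_harm (- (pi / 2)) (x, y, 0) (rapid_tcoef l).
have weak B B' (u : int -> R) : fast B u -> B <= B' -> fast B' u.
  move=> hu BB m; apply: (le_trans (hu m)); apply: ler_wpM2r => //; exact: expR_ge0.
exists (Num.max B1 B2); split.
  apply: (weak B1); last by rewrite le_max lexx.
  by under eq_fun do rewrite (ttermE _ _ _ 0) /=.
apply: (weak B2); last by rewrite le_max lexx orbT.
by under eq_fun do rewrite (ttermE _ _ _ 0) /=.
Qed.

(** Jacobi theta series of degree D with characteristic l. *)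
Definition theta l p : R[i] := czsum (tterm l p.1.1 p.1.2).

Lemma thetaE l : theta l = fun p => harm_series (tcoef l) 0 p +i* harm_series (tcoef l) (- (pi / 2)) p.
Proof.
Transparent harm_series.
apply/funext => -[[x y] t]; rewrite /theta /czsum.
by apply: complex_congr; congr zsum; apply/funext => m; rewrite (ttermE _ _ _ t).
Opaque harm_series.
Qed.

Lemma smooth_theta l : smooth (theta l).
Proof.
by rewrite thetaE; apply/smoothP; split; exact: rsmooth_harm_series (rapid_tcoef l).
Qed.

(** The real and imaginary parts are series of conjugate harmonic functions. *)
Lemma theta_holomorphic l p :
  cderive e_y (theta l) p = 'i%C * cderive e_x (theta l) p /\ cderive e_t (theta l) p = 0.
Proof.
have r := rapid_tcoef l; have r1 := rapid_freq r.
Transparent cderive.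
rewrite thetaE /cderive.
have [_ h1] := harm_series_derive 0 p r.
have [_ h2] := harm_series_derive (- (pi / 2)) p r.
rewrite /= !h1 !h2 /harm_series_diff e_xP e_yP e_tP /= !mul0r !mul1r !add0r !addr0 addNr.
split=> //; apply: complex_congr => //; last by rewrite mul0r mul1r add0r.
rewrite mul0r sub0r mul1r.
have [B hB] := fast_harm (- (pi / 2)) p r1.
Transparent harm_series.
rewrite /harm_series -mulN1r.
have := zsum_comb (-1) 0 hB hB; rewrite mul0r addr0 => <-; congr zsum; apply/funext => m.
by rewrite /harm cosDpihalf cosBpihalf; ring.
Opaque harm_series cderive.
Qed.

Lemma tcoef_mod l l' : (l == l' %[mod D])%Z -> tcoef l = tcoef l'.
Proof. by move=> /eqP e; apply/funext => m; rewrite /tcoef e. Qed.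

Lemma theta_mod l l' : (l == l' %[mod D])%Z -> theta l = theta l'.
Proof.
move=> e; apply/funext => p; congr czsum; apply/funext => m.
by rewrite /tterm (tcoef_mod e).
Qed.

Lemma wavec_mod m l : (m == l %[mod D])%Z -> wavec m (D%:R^-1) = wavec l D%:R^-1 :> R[i].
Proof.
rewrite eqz_mod_dvd => /dvdzP[q]; move/(canRL (subrK _)) ->.
have E a b : wavec (a + b) (D%:R^-1) = wavec a D%:R^-1 * wavec b D%:R^-1 :> R[i].
  by rewrite /wavec -cexpD intrD; congr cexp; cring.
rewrite E -[RHS]mul1r; congr (_ * _); rewrite -(wavec_int R q) /wavec.
by congr (cexp (_ * _%:C)); rewrite intrM -pmulrn; field; rewrite D0.
Qed.

Lemma theta_y l x y t : theta l (x, D%:R^-1 + y, t) = wavec l D%:R^-1 * theta l (x, y, t).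
Proof.
rewrite /theta /= -czsumZ; last exact: cfast_tterm.
congr czsum; apply/funext => m; rewrite /tterm mulrCA /tcoef.
case: ifP => [e|_]; last by rewrite !mul0r.
congr (_ * _); rewrite -(wavec_mod e) /wavec -cexpD; congr cexp.
by rewrite /freq; cring.
Qed.

Lemma theta_y1 l x y t : theta l (x, 1 + y, t) = theta l (x, y, t).
Proof.
rewrite /theta /=; congr czsum; apply/funext => m; rewrite /tterm; congr (_ * _).
rewrite -[RHS]mul1r -(wavec_int R m) /wavec -cexpD; congr cexp.
by rewrite /freq; cring.
Qed.

(** The shift of x by j / D completes the square in the Gaussian coefficients and
    moves the residue class. *)
Lemma theta_x l (j : nat) x y t :
  theta l (j%:R / D%:R + x, y, t) =
  cexp ((pi * j%:R ^+ 2 / D%:R)%:C + (2 * pi * j%:R)%:C * (x +i* y)) * theta (l - j%:Z) (x, y, t).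
Proof.
rewrite /theta /= -czsumZ; last exact: cfast_tterm.
set K := cexp _.
have step m : tterm l (j%:R / D%:R + x) y (m + j%:Z) = K * tterm (l - j%:Z) x y m.
  rewrite /tterm mulrCA /tcoef.
  have -> : (m == l - j%:Z %[mod D])%Z = (m + j%:Z == l %[mod D])%Z.
    by rewrite !eqz_mod_dvd opprB addrA addrAC.
  case: ifP => [e|_]; last by rewrite !mul0r.
  rewrite -!cexp_real /K -!cexpD; congr cexp; rewrite /freq intrD.
  by rewrite -pmulrn; cfield; rewrite D0.
rewrite -(czsum_shift j (cfast_tterm _ _ _)).
by congr czsum; apply/funext => m; exact: step.
Qed.

End Theta.

Local Opaque e_x e_y e_t cderive Xop Yop Zop Zbarop sumsq primitive mean zsum harm_series theta.

(** * The ground level *)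

Section GroundLevel.
Variable R : realType.
Local Notation H := (heis R).
Implicit Types (f K : H -> R[i]) (x y t : R) (m : int) (p v : H).
Local Notation e_x := (e_x R).
Local Notation e_y := (e_y R).
Local Notation e_t := (e_t R).
Variable T : R.

(** Multiplication by [exp twist] turns the equations of the ground level into the
    Cauchy-Riemann equations in x + iy. *)
Definition twist p : R[i] :=
  (- (2 * T * (p.1.1 * p.1.1))) +i* (T * (p.2 - 2 * (p.1.1 * p.1.2))).

Lemma twistE x y t :
  twist (x, y, t) = (- (2 * T * (x * x))) +i* (T * (t - 2 * (x * y))).
Proof. by []. Qed.

Lemma smooth_twist : smooth twist.
Proof.
have X := rsmooth_x R; have Y := rsmooth_y R; have Z := rsmooth_t R.
apply/smoothP; split; rewrite /twist /=.
  by apply: rsmooth_opp; apply: rsmooth_mul; [exact: rsmooth_cst|exact: rsmooth_mul].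
apply: rsmooth_mul; first exact: rsmooth_cst.
apply: rsmooth_sub => //; apply: rsmooth_mul; first exact: rsmooth_cst.
exact: rsmooth_mul.
Qed.

Lemma cderive_twist v x y t : cderive v twist (x, y, t) =
  (- (4 * T * x * v.1.1)) +i* (T * (v.2 - 2 * (x * v.1.2 + y * v.1.1))).
Proof.
have X := rsmooth_x R; have Y := rsmooth_y R; have Z := rsmooth_t R.
Transparent cderive.
rewrite /cderive /twist /=.
Opaque cderive.
have XX := rsmooth_mul X X; have XY := rsmooth_mul X Y.
have c1 := rsmooth_cst (2 * T : R); have c2 := rsmooth_cst (2 : R); have c3 := rsmooth_cst T.
apply: complex_congr.
  rewrite (derive_opp _ _ (rsmooth_mul c1 XX)) (derive_mul _ _ c1 XX) (derive_mul _ _ X X).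
  by rewrite derive_x (derive_cst (2 * T)) /xcoord /=; ring.
rewrite (derive_mul _ _ c3 (rsmooth_sub Z (rsmooth_mul c2 XY))).
rewrite (derive_sub _ _ Z (rsmooth_mul c2 XY)) (derive_mul _ _ c2 XY) (derive_mul _ _ X Y).
rewrite derive_x derive_y derive_t (derive_cst T) (derive_cst (2 : R)) /xcoord /ycoord /=.
by ring.
Qed.

Lemma cderive_twisted v K p : smooth K ->
  cderive v (fun p => cexp (twist p) * K p) p =
  cexp (twist p) * (cderive v twist p * K p + cderive v K p).
Proof.
move=> sK; rewrite (cderive_mul _ _ (smooth_cexp smooth_twist) sK) (cderive_cexp _ _ smooth_twist).
by ring.
Qed.

Lemma smooth_twisted K : smooth K -> smooth (fun p => cexp (twist p) * K p).
Proof. by move=> sK; apply: smooth_mul => //; exact: smooth_cexp smooth_twist. Qed.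

Definition holomorphic K := forall p,
  cderive e_y K p = 'i%C * cderive e_x K p /\ cderive e_t K p = 0.

Lemma Zbarop_t_eigen f p : t_eigen T f ->
  Zbarop f p = (cderive e_x f p + 'i%C * cderive e_y f p) / 2 + ((T * p.1.1) +i* (T * p.1.2)) * f p.
Proof.
Transparent Xop Yop.
move=> fT; rewrite ZbaropE /Xop /Yop.
Opaque Xop Yop.
rewrite fT; move: (cderive e_x f p) (cderive e_y f p) (f p) => [a a'] [b b'] [d d'].
have -> : (2 : R[i])^-1 = (2^-1 : R)%:C by rewrite fmorphV rmorph_nat.
by cfield.
Qed.

Lemma twisted_ground K : smooth K -> holomorphic K ->
  t_eigen T (fun p => cexp (twist p) * K p) /\
  forall p, Zbarop (fun p => cexp (twist p) * K p) p = 0.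
Proof.
move=> sK hK.
have tK : t_eigen T (fun p => cexp (twist p) * K p).
  move=> [[x y] t]; rewrite (cderive_twisted _ _ sK) (hK _).2 cderive_twist e_tP /=.
  by rewrite addr0 mulrCA; congr (_ * _); cring.
split=> // -[[x y] t]; rewrite (Zbarop_t_eigen _ tK) !(cderive_twisted _ _ sK) (hK _).1.
rewrite !cderive_twist e_xP e_yP /=.
move: (cexp _) (cderive e_x K _) (K _) => [a a'] [b b'] [d d'].
have -> : (2 : R[i])^-1 = (2^-1 : R)%:C by rewrite fmorphV rmorph_nat.
by cfield.
Qed.

(** The converse: division by [exp twist] makes any solution of the ground
    equations holomorphic. *)
Lemma ground_untwist f : smooth f -> t_eigen T f -> (forall p, Zbarop f p = 0) ->
  exists K, [/\ smooth K, holomorphic K & f = fun p => cexp (twist p) * K p].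
Proof.
move=> sf fT f0; pose K p := cexp (- twist p) * f p.
have sN := smooth_opp smooth_twist; have sK : smooth K by apply: smooth_mul => //; exact: smooth_cexp.
exists K; split=> //; last first.
  by apply/funext => p; rewrite /K mulrA -cexpD subrr cexp0 mul1r.
have dK v p : cderive v K p = cexp (- twist p) * (cderive v f p - cderive v twist p * f p).
  rewrite (cderive_mul _ _ (smooth_cexp sN) sf) (cderive_cexp _ _ sN) (cderive_opp _ _ smooth_twist).
  by ring.
move=> [[x y] t]; rewrite !dK !cderive_twist e_xP e_yP e_tP /= fT.
split; last first.
  by rewrite -mulrBl; apply/eqP; rewrite mulf_eq0 mulf_eq0; apply/orP; right; apply/orP; left; apply/eqP; cring.
rewrite mulrCA; congr (_ * _).
have := Zbarop_t_eigen (x, y, t) fT; rewrite f0 /=.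
move: (cderive e_x f _) (cderive e_y f _) (f _) => [a a'] [b b'] [d d'].
have -> : (2 : R[i])^-1 = (2^-1 : R)%:C by rewrite fmorphV rmorph_nat.
move=> /eqP; rewrite eq_complex /= => /andP[/eqP E1 /eqP E2].
by apply/eqP; rewrite eq_complex /=; apply/andP; split; apply/eqP; lra.
Qed.

End GroundLevel.

Local Opaque e_x e_y e_t cderive Xop Yop Zop Zbarop sumsq primitive mean zsum harm_series theta cmean.

Section GroundBasis.
Variable R : realType.
Variable D : nat.
Hypothesis D_gt0 : (0 < D)%N.
Local Notation H := (heis R).
Implicit Types (f K : H -> R[i]) (x y t : R) (l m : int) (p v : H).
Local Notation e_x := (e_x R).
Local Notation e_y := (e_y R).
Local Notation e_t := (e_t R).

Let D0 : D%:R != 0 :> R. Proof. by rewrite pnatr_eq0 -lt0n. Qed.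
Let Dp : 0 < D%:R :> R. Proof. by rewrite ltr0n. Qed.

(** The frequency for which the line bundle on the torus has degree D. *)
Let T : R := pi * D%:R / 2.

Record ground f : Prop := Ground {
  ground_smooth : smooth f;
  ground_t : t_eigen T f;
  ground_Zbar : forall p, Zbarop f p = 0;
  ground_lattice : lattice_invariant f }.

Lemma ground_comb k (a : 'I_k -> R[i]) (e : 'I_k -> H -> R[i]) :
  (forall j, ground (e j)) -> ground (fun p => \sum_j a j * e j p).
Proof.
move=> he; have se j := ground_smooth (he j).
have [sm st] := comb_sum a (comb_cderive e_t) se.
have [_ ss] := comb_sum a (@Zbarop_comb R) se.
split=> //.
- move=> p; rewrite st mulr_sumr; apply: eq_bigr => j _.
  by rewrite (ground_t (he j)) mulrCA.
- by move=> p; rewrite ss big1// => j _; rewrite (ground_Zbar (he j)) mulr0.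
- by split=> p; apply: eq_bigr => j _; have [e1 e2] := ground_lattice (he j);
    rewrite ?e1 ?e2.
Qed.

Lemma lattice_x f x y t : lattice_invariant f -> f (1 + x, y, t) = f (x, y, t + 2 * y).
Proof.
move=> [f1 _]; rewrite -[RHS]f1 heis_mulE; congr (f (_, _, _)); ring.
Qed.

Lemma lattice_y f x y t : lattice_invariant f -> f (x, 1 + y, t) = f (x, y, t - 2 * x).
Proof.
move=> [_ f2]; rewrite -[RHS]f2 heis_mulE; congr (f (_, _, _)); ring.
Qed.

Definition section l p : R[i] := cexp (twist T p) * theta D l p.

Lemma section_mod l m : (l == m %[mod D])%Z -> section l = section m.
Proof. by move=> e; rewrite /section (theta_mod R e). Qed.

Definition transl_x : H := (D%:R^-1, 0, 0).
Definition transl_y : H := (0, D%:R^-1, 0).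

Lemma theta_t l x y t t' : theta D l (x, y, t) = theta D l (x, y, t') :> R[i].
Proof.
Transparent theta.
by rewrite /theta.
Opaque theta.
Qed.

Lemma section_transl_y l p : section l (transl_y * p)%g = wavec l D%:R^-1 * section l p.
Proof.
case: p => [[x y] t]; rewrite heis_mulE /section add0r theta_y// mulrCA mulrA.
rewrite (theta_t l x y _ t) mulrA; congr (_ * _ * _); rewrite !twistE; congr cexp; cring.
Qed.

Lemma section_shift l (j : nat) x y t :
  section l (j%:R / D%:R + x, y, t - 2 * (j%:R / D%:R) * y) = section (l - j%:Z) (x, y, t).
Proof.
rewrite /section theta_x// mulrA -cexpD (theta_t _ x y _ t); congr (cexp _ * _).
by rewrite !twistE /T; cfield; rewrite D0.
Qed.

Lemma section_transl_x l p : section l (transl_x * p)%g = section (l - 1) p.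
Proof.
case: p => [[x y] t]; rewrite heis_mulE.
have := section_shift l 1 x y t; rewrite div1r => <-.
have -> : (D%:R^-1 + x, 0 + y, 0 + t + 2 * (0 * x - D%:R^-1 * y)) =
  (D%:R^-1 + x, y, t - 2 * D%:R^-1 * y) :> H by congr (_, _, _); ring.
by [].
Qed.

Lemma ground_section l : ground (section l).
Proof.
have sth := smooth_theta R D_gt0 l.
have hth : holomorphic (theta D l : H -> R[i]) by move=> p; exact: theta_holomorphic.
have [st sz] := twisted_ground T sth hth.
split=> //; first exact: smooth_twisted.
split=> -[[x y] t]; rewrite heis_mulE.
  have e : (l - D%:Z == l %[mod D])%Z.
    by rewrite eqz_mod_dvd; apply/dvdzP; exists (-1); ring.
  have := section_shift l D x y t; rewrite (section_mod e) mulfV// => <-.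
  have -> : (1 + x, 0 + y, 0 + t + 2 * (0 * x - 1 * y)) =
    (1 + x, y, t - 2 * 1 * y) :> H by congr (_, _, _); ring.
  by [].
rewrite /section add0r theta_y1// (theta_t l x y _ t); congr (_ * _).
by rewrite !twistE; congr cexp; cring.
Qed.

(** At the origin the theta series is a sum of nonnegative terms, one of them
    positive. *)
Lemma section_origin l : exists2 s : R, 0 < s & section l (0, 0, 0) = s%:C.
Proof.
have t0 m : tterm D l 0 0 m = (tcoef R D l m)%:C.
  by rewrite /tterm -[0 +i* 0]/(0 : R[i]) mulr0 cexp0 mulr1.
have [B [h1 h2]] := @cfast_tterm R D D_gt0 l 0 0.
have E : (fun m => complex.Re (tterm D l 0 0 m)) = tcoef R D l.
  by apply/funext => m; rewrite t0.
have hB : fast B (tcoef R D l) by rewrite -E.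
exists (zsum (fun m => tcoef R D l m)).
  have c0 m : 0 <= tcoef R D l m by rewrite /tcoef; case: ifP => // _; exact: expR_ge0.
  by apply: lt_le_trans (zsum_ge0 hB c0 l); rewrite /tcoef eqxx expR_gt0.
Transparent theta.
rewrite /section twistE /theta /czsum.
Opaque theta.
rewrite -[RHS](mul1r); congr (_ * _).
  by rewrite -cexp0; congr cexp; cring.
apply: complex_congr.
  by congr zsum; apply/funext => m; rewrite t0.
have z0 : zsum (fun _ : int => 0 : R) = 0.
  have := zsum_comb 0 0 hB hB; rewrite !mul0r addr0 => z0; rewrite -[RHS]z0.
  by congr zsum; apply/funext => m; rewrite !mul0r addr0.
by rewrite -[RHS]z0; congr zsum; apply/funext => m; rewrite t0.
Qed.

(** Fourier coefficients along the segment x = t = 0. *)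
Definition coef f m : R[i] := cmean (fun y => f (0, y, 0) * wavec (- m) y).

Lemma ccontinuous_coef f x m : smooth f -> ccontinuous (fun y => f (x, y, 0) * wavec m y).
Proof.
move=> sf; apply: ccontinuous_mul; first exact: ccontinuous_slice_y.
exact: ccontinuous_wavec.
Qed.

Lemma coef_comb k (a : 'I_k -> R[i]) (e : 'I_k -> H -> R[i]) m :
  (forall j, smooth (e j)) ->
  coef (fun p => \sum_j a j * e j p) m = \sum_j a j * coef (e j) m.
Proof.
move=> se.
have lin (u u' : R[i]) f g (p : H) : smooth f -> smooth g ->
    (fun f (_ : H) => coef f m) (fun q => u * f q + u' * g q) p = u * coef f m + u' * coef g m.
  move=> sf sg; rewrite /coef -cmean_comb; try exact: ccontinuous_coef.
  by congr cmean; apply/funext => y; ring.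
by have [_ h] := comb_sum a lin se; exact: (h (0, 0, 0)).
Qed.

Lemma coef_scale (a : R[i]) f m : smooth f -> coef (fun p => a * f p) m = a * coef f m.
Proof.
move=> sf; have := coef_comb (k := 1) (fun=> a) m (fun=> sf).
by rewrite big_ord1 => <-; congr coef; apply/funext => p; rewrite big_ord1.
Qed.

Lemma coef_transl_y f m : ground f ->
  coef (fun p => f (transl_y * p)%g) m = wavec m D%:R^-1 * coef f m.
Proof.
move=> hf; have sf := ground_smooth hf.
pose g y := f (0, y, 0) * wavec (- m) y.
have gp y : g (1 + y) = g y.
  by rewrite /g wavec1 (lattice_y _ _ _ (ground_lattice hf)) mulr0 subr0.
have Dge : 0 <= (D%:R^-1 : R) by rewrite invr_ge0 ltW.
have ch := ccontinuous_coef 0 (- m) (smooth_ltrans transl_y sf).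
have E : coef f m = wavec (- m) D%:R^-1 * coef (fun p => f (transl_y * p)%g) m.
  rewrite {1}/coef -/g -(cmean_shift (ccontinuous_coef 0 (- m) sf) gp Dge) -(cmeanZ _ ch).
  congr cmean; apply/funext => y; rewrite heis_mulE /g wavecD mulrCA; congr (_ * (f _ * _)).
  by congr (_, _, _); ring.
rewrite E mulrA (_ : wavec m _ * _ = 1) ?mul1r//.
by rewrite /wavec -cexpD -[RHS]cexp0 mulrNz; congr cexp; cring.
Qed.

Lemma cderive_z v (p : H) : cderive v (fun p : H => p.1.1 +i* p.1.2 : R[i]) p = v.1.1 +i* v.1.2.
Proof.
Transparent cderive.
by rewrite /cderive /=; apply: complex_congr; [exact: derive_x|exact: derive_y].
Opaque cderive.
Qed.

(** The m-th Fourier coefficient of the holomorphic function attached to f,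
    divided by [exp (2 pi m x)], does not depend on x.  Comparing x = 0 with x = 1
    gives the recurrence; uniqueness of Fourier coefficients gives the rest. *)
Lemma ground_coefP f : ground f ->
  (forall m, coef f m = cexp (2 * T - 2 * pi * m%:~R)%:C * coef f (m - D%:Z)) /\
  ((forall m, coef f m = 0) -> forall p, f p = 0).
Proof.
move=> hf; have [sf fT fZ fl] := hf.
have [K [sK hK fE]] := ground_untwist sf fT fZ.
have fK p : f p = cexp (twist T p) * K p by rewrite fE.
have ft x y t s : f (x, y, s + t) = cexp ('i%C * (T * s)%:C) * f (x, y, t).
  exact: t_eigenP.
pose w m p : R[i] := (- (2 * pi * m%:~R))%:C * (p.1.1 +i* p.1.2).
have sz : smooth (fun p : H => p.1.1 +i* p.1.2 : R[i]).
  by apply/smoothP; split; [exact: rsmooth_x|exact: rsmooth_y].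
have sw m : smooth (w m) by exact: smoothZ.
pose Km m p := K p * cexp (w m p).
have sKm m : smooth (Km m) by apply: smooth_mul => //; exact: smooth_cexp.
have Ky x y t : K (x, 1 + y, t) = K (x, y, t).
  have := lattice_y x y t fl; rewrite (addrC t) ft !fK mulrA -cexpD.
  have -> : 'i%C * (T * - (2 * x))%:C + twist T (x, y, t) = twist T (x, 1 + y, t).
    by rewrite !twistE; cring.
  by apply: mulfI; exact: cexp_neq0.
have Kx x y t : K (1 + x, y, t) = cexp ((4 * T * x + 2 * T) +i* (4 * T * y)) * K (x, y, t).
  have := lattice_x x y t fl; rewrite (addrC t) ft !fK mulrA -cexpD.
  have -> : 'i%C * (T * (2 * y))%:C + twist T (x, y, t) =
      twist T (1 + x, y, t) + ((4 * T * x + 2 * T) +i* (4 * T * y)).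
    by rewrite !twistE; cring.
  by rewrite [in RHS]cexpD -mulrA; apply: mulfI; exact: cexp_neq0.
have wy m x y t : cexp (w m (x, 1 + y, t)) = cexp (w m (x, y, t)).
  rewrite -[RHS]mul1r -(wavec_int R (- m)) /wavec -cexpD; congr cexp.
  by rewrite /w mulrNz; cring.
have dKm m p : cderive e_x (Km m) p = - 'i%C * cderive e_y (Km m) p.
  rewrite !(cderive_mul _ _ sK (smooth_cexp (sw m))) !(cderive_cexp _ _ (sw m)) !(cderiveZ _ _ _ sz).
  rewrite !cderive_z (hK p).1 e_xP e_yP /=.
  by move: (cderive e_x K p) (K p) (cexp _) => [a a'] [b b'] [d d']; cring.
have const m x : cmean (fun y => Km m (x, y, 0)) = cmean (fun y => Km m (0, y, 0)).
  apply: cmean_const => // x'.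
  under eq_fun do rewrite dKm.
  rewrite cmeanZ; last exact: ccontinuous_slice_y (smooth_cderive _ (sKm m)).
  by rewrite cmean_dy ?mulr0// => y; rewrite /Km Ky wy.
have Km0 m : cmean (fun y => Km m (0, y, 0)) = coef f m.
  congr cmean; apply/funext => y; rewrite fK /Km /w.
  have -> : twist T (0, y, 0) = 0 by rewrite twistE; cring.
  rewrite cexp0 mul1r /wavec; congr (_ * cexp _).
  by rewrite mulrNz; cring.
split=> [m|c0].
  rewrite -Km0 -(const m 1) -Km0 -cmeanZ; last exact: ccontinuous_slice_y (sKm _).
  congr cmean; apply/funext => y.
  have := Kx 0 y 0; rewrite addr0 /Km => ->.
  rewrite mulrAC -cexpD [RHS]mulrCA mulrC -cexpD; congr (_ * cexp _).
  by rewrite /w intrB -pmulrn /T; cfield.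
move=> [[x y] t]; rewrite -[t]addr0 ft fK.
have cK : ccontinuous (fun y => K (x, y, 0)) by exact: ccontinuous_slice_y.
rewrite (cfourier_eq0 cK) ?mulr0// => m.
have := const (- m) x; rewrite Km0 c0.
have -> : (fun y => Km (- m) (x, y, 0)) =
    fun y => cexp (2 * pi * m%:~R * x)%:C * (K (x, y, 0) * wavec m y).
  apply/funext => z; rewrite /Km mulrCA; congr (_ * _).
  by rewrite /wavec -cexpD; congr cexp; rewrite /w mulrNz; cring.
rewrite cmeanZ; last by apply: ccontinuous_mul => //; exact: ccontinuous_wavec.
by move=> /eqP; rewrite mulf_eq0 (negbTE (cexp_neq0 _)) => /eqP.
Qed.

(** By [ground_coefP] the coefficients at m and m - D are proportional. *)
Lemma coef_eq0_mod f l m : ground f -> (l == m %[mod D])%Z -> coef f l = 0 -> coef f m = 0.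
Proof.
move=> hf; have [sh _] := ground_coefP hf.
have step (k : nat) a : (coef f (a + k%:Z * D%:Z) == 0) = (coef f a == 0).
  elim: k => [|k IHk]; first by rewrite mul0r addr0.
  rewrite sh mulf_eq0 (negbTE (cexp_neq0 _)) /= -IHk; congr (coef f _ == 0).
  by rewrite intS; ring.
rewrite eqz_mod_dvd => /dvdzP[[k|k] /(canRL (subrK _))]; rewrite addrC => -> /eqP c0; apply/eqP.
  by rewrite -(step k).
rewrite -(step k.+1) in c0; move: c0; congr (coef f _ == 0).
by rewrite NegzE; ring.
Qed.

Lemma ground_eq0 f : ground f -> (forall l : 'I_D, coef f (Posz l) = 0) -> forall p, f p = 0.
Proof.
move=> hf c0; apply: (ground_coefP hf).2 => m.
have lt : (`|(m %% D)%Z| < D)%N.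
  have := ltz_pmod m (_ : 0 < D%:Z); have := modz_ge0 m (_ : D%:Z != 0); lia.
apply: (coef_eq0_mod hf _ (c0 (Ordinal lt))) => /=.
have -> : Posz `|(m %% D)%Z| = (m %% D)%Z by have := modz_ge0 m (_ : D%:Z != 0); lia.
by rewrite modz_mod.
Qed.

End GroundBasis.

Local Opaque e_x e_y e_t cderive Xop Yop Zop Zbarop sumsq primitive mean zsum harm_series theta cmean coef.

(** * The quarter turn on the ground level *)

Section TurnMatrix.
Variable R : realType.
Variable D : nat.
Hypothesis D_gt0 : (0 < D)%N.
Local Notation H := (heis R).
Implicit Types (f : H -> R[i]) (x y t : R) (l m : int) (p : H).
Local Notation section := (section (R := R) D).
Local Notation coef := (@coef R).

Let D0 : D%:R != 0 :> R. Proof. by rewrite pnatr_eq0 -lt0n. Qed.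
Let Dp : 0 < D%:R :> R. Proof. by rewrite ltr0n. Qed.

Definition zeta : R[i] := wavec 1 D%:R^-1.

Lemma wavec_add l m (s : R) : wavec (l + m) s = wavec l s * wavec m s.
Proof. by rewrite /wavec -cexpD intrD; congr cexp; cring. Qed.

Lemma wavec_nat (k : nat) : wavec k%:Z D%:R^-1 = zeta ^+ k.
Proof.
elim: k => [|k IHk]; last by rewrite intS wavec_add IHk exprS.
by rewrite expr0 /wavec -cexp0; congr cexp; cring.
Qed.

Lemma zeta_expD : zeta ^+ D = 1.
Proof.
rewrite -wavec_nat -[RHS](wavec_int R 1) /wavec -pmulrn; congr (cexp (_ * _%:C)).
by field; rewrite D0.
Qed.

Lemma zeta_exp_neq1 (k : nat) : (0 < k < D)%N -> zeta ^+ k != 1.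
Proof.
move=> /andP[k0 kD]; rewrite -wavec_nat wavecE; apply/eqP => -[E _].
pose u : R := pi * k%:R / D%:R.
have u2 : 2 * pi * k%:~R / D%:R = u *+ 2 by rewrite /u -pmulrn -mulr_natl; ring.
move: E; rewrite u2 cos_mulr2n cos2sin2 => E.
have p0 := pi_gt0 R.
have s0 : 0 < sin u.
  apply: sin_gt0_pi; rewrite /u; apply/andP; split.
    by rewrite divr_gt0// mulr_gt0// ltr0n.
  by rewrite ltr_pdivrMr// ltr_pM2l// ltr_nat.
have := exprn_gt0 2 s0; move: E; rewrite -mulr_natl; lra.
Qed.

Lemma wavec_eq1 l : wavec l D%:R^-1 = 1 :> R[i] -> (D %| l)%Z.
Proof.
have lt : (`|(l %% D)%Z| < D)%N.
  have := ltz_pmod l (_ : 0 < D%:Z); have := modz_ge0 l (_ : D%:Z != 0); lia.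
have e : Posz `|(l %% D)%Z| = (l %% D)%Z by have := modz_ge0 l (_ : D%:Z != 0); lia.
have ee : (l == (l %% D)%Z %[mod D])%Z by rewrite modz_mod.
rewrite (wavec_mod R D_gt0 ee) -e wavec_nat => z1.
have [l0|l0] := posnP `|(l %% D)%Z|%N.
  by apply/dvdz_mod0P; rewrite -e l0.
by have := zeta_exp_neq1 (introT andP (conj l0 lt)); rewrite z1 eqxx.
Qed.

(** Translation by 1/D in y is diagonal with distinct eigenvalues, both on the
    sections and on the coefficients. *)
Lemma coef_section_neq l m : ~~ (l == m %[mod D])%Z -> coef (section l) m = 0.
Proof.
move=> lm; have := coef_transl_y D_gt0 m (ground_section R D_gt0 l).
have -> : (fun p => section l (transl_y R D * p)%g) = fun p => wavec l D%:R^-1 * section l p.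
  by apply/funext => p; exact: section_transl_y.
have sl := ground_smooth (ground_section R D_gt0 l).
rewrite (coef_scale _ m sl).
move=> /eqP; rewrite -subr_eq0 -mulrBl mulf_eq0 => /orP[|/eqP//].
rewrite subr_eq0 => /eqP E; case/negP: lm; rewrite eqz_mod_dvd; apply: wavec_eq1.
have : wavec (l - m) D%:R^-1 * wavec m D%:R^-1 = 1 * wavec m D%:R^-1 :> R[i].
  by rewrite -wavec_add subrK E mul1r.
by apply: mulIf; rewrite /wavec cexp_neq0.
Qed.

(** Otherwise every coefficient of the section would vanish, although its value at
    the origin is positive. *)
Lemma coef_section_diag l : coef (section l) l != 0.
Proof.
apply/eqP => c0; have [s s0 E] := section_origin R D_gt0 l.
have := (ground_coefP (ground_section R D_gt0 l)).2.
move=> /(_ _ (0, 0, 0)) h; have : s%:C = 0 :> R[i].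
  rewrite -E; apply: h => m; have [lm|lm] := boolP (l == m %[mod D])%Z.
    exact: (coef_eq0_mod (ground_section R D_gt0 l) lm c0).
  exact: coef_section_neq.
by move=> /eqP; rewrite fmorph_eq0 gt_eqF.
Qed.

Lemma ord_mod (i j : 'I_D) : (Posz i == Posz j %[mod D])%Z = (i == j).
Proof.
by rewrite !modz_small ?lez_nat ?ltz_nat ?ltn_ord.
Qed.

Lemma coef_sections (a : 'I_D -> R[i]) (m : 'I_D) :
  coef (fun p => \sum_j a j * section (Posz j) p) (Posz m) = a m * coef (section (Posz m)) (Posz m).
Proof.
rewrite coef_comb => [|j]; last exact: ground_smooth (ground_section R D_gt0 _).
rewrite (bigD1 m)//= big1 ?addr0// => j jm.
by rewrite coef_section_neq ?mulr0// ord_mod.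
Qed.

Lemma sections_free (a : 'I_D -> R[i]) :
  (forall p, \sum_j a j * section (Posz j) p = 0) -> forall j, a j = 0.
Proof.
move=> a0 j; have := coef_sections a j.
have -> : (fun p => \sum_j a j * section (Posz j) p) = fun p => \sum_(j < D) 0 * section (Posz j) p.
  by apply/funext => p; rewrite a0 big1// => i _; rewrite mul0r.
rewrite (coef_sections (fun=> 0)) mul0r => /esym/eqP.
by rewrite mulf_eq0 (negbTE (coef_section_diag _)) orbF => /eqP.
Qed.

Lemma sections_span f : ground D f ->
  exists a : 'I_D -> R[i], f = fun p => \sum_j a j * section (Posz j) p.
Proof.
move=> hf; pose a (j : 'I_D) := coef f (Posz j) / coef (section (Posz j)) (Posz j).
exists a; have hs : ground D (fun p => \sum_j a j * section (Posz j) p).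
  by apply: ground_comb => j; exact: ground_section.
pose e (i : 'I_2) := if i == ord0 then f else fun p => \sum_j a j * section (Posz j) p.
pose b (i : 'I_2) : R[i] := if i == ord0 then 1 else - 1.
have he i : ground D (e i) by rewrite /e; case: ifP.
have E p : \sum_i b i * e i p = f p - \sum_j a j * section (Posz j) p.
  by rewrite !big_ord_recl big_ord0 /b /e /= mul1r mulN1r addr0.
apply/funext => p; apply/eqP; rewrite -subr_eq0 -E; apply/eqP.
apply: (ground_eq0 D_gt0 (ground_comb b he)) => l.
rewrite coef_comb => [|j]; last exact: ground_smooth (he j).
rewrite !big_ord_recl big_ord0 /b /e /= mul1r mulN1r addr0 coef_sections /a.
by rewrite divfK ?subrr// coef_section_diag.
Qed.

Variables (c : R) (n : nat).
Hypothesis cD : pi * D%:R / 2 * c = 2 * pi * n%:R.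

Lemma turn_transl_x s p : turn s (transl_x R D * p)%g = (transl_y R D * turn s p)%g.
Proof.
by case: p => [[x y] t]; rewrite /turn !heis_mulE /=; congr (_, _, _); ring.
Qed.

Lemma turn_transl_y s p : (transl_x R D * turn s (transl_y R D * p))%g = turn s p.
Proof.
by case: p => [[x y] t]; rewrite /turn !heis_mulE /=; congr (_, _, _); ring.
Qed.

Lemma ground_turn f s : ground D f -> ground D (fun p => f (turn s p)).
Proof.
move=> [sf fT fZ [f1 f2]]; split.
- exact: smooth_turn.
- by move=> p; rewrite dt_turn fT.
- by move=> p; rewrite Zbarop_turn// fZ mulr0.
- split=> p.
    rewrite -[RHS]f2; congr f.
    by case: p => [[x y] t]; rewrite /turn !heis_mulE /=; congr (_, _, _); ring.
  rewrite -[LHS]f1; congr f.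
  by case: p => [[x y] t]; rewrite /turn !heis_mulE /=; congr (_, _, _); ring.
Qed.

(** The turn exchanges the translations by 1/D in x and in y.  One of them is
    diagonal and the other cyclic on the sections, so the matrix of the turn is
    determined up to a factor by its corner entry; the values at the origin, which
    are positive, show that this factor is i^n times a positive number. *)
Lemma turn_section_prop : exists r : R, 0 < r /\
  forall (l : 'I_D) p, section (Posz l) (turn (c / 4) p) =
    \sum_(m < D) 'i%C ^+ n * r%:C * zeta ^+ (l * m) * section (Posz m) p.
Proof.
pose G l p := section l (turn (c / 4) p).
have hG l : ground D (G l) by apply: ground_turn; exact: ground_section.
have [A hA] : exists A : 'I_D -> 'I_D -> R[i],
    forall (l : 'I_D) p, G (Posz l) p = \sum_(m < D) A l m * section (Posz m) p.
  have /choice[A hA] : forall l : 'I_D, exists a : 'I_D -> R[i],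
      G (Posz l) = fun p => \sum_(m < D) a m * section (Posz m) p.
    by move=> l; exact: sections_span.
  by exists A => l p; rewrite hA.
have Gx (l : int) p : G l (transl_x R D * p)%g = wavec l D%:R^-1 * G l p.
  by rewrite /G turn_transl_x section_transl_y.
have Gy (l : int) p : G l (transl_y R D * p)%g = G (l + 1) p.
  by rewrite /G -(turn_transl_y (c / 4) p) section_transl_x// addrK.
have coefG (l : 'I_D) (m : 'I_D) : coef (G (Posz l)) (Posz m) = A l m * coef (section (Posz m)) (Posz m).
  have -> : G (Posz l) = fun p => \sum_(m < D) A l m * section (Posz m) p.
    by apply/funext => p; rewrite hA.
  exact: coef_sections.
have Ax (l m m' : 'I_D) : m' = m.+1 :> nat -> A l m' = zeta ^+ l * A l m.
  move=> mm.
  have : coef (fun p => \sum_j A l j * section (Posz j - 1) p) (Posz m) =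
      coef (fun p => zeta ^+ l * G (Posz l) p) (Posz m).
    congr (coef _ _); apply/funext => p; rewrite -wavec_nat -Gx hA.
    by apply: eq_bigr => j _; rewrite section_transl_x.
  rewrite coef_comb => [|j]; last exact: ground_smooth (ground_section R D_gt0 _).
  rewrite (bigD1 m')//= big1 => [|j jm]; last first.
    rewrite coef_section_neq ?mulr0//; apply: contra jm.
    rewrite -ord_mod !eqz_mod_dvd mm intS; congr (D %| _)%Z; ring.
  rewrite addr0 mm intS addrAC subrr add0r.
  rewrite (coef_scale _ (Posz m) (ground_smooth (hG (Posz l)))).
  by rewrite coefG mulrA; apply: mulIf; exact: coef_section_diag.
have Ay (l l' m : 'I_D) : l' = l.+1 :> nat -> A l' m = zeta ^+ m * A l m.
  move=> ll; have := coef_transl_y D_gt0 (Posz m) (hG (Posz l)).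
  have -> : (fun p => G (Posz l) (transl_y R D * p)%g) = G (Posz l').
    by apply/funext => p; rewrite Gy ll intS addrC.
  by rewrite !coefG wavec_nat mulrA; apply: mulIf; exact: coef_section_diag.
pose o : 'I_D := Ordinal D_gt0.
have A0m (m : 'I_D) : A o m = A o o.
  case: m => k; elim: k => [|k IHk] kD; first by congr (A o _); exact: val_inj.
  by rewrite (Ax o (Ordinal (ltnW kD)))// IHk expr0 mul1r.
have Alm (l m : 'I_D) : A l m = A o o * zeta ^+ (l * m).
  case: l => k; elim: k => [|k IHk] kD.
    by rewrite mul0n expr0 mulr1 -(A0m m); congr (A _ m); exact: val_inj.
  by rewrite (Ay (Ordinal (ltnW kD)))// IHk /= mulSn exprD; ring.
have /choice[s hs] : forall m : 'I_D, exists s : R, 0 < s /\ section (Posz m) (0, 0, 0) = s%:C.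
  by move=> m; have [s s0 e] := section_origin R D_gt0 (Posz m); exists s.
have S0 : 0 < \sum_(m < D) s m.
  rewrite (bigD1 o)//= ltr_pwDl ?(hs o).1//.
  by apply: sumr_ge0 => i _; rewrite ltW// (hs i).1.
have eG : G 0 (0, 0, 0) = 'i%C ^+ n * (s o)%:C.
  rewrite /G /turn /= oppr0 (t_eigenP _ _ _ _ (ground_smooth (ground_section R D_gt0 0))
    (ground_t (ground_section R D_gt0 0))).
  congr (_ * _); last exact: (hs o).2.
  have -> : pi * D%:R / 2 * (c / 4) = n%:R * (pi / 2) :> R.
    by rewrite mulrA cD; field.
  rewrite -[LHS](_ : cexp (('i%C * (pi / 2)%:C) *+ n) = _).
    rewrite cexpMn /cexp /= !mul0r !mul1r subr0 add0r expR0 !mul1r cos_pihalf sin_pihalf.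
    by [].
  by congr cexp; rewrite mulr_natl rmorphMn mulrnAr.
exists (s o / \sum_(m < D) s m); split; first by rewrite divr_gt0// (hs o).1.
have Aoo : A o o = 'i%C ^+ n * (s o / \sum_(m < D) s m)%:C.
  have := hA o (0, 0, 0); rewrite eG.
  have -> : \sum_(m < D) A o m * section (Posz m) (0, 0, 0) = A o o * (\sum_(m < D) s m)%:C.
    rewrite rmorph_sum mulr_sumr; apply: eq_bigr => m _.
    by rewrite A0m (hs m).2.
  move=> E; have SC : (\sum_(m < D) s m)%:C != 0 :> R[i] by rewrite fmorph_eq0 gt_eqF.
  by apply: (mulIf SC); rewrite -E -mulrA -rmorphM divfK// gt_eqF.
move=> l p; rewrite -/(G _ p) hA; apply: eq_bigr => m _.
by rewrite Alm Aoo.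
Qed.

End TurnMatrix.

(** * Chebyshev polynomials and vanishing trigonometric sums *)

Section Chebyshev.
Variable R : realType.
Implicit Types (a b : {poly R}) (th : R).

(** Solutions of the recurrence of the Chebyshev polynomials of both kinds. *)
Definition cheb a b (n : nat) : {poly R} :=
  (iter n (fun p : {poly R} * {poly R} => (p.2, 2 *: ('X * p.2) - p.1)) (a, b)).1.

Lemma chebSS a b n : cheb a b n.+2 = 2 *: ('X * cheb a b n.+1) - cheb a b n.
Proof. by []. Qed.

Lemma cheb_cos n th : (cheb 1 'X n).[cos th] = cos (n%:R * th).
Proof.
suff [] : (cheb 1 'X n).[cos th] = cos (n%:R * th) /\
  (cheb 1 'X n.+1).[cos th] = cos (n.+1%:R * th) by [].
elim: n => [|n [IH1 IH2]]; first by rewrite hornerC hornerX mul0r cos0 mul1r.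
split=> //; rewrite chebSS hornerD hornerN hornerZ hornerM hornerX IH1 IH2.
have -> : n.+2%:R * th = n.+1%:R * th + th by rewrite -[n.+2%:R]natr1; ring.
have -> : n%:R * th = n.+1%:R * th - th by rewrite -[n.+1%:R]natr1; ring.
by rewrite (cosD _ th) cosB; ring.
Qed.

Lemma cheb_sin n th : sin th * (cheb 0 1 n).[cos th] = sin (n%:R * th).
Proof.
suff [] : sin th * (cheb 0 1 n).[cos th] = sin (n%:R * th) /\
  sin th * (cheb 0 1 n.+1).[cos th] = sin (n.+1%:R * th) by [].
elim: n => [|n [IH1 IH2]].
  by rewrite !hornerC mul0r sin0 !mul1r mulr0 mulr1.
split=> //; rewrite chebSS hornerD hornerN hornerZ hornerM hornerX.
have -> : n.+2%:R * th = n.+1%:R * th + th by rewrite -[n.+2%:R]natr1; ring.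
have := IH1; have -> : n%:R * th = n.+1%:R * th - th by rewrite -[n.+1%:R]natr1; ring.
rewrite (sinD _ th) sinB -IH2 => E.
transitivity (2 * cos th * (sin th * (cheb 0 1 n.+1).[cos th]) - sin th * (cheb 0 1 n).[cos th]).
  by ring.
by rewrite E; ring.
Qed.

Lemma cheb_size a b (e : nat) : (e <= 1)%N -> (size a <= 1 - e)%N -> (size b <= 2 - e)%N ->
  0 < b`_(1 - e) ->
  forall n, (size (cheb a b n) <= n.+1 - e)%N /\ ((0 < n)%N -> 0 < (cheb a b n)`_(n - e)).
Proof.
move=> e1 sa sb b0.
suff S n : [/\ (size (cheb a b n) <= n.+1 - e)%N, (size (cheb a b n.+1) <= n.+2 - e)%N &
    0 < (cheb a b n.+1)`_(n.+1 - e)].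
  by case=> [|n]; split=> //; have [] := S n.
elim: n => [//|n [s1 s2 c0]]; split=> //.
  apply/leq_sizeP => j hj; rewrite chebSS coefB coefZ coefXM.
  rewrite (nth_default 0 (leq_trans s1 _)); last by lia.
  case: j hj => [|j] hj; first by lia.
  rewrite /= (nth_default 0 (leq_trans s2 _)); last by lia.
  by rewrite mulr0 subr0.
have -> : (n.+2 - e = (n.+1 - e).+1)%N by lia.
rewrite chebSS coefB coefZ coefXM /= (nth_default 0 (leq_trans s1 _)); last by lia.
by rewrite subr0 mulr_gt0.
Qed.

End Chebyshev.

(** A vector u supported on [0, q] whose trigonometric transform is a multiple of
    u itself: the transform is a polynomial of degree at most q in the nodes x_m
    (q - 1 for sine polynomials, where e = 1) and vanishes at the nodes outside
    the support. *)
Section Rigidity.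
Variables (R : realType) (h q e : nat) (P : nat -> {poly R}) (x g u : nat -> R) (kap : R).

(** The distance of j to 0 modulo 2 h. *)
Definition cdist (j : nat) : nat := if (j <= h)%N then j else (2 * h - j)%N.

Let Q : {poly R} := \sum_(j < 2 * h) u (cdist j) *: P (cdist j).

Hypothesis qh : (q < h)%N.
Hypothesis e1 : (e <= 1)%N.
Hypothesis sP : forall j, (size (P j) <= j.+1 - e)%N.
Hypothesis x_decr : forall i j, (i < j <= h)%N -> x j < x i.
Hypothesis g_gt0 : forall m, (e <= m <= h - e)%N -> 0 < g m.
Hypothesis g_h : (0 < e)%N -> g h = 0.
Hypothesis kap0 : kap != 0.
Hypothesis eqn : forall m, (m <= h)%N -> g m * Q.[x m] = kap * u m.
Hypothesis supp : forall j, (q < j <= h - e)%N -> u j = 0.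

Let supp_h j : (q < j <= h)%N -> u j = 0.
Proof.
move=> /andP[qj jh]; have [je|je] := leqP j (h - e); first by apply: supp; rewrite qj.
have jE : j = h by lia.
have := eqn jh; rewrite jE g_h ?mul0r; last by lia.
by move=> /esym/eqP; rewrite mulf_eq0 (negbTE kap0) => /eqP.
Qed.

Let cdist_le (j : 'I_(2 * h)) : (cdist j <= h)%N.
Proof. by have := ltn_ord j; rewrite /cdist; case: ifP; lia. Qed.

Let size_Q : (size Q <= q.+1 - e)%N.
Proof.
apply: (leq_trans (size_sum _ _ _)); apply/bigmax_leqP => j _.
have [jq|jq] := leqP (cdist j) q; last by rewrite supp_h ?scale0r ?size_poly0// jq cdist_le.
by apply: (leq_trans (size_scale_leq _ _)); apply: leq_trans (sP _) _; lia.
Qed.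

Let xs := [seq x m | m <- iota q.+1 (h - e - q)].

Let xs_in m : m \in iota q.+1 (h - e - q) -> (q < m <= h - e)%N.
Proof. by rewrite mem_iota; lia. Qed.

Let xs_uniq : uniq xs.
Proof.
rewrite map_inj_in_uniq ?iota_uniq// => i j /xs_in hi /xs_in hj E.
have [ij|ij|//] := ltngtP i j.
  have := x_decr (i := i) (j := j); rewrite E ltxx => /(_ _); lia.
have := x_decr (i := j) (j := i); rewrite E ltxx => /(_ _); lia.
Qed.

Let xs_roots : all (root Q) xs.
Proof.
apply/allP => _ /mapP[m /xs_in mh ->]; rewrite /root; have := @eqn m; rewrite supp// mulr0.
move=> /(_ _)/eqP; rewrite mulf_eq0 gt_eqF ?g_gt0//=; try lia.
by apply; lia.
Qed.

Let conclude : Q = 0 -> forall m, (m <= h)%N -> u m = 0.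
Proof.
move=> Q0 m mh; have := eqn mh; rewrite Q0 horner0 mulr0 => /esym/eqP.
by rewrite mulf_eq0 (negbTE kap0) => /eqP.
Qed.

(** More roots than the degree allows. *)
Lemma rigid_strict : (2 * q < h)%N -> forall m, (m <= h)%N -> u m = 0.
Proof.
move=> qh2; apply: conclude; apply: (roots_geq_poly_eq0 xs_roots xs_uniq).
by rewrite size_map size_iota; apply: leq_trans size_Q _; lia.
Qed.

(** In the borderline case a sign decides: at the node x_q the polynomial has
    the sign of its leading coefficient. *)
Lemma rigid_sign : (2 * q = h)%N -> kap < 0 -> 0 < (P q)`_(q - e) ->
  forall m, (m <= h)%N -> u m = 0.
Proof.
move=> qh2 kn cq; apply: conclude.
have [sQ|sQ] := leqP (size Q) (q - e).
  apply: (roots_geq_poly_eq0 xs_roots xs_uniq).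
  by rewrite size_map size_iota; apply: leq_trans sQ _; lia.
have sQE : size Q = (q - e).+1.
  by apply/eqP; rewrite eqn_leq sQ andbT; apply: leq_trans size_Q _; lia.
pose C : R := \sum_(j < 2 * h) (cdist j == q)%:R.
have C1 : 0 < C.
  have qo : (q < 2 * h)%N by lia.
  rewrite /C (bigD1 (Ordinal qo))//= {1}/cdist ltnW// eqxx ltr_pwDl// ?ltr01//.
  by apply: sumr_ge0 => j _; rewrite ler0n.
have lQ : lead_coef Q = C * (u q * (P q)`_(q - e)).
  rewrite lead_coefE sQE coef_sum /C mulr_suml; apply: eq_bigr => j _; rewrite coefZ.
  have [jq|jq|->] := ltngtP (cdist j) q; last by rewrite mul1r.
    rewrite mul0r nth_default ?mulr0//.
    by apply: leq_trans (sP _) _; lia.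
  by rewrite supp_h ?mul0r// jq cdist_le.
have xsr : size Q = (size xs).+1 by rewrite sQE size_map size_iota; congr _.+1; lia.
have QE := all_roots_prod_XsubC xsr xs_roots (etrans (uniq_rootsE xs) xs_uniq).
have := eqn (ltnW qh); rewrite {1}QE hornerZ lQ horner_prod.
have : 0 < \prod_(z <- xs) ('X - z%:P).[x q].
  rewrite big_seq prodr_gt0// => z /mapP[m /xs_in mh ->].
  by rewrite hornerXsubC subr_gt0 x_decr//; lia.
move: (\prod_(z <- xs) _) => p p0 E.
have gq : 0 < g q by apply: g_gt0; lia.
have pos : 0 < g q * (C * (P q)`_(q - e) * p) - kap.
  by rewrite subr_gt0; apply: lt_trans kn _; rewrite !mulr_gt0.
have : (g q * (C * (P q)`_(q - e) * p) - kap) * u q = 0.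
  by rewrite mulrBl -E; ring.
move=> /eqP; rewrite mulf_eq0 gt_eqF//= => /eqP uq.
by apply/eqP; rewrite -lead_coef_eq0 lQ uq mul0r mulr0.
Qed.

End Rigidity.

Local Opaque e_x e_y e_t cderive Xop Yop Zop Zbarop sumsq primitive mean zsum harm_series theta cmean section.

(** * Eigenspaces of the discrete Fourier transform *)

Section DFT.
Variable R : realType.
Variable D : nat.
Hypothesis D_gt0 : (0 < D)%N.
Local Notation zeta := (zeta R D).
Local Notation C := R[i].

Definition dft : 'M[C]_D := \matrix_(l, m) zeta ^+ (l * m).

Let negP (l : 'I_D) : ((D - l) %% D < D)%N. Proof. by rewrite ltn_mod. Qed.
Definition neg (l : 'I_D) : 'I_D := Ordinal (negP l).

Lemma neg0 (l : 'I_D) : l = 0%N :> nat -> neg l = 0%N :> nat.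
Proof. by move=> /= ->; rewrite subn0 modnn. Qed.

Lemma negE (l : 'I_D) : (0 < l)%N -> neg l = (D - l)%N :> nat.
Proof. by move=> l0 /=; rewrite modn_small//; have := ltn_ord l; lia. Qed.

Lemma negK : involutive neg.
Proof.
move=> l; apply: ord_inj; have [l0|l0] := posnP l.
  by rewrite [LHS]neg0 ?neg0.
have n0 : (0 < neg l)%N by rewrite negE//; have := ltn_ord l; lia.
by rewrite [LHS]negE// [X in (_ - X)%N]negE//; have := ltn_ord l; move=> lD; rewrite subKn// ltnW.
Qed.

Lemma neg_dvd (l m : 'I_D) : (D %| l + m)%N = (m == neg l).
Proof.
have [lD mD] := (ltn_ord l, ltn_ord m); apply/idP/eqP => [/dvdnP[k E]|->].
  apply: ord_inj; have [l0|l0] := posnP l.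
    by rewrite [RHS]neg0//; rewrite l0 add0n in E; case: k E => [|k]; rewrite ?mulSn ?mul0n; lia.
  by rewrite [RHS]negE//; case: k E => [|[|k]]; rewrite ?mulSn ?mul0n; lia.
have [l0|l0] := posnP l; first by rewrite neg0 ?l0.
by rewrite negE// subnKC ?dvdnn// ltnW.
Qed.

Definition refl_mx : 'M[C]_D := \matrix_(l, m) (m == neg l)%:R.

Lemma zeta_exp_eq1 k : (zeta ^+ k == 1) = (D %| k)%N.
Proof.
rewrite -(expr_mod k (zeta_expD R D_gt0)) /dvdn; have [->|k0] := posnP (k %% D)%N.
  by rewrite expr0 eqxx.
by apply: negbTE; apply: zeta_exp_neq1 => //; rewrite k0 ltn_mod.
Qed.

Lemma zeta_sum k : \sum_(j < D) zeta ^+ (k * j) = D%:R * (D %| k)%:R.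
Proof.
have [kD|kD] := boolP (D %| k)%N.
  rewrite mulr1 (eq_bigr (fun=> 1)) ?sumr_const ?card_ord// => j _.
  by apply/eqP; rewrite zeta_exp_eq1 dvdn_mulr.
rewrite mulr0; have := subrX1 (zeta ^+ k) D.
rewrite -exprM mulnC exprM (zeta_expD R D_gt0) expr1n subrr => /esym/eqP.
rewrite mulf_eq0 subr_eq0 zeta_exp_eq1 (negbTE kD) /= => /eqP E; rewrite -[RHS]E.
by apply: eq_bigr => j _; rewrite exprM.
Qed.

Lemma dft_sqr : dft *m dft = D%:R *: refl_mx.
Proof.
apply/matrixP => l m; rewrite !mxE -neg_dvd -zeta_sum; apply: eq_bigr => j _.
by rewrite !mxE -exprD mulnDl (mulnC j m).
Qed.

Lemma mulmx_refl (v : 'rV[C]_D) m : (v *m refl_mx) 0 m = v 0 (neg m).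
Proof.
rewrite mxE (bigD1 (neg m))//= !mxE negK eqxx mulr1 big1 ?addr0// => j jm.
by rewrite mxE; case: eqP => [E|_]; [rewrite E negK eqxx in jm|rewrite mulr0].
Qed.

Lemma refl_sqr : refl_mx *m refl_mx = 1%:M.
Proof.
apply/row_matrixP => i; apply/rowP => m; rewrite row_mul mulmx_refl !mxE.
by rewrite (can_eq negK) eq_sym.
Qed.

End DFT.

Section Normalisation.
Variable R : realType.
Variable D : nat.
Hypothesis D_gt0 : (0 < D)%N.
Variables (c : R) (n : nat).
Hypothesis cD : pi * D%:R / 2 * c = 2 * pi * n%:R.
Local Notation section := (section (R := R) D).
Local Notation C := R[i].

Let S (p : heis R) : 'cV[C]_D := \col_l section (Posz l) p.

(** The fourth power of the quarter turn is a central translation, under which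
    the sections are invariant; this fixes the modulus of the matrix. *)
Lemma turn_section : exists r : R, [/\ 0 < r, r ^+ 2 * D%:R = 1 &
  forall (l : 'I_D) p, section (Posz l) (turn (c / 4) p) =
    \sum_(m < D) 'i%C ^+ n * r%:C * zeta R D ^+ (l * m) * section (Posz m) p].
Proof.
have [r [r0 hr]] := turn_section_prop D_gt0 cD; exists r; split=> //.
pose a : C := 'i%C ^+ n * r%:C.
have hS p : S (turn (c / 4) p) = (a *: dft R D) *m S p.
  apply/colP => l; rewrite mxE hr mxE; apply: eq_bigr => m _.
  by rewrite !mxE.
have S4 p : S (turn (c / 4) (turn (c / 4) (turn (c / 4) (turn (c / 4) p)))) =
    (a ^+ 4 * D%:R ^+ 2) *: S p.
  have AA (v : 'cV[C]_D) : (a *: dft R D) *m ((a *: dft R D) *m v) =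
      (a ^+ 2 * D%:R) *: (refl_mx R D_gt0 *m v).
    by rewrite mulmxA -scalemxAl -scalemxAr (dft_sqr R D_gt0) !scalerA -scalemxAl.
  rewrite !hS !AA -scalemxAr scalerA mulmxA refl_sqr mul1mx; congr (_ *: _); ring.
have T4 l p : section l (turn (c / 4) (turn (c / 4) (turn (c / 4) (turn (c / 4) p)))) = section l p.
  have hg := ground_section R D_gt0 l.
  case: p => [[x y] t]; rewrite /turn /=.
  have -> : (- - x, - - y, c / 4 + (c / 4 + (c / 4 + (c / 4 + t)))) = (x, y, c + t) :> heis R.
    by congr (_, _, _); rewrite ?opprK//; field.
  rewrite (t_eigenP _ _ _ _ (ground_smooth hg) (ground_t hg)) cD.
  by have := wavec_int R n; rewrite /wavec mulr1 -pmulrn => ->; rewrite mul1r.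
have [s s0 hs] := section_origin R D_gt0 (Posz (Ordinal D_gt0)).
have := congr1 (fun v : 'cV[C]_D => v (Ordinal D_gt0) 0) (S4 (0, 0, 0)).
rewrite !mxE T4 hs => E.
have sC : s%:C != 0 :> C by rewrite fmorph_eq0 gt_eqF.
have := mulIf sC (etrans (mul1r _) E).
rewrite /a exprMn -exprM mulnC exprM -[4%N]/(2 * 2)%N exprM sqr_i sqrrN !expr1n mul1r.
rewrite exprM -exprMn -!rmorphXn -[D%:R](rmorph_nat (real_complex R)) -rmorphM -rmorphXn.
move=> /esym[rD]; have /eqP := rD; rewrite sqrf_eq1 => /orP[/eqP//|/eqP E'].
have : 0 < r ^+ 2 * D%:R by rewrite mulr_gt0 ?exprn_gt0 ?ltr0n.
by rewrite E' oppr_gt0 ltr10.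
Qed.

End Normalisation.

Section Eigenspaces.
Variable R : realType.
Local Notation C := R[i].
Variable h : nat.
Hypothesis h_gt0 : (0 < h)%N.
Local Notation D := (2 * h)%N.
Variable rho : R.
Hypothesis rho_gt0 : 0 < rho.
Hypothesis rhoD : rho ^+ 2 * D%:R = 1.
Local Notation zeta := (zeta R D).

Let D_gt0 : (0 < D)%N. Proof. by rewrite muln_gt0. Qed.
Local Notation neg := (neg D_gt0).

(** The unitary discrete Fourier transform. *)
Definition fourier : 'M[C]_D := rho%:C *: dft R D.

Lemma fourier_sqr : fourier *m fourier = refl_mx R D_gt0.
Proof.
rewrite /fourier -scalemxAl -scalemxAr (dft_sqr R D_gt0) !scalerA.
rewrite -[D%:R](rmorph_nat (real_complex R)) -!rmorphM -mulrA mulrCA mulrA -expr2.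
by rewrite mulrC mulrC rhoD rmorph1 scale1r.
Qed.

Lemma eigen_parity (mu : C) (v : 'rV_D) m : v *m fourier = mu *: v ->
  v 0 (neg m) = mu ^+ 2 * v 0 m.
Proof.
move=> E; rewrite -mulmx_refl -fourier_sqr mulmxA E -scalemxAl E scalerA -expr2.
by rewrite mxE.
Qed.

Let th (m : nat) : R := m%:R * (pi / h%:R).

Let h0 : h%:R != 0 :> R. Proof. by rewrite pnatr_eq0 -lt0n. Qed.

Let zetaE l m : zeta ^+ (l * m) = cos (l%:R * th m) +i* sin (l%:R * th m) :> C.
Proof.
rewrite -wavec_nat wavecE -pmulrn.
have -> : 2 * pi * (l * m)%:R * D%:R^-1 = l%:R * th m :> R.
  by rewrite !natrM /th; field.
by [].
Qed.

Let th_neg (l : 'I_D) m : (0 < l)%N -> (neg l)%:R * th m = - (l%:R * th m) + (m%:R * pi) *+ 2.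
Proof.
move=> l0; rewrite negE// natrB ?(ltnW (ltn_ord _))// natrM /th -mulr_natr.
by field.
Qed.

Let cos_2pi (m : nat) (x : R) : cos (x + (m%:R * pi) *+ 2) = cos x.
Proof.
elim: m => [|m IHm]; first by rewrite mul0r mul0rn addr0.
have -> : x + (m.+1%:R * pi) *+ 2 = x + (m%:R * pi) *+ 2 + pi *+ 2.
  by rewrite -natr1; move: (pi : R) => a; ring.
by rewrite cosD2pi.
Qed.

Let sin_2pi (m : nat) (x : R) : sin (x + (m%:R * pi) *+ 2) = sin x.
Proof.
elim: m => [|m IHm]; first by rewrite mul0r mul0rn addr0.
have -> : x + (m.+1%:R * pi) *+ 2 = x + (m%:R * pi) *+ 2 + pi *+ 2.
  by rewrite -natr1; move: (pi : R) => a; ring.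
by rewrite sinD2pi.
Qed.

Let cos_neg (l : 'I_D) m : cos ((neg l)%:R * th m) = cos (l%:R * th m).
Proof.
have [l0|l0] := posnP l; first by rewrite neg0 ?l0.
by rewrite th_neg// cos_2pi cosN.
Qed.

Let sin_neg (l : 'I_D) m : sin ((neg l)%:R * th m) = - sin (l%:R * th m).
Proof.
have [l0|l0] := posnP l; first by rewrite neg0 ?l0// mul0r sin0 oppr0.
by rewrite th_neg// sin_2pi sinN.
Qed.

Let trig (e : nat) (x : R) : R := if e == 0%N then cos x else sin x.

Let trig_neg e (l : 'I_D) m : (e <= 1)%N ->
  trig e ((neg l)%:R * th m) = (- 1) ^+ e * trig e (l%:R * th m).
Proof. by case: e => [|[|//]] _; rewrite /trig /= ?cos_neg ?sin_neg ?mul1r ?mulN1r. Qed.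

(** By parity the transform of an eigenvector is a cosine sum (e = 0) or i times a
    sine sum (e = 1). *)
Lemma eigen_trig (e : nat) (nu : C) (v : 'rV_D) (m : 'I_D) : (e <= 1)%N -> nu ^+ 2 = 1 ->
  v *m fourier = ('i%C ^+ e * nu) *: v ->
  nu * v 0 m = rho%:C * \sum_(l < D) (trig e (l%:R * th m))%:C * v 0 l.
Proof.
move=> e1 nu1 E; have par l := eigen_parity l E.
have mu2 : ('i%C ^+ e * nu) ^+ 2 = (- 1) ^+ e by rewrite exprMn nu1 mulr1 exprAC sqr_i.
rewrite mu2 in par.
have odd0 : \sum_(l < D) (trig (1 - e) (l%:R * th m))%:C * v 0 l = 0.
  set s := LHS; have : s = - s.
    rewrite {1}/s (reindex_inj (can_inj (negK D_gt0))) /= -sumrN; apply: eq_bigr => l _.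
    rewrite par trig_neg ?leq_subr// rmorphM rmorphXn rmorphN1.
    by case: e e1 {E par mu2 s} => [|[|//]] _; ring.
  move=> /eqP; rewrite -addr_eq0 -mulr2n -mulr_natl mulf_eq0 pnatr_eq0 /=.
  by move=> /eqP.
have i0 : 'i%C ^+ e != 0 :> C by rewrite expf_neq0 ?imaginary_neq0.
apply: (mulfI i0); rewrite mulrA.
transitivity ((v *m fourier) 0 m); first by rewrite E mxE.
have -> : (v *m fourier) 0 m = rho%:C * (\sum_(l < D) (trig 0 (l%:R * th m))%:C * v 0 l +
    'i%C * \sum_(l < D) (trig 1 (l%:R * th m))%:C * v 0 l).
  rewrite mxE mulr_sumr -big_split mulr_sumr; apply: eq_bigr => l _.
  rewrite !mxE zetaE /trig /=.
  by move: (cos _) (sin _) (v 0 l) => a b [d d']; cring.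
case: e e1 odd0 {E par mu2 i0} => [|[|//]] _ => [|] ->.
  by rewrite mulr0 addr0 mul1r.
by rewrite add0r mulrCA.
Qed.

Let o (j : nat) : 'I_D := insubd (Ordinal D_gt0) j.

Let oK (j : nat) : (j < D)%N -> o j = j :> nat.
Proof. by move=> jD; rewrite /o insubdK. Qed.

Let oE (l : 'I_D) : o l = l. Proof. by apply: ord_inj; rewrite oK. Qed.

Let P (e : nat) : nat -> {poly R} := if e == 0%N then cheb 1 'X else cheb 0 1.
Let g (e m : nat) : R := if e == 0%N then 1 else sin (th m).

Let trigE e j m : trig e (j%:R * th m) = g e m * (P e j).[cos (th m)].
Proof. by rewrite /trig /g /P; case: eqP => _; rewrite ?mul1r ?cheb_cos ?cheb_sin. Qed.

Let sizeP e : (e <= 1)%N -> forall j, (size (P e j) <= j.+1 - e)%N /\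
  ((0 < j)%N -> 0 < (P e j)`_(j - e)).
Proof.
case: e => [|[|//]] _ j; rewrite /P /=; apply: cheb_size => //.
- by rewrite size_poly1.
- by rewrite size_polyX.
- by rewrite coefX ltr01.
- by rewrite size_poly0.
- by rewrite size_poly1.
- by rewrite coef1 ltr01.
Qed.

Let th_in m : (m <= h)%N -> 0 <= th m <= pi.
Proof.
move=> mh; have p0 := pi_gt0 R; apply/andP; split.
  by rewrite mulr_ge0// divr_ge0// ltW.
by rewrite /th mulrCA ger_pMr// ler_pdivrMr ?ltr0n// mul1r ler_nat.
Qed.

Let th_lt i j : (i < j)%N -> th i < th j.
Proof.
by move=> ij; rewrite ltr_pM2r ?ltr_nat// divr_gt0 ?pi_gt0 ?ltr0n.
Qed.

Let thh : th h = pi.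
Proof. by rewrite /th mulrCA divff// mulr1. Qed.

(** The vanishing lemmas on trigonometric sums apply separately to the real and
    imaginary parts of the eigenvector. *)
Lemma eigen_eq0 (e q : nat) (s : R) (v : 'rV_D) : (e <= 1)%N -> s ^+ 2 = 1 -> (q < h)%N ->
  ((2 * q < h)%N || (2 * q == h)%N && (s < 0)) ->
  v *m fourier = ('i%C ^+ e * s%:C) *: v ->
  (forall j : 'I_D, (q < j <= h - e)%N -> v 0 j = 0) -> v = 0.
Proof.
move=> e1 s1 qh qs E supp.
have s1C : s%:C ^+ 2 = 1 :> C by rewrite -rmorphXn s1.
have par l := eigen_parity l E.
have mu2 : ('i%C ^+ e * s%:C) ^+ 2 = (- 1) ^+ e by rewrite exprMn s1C mulr1 exprAC sqr_i.
rewrite mu2 in par.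
have s0 : s != 0 by apply/eqP => s0; move: s1; rewrite s0 expr2 mul0r => /esym/eqP; rewrite oner_eq0.
have kap0 : s / rho != 0 by rewrite mulf_neq0// invr_eq0 gt_eqF.
have part (w : C -> R) : (forall (a : 'I_D -> R) (z : 'I_D -> C),
      w (\sum_l (a l)%:C * z l) = \sum_l a l * w (z l)) ->
    (forall a z, w (a%:C * z) = a * w z) ->
    forall m, (m <= h)%N -> w (v 0 (o m)) = 0.
  move=> wS wZ; pose u j := w (v 0 (o j)).
  have w0 : w 0 = 0 by rewrite -[0](mul0r (0 : C)) -[X in X * _]/(0%:C) wZ mul0r.
  have wN b z : w ((- 1) ^+ b * z) = (- 1) ^+ b * w z.
    by rewrite -(wZ ((- 1) ^+ b)) rmorphXn rmorphN1.
  have eqn m : (m <= h)%N ->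
      g e m * (\sum_(j < 2 * h) u (cdist h j) *: P e (cdist h j)).[cos (th m)] = s / rho * u m.
    move=> mh; have mD : (m < D)%N by lia.
    have := congr1 w (eigen_trig (o m) e1 s1C E); rewrite !wZ oK// wS => E2.
    rewrite mulrAC -/(u m) E2 mulrAC mulfV ?gt_eqF// mul1r horner_sum mulr_sumr.
    apply: eq_bigr => l _; rewrite hornerZ mulrCA -trigE /cdist mulrC; case: ifP => lh.
      by rewrite /u oE.
    have l0 : (0 < l)%N by lia.
    rewrite -negE// trig_neg// /u oE par wN mulrACA -exprD addnn -signr_odd odd_double.
    by rewrite expr0 mul1r.
  have uS j : (q < j <= h - e)%N -> u j = 0.
    by move=> jq; rewrite /u supp ?oK//; lia.
  have decr i j : (i < j <= h)%N -> cos (th j) < cos (th i).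
    move=> /andP[ij jh]; rewrite ltr_cos ?th_lt// in_itv /=; first by apply: th_in; lia.
    exact: th_in.
  have g0 m : (e <= m <= h - e)%N -> 0 < g e m.
    rewrite /g; case: eqP => [_ _|/eqP e0 mh]; first exact: ltr01.
    apply: sin_gt0_pi; rewrite -thh th_lt/=; last by lia.
    by rewrite -[X in X < _](mul0r (pi / h%:R)) -[X in X * _]/(0%:R) th_lt//; lia.
  have gh : (0 < e)%N -> g e h = 0 by rewrite /g; case: (e) => //= _ _; rewrite thh sinpi.
  have sP j := (sizeP e1 j).1.
  case/orP: qs => [q2|/andP[/eqP q2 sn]] m mh.
    exact: (rigid_strict qh e1 sP decr g0 gh kap0 eqn uS q2 mh).
  apply: (rigid_sign qh e1 sP decr g0 gh kap0 eqn uS q2 _ _ mh).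
    by rewrite nmulr_rlt0 ?invr_gt0.
  by apply: (sizeP e1 q).2; lia.
have vz (m : nat) : (m <= h)%N -> v 0 (o m) = 0.
  move=> mh; apply/eqP; rewrite eq_complex; apply/andP; split; apply/eqP.
    apply: (part (@complex.Re R)) => // [a z|a z]; last by rewrite Re_mul /= mul0r subr0.
    by rewrite (big_morph _ (@Re_add R) (erefl _ : complex.Re (0 : C) = 0)); apply: eq_bigr => l _; rewrite Re_mul /= mul0r subr0.
  apply: (part (@complex.Im R)) => // [a z|a z]; last by rewrite Im_mul /= mul0r addr0.
  by rewrite (big_morph _ (@Im_add R) (erefl _ : complex.Im (0 : C) = 0)); apply: eq_bigr => l _; rewrite Im_mul /= mul0r addr0.
apply/rowP => l; rewrite [RHS]mxE; have [lh|lh] := leqP l h; first by rewrite -[l]oE vz.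
have n0 : v 0 (neg l) = 0.
  by rewrite -[neg l]oE vz// negE; lia.
move: n0; rewrite par => /eqP; rewrite mulf_eq0 signr_eq0 /= => /eqP.
by [].
Qed.

End Eigenspaces.

Local Opaque e_x e_y e_t cderive Xop Yop Zop Zbarop sumsq primitive mean zsum harm_series theta cmean section.

Section FourthRoots.
Variables (R : realType) (d : nat).
Local Notation C := R[i].

(** For a fourth root of unity a, the rows of [1 + a^3 G + a^2 G^2 + a G^3] are
    eigenvectors for a, and these four matrices add up to 4. *)
Lemma eigen4_sum (G : 'M[C]_d) : G *m G *m (G *m G) = 1%:M ->
  (d <= \rank (eigenspace G 1) + \rank (eigenspace G (- 1)) +
        \rank (eigenspace G 'i%C) + \rank (eigenspace G (- 'i%C)))%N.
Proof.
move=> G4; pose P (a : C) : 'M[C]_d :=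
  1%:M + (a ^+ 3 *: G + (a ^+ 2 *: (G *m G) + a *: (G *m G *m G))).
have PE a : a ^+ 4 = 1 -> (P a <= eigenspace G a)%MS.
  move=> a4; apply/eigenspaceP; rewrite /P.
  rewrite 3!mulmxDl mul1mx -!scalemxAl -[G *m G *m G *m G]mulmxA G4.
  rewrite 3!scalerDr !scalerA -exprS a4 -exprS -expr2 scale1r.
  by rewrite [RHS]addrC -!addrA.
have i2 : 'i%C ^+ 2 = - 1 :> C by rewrite sqr_i.
have i4 : 'i%C ^+ 4 = 1 :> C by rewrite -[4%N]/(2 * 2)%N exprM i2 sqrrN expr1n.
have S : (4%:R *: (1%:M : 'M[C]_d) <=
    eigenspace G 1%R + eigenspace G (- 1) + eigenspace G 'i%C + eigenspace G (- 'i%C))%MS.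
  have -> : 4%:R *: (1%:M : 'M[C]_d) = P 1 + P (- 1) + P 'i%C + P (- 'i%C).
    have i3 : 'i%C ^+ 3 = - 'i%C :> C by rewrite exprS i2 mulrN1.
    have j3 : (- 'i%C : C) ^+ 3 = 'i%C by rewrite exprS sqrrN i2 mulrN1 opprK.
    have n3 : (- 1 : C) ^+ 3 = - 1 by rewrite exprS sqrrN expr1n mulr1.
    rewrite /P j3 i3 n3 !sqrrN i2 !expr1n; move: (1%:M) (G *m G) => U W.
    have e4 : (4%:R : C) = 1 + 1 + 1 + 1 by rewrite -[4%N]/(1 + 1 + 1 + 1)%N !natrD.
    rewrite e4 !scalerDl !scaleNr !scale1r. 
    move: ('i%C *: G) ('i%C *: (W *m G)) (W *m G) => X Y V.
    apply/matrixP => l m; rewrite !mxE.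
    by move: (U l m) (V l m) (W l m) (G l m) (X l m) (Y l m) => u v w g x y; ring.
  do 3!(apply: addmx_sub_adds; last by apply: PE; rewrite -?[4%N]/(2 * 2)%N ?exprM ?sqrrN ?i2 ?sqrrN ?expr1n).
  by apply: PE; rewrite expr1n.
have := mxrankS S; rewrite eqmx_scale ?pnatr_eq0// mxrank1 => /leq_trans; apply.
apply: leq_trans (mxrank_adds_leqif _ _).1 _; rewrite leq_add2r.
apply: leq_trans (mxrank_adds_leqif _ _).1 _; rewrite leq_add2r.
exact: (mxrank_adds_leqif _ _).1.
Qed.

End FourthRoots.

Section Ranks.
Variable R : realType.
Local Notation C := R[i].
Variable h : nat.
Hypothesis h_gt0 : (0 < h)%N.
Local Notation D := (2 * h)%N.
Variable rho : R.
Hypothesis rho_gt0 : 0 < rho.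
Hypothesis rhoD : rho ^+ 2 * D%:R = 1.
Local Notation F := (fourier h rho).

Let D_gt0 : (0 < D)%N. Proof. by rewrite muln_gt0. Qed.

Definition mult (mu : C) : nat := \rank (eigenspace F mu).

(** Forgetting all coordinates outside the window (q, h - e] is injective on the
    eigenspace. *)
Lemma mult_le (e q : nat) (s : R) : (e <= 1)%N -> s ^+ 2 = 1 -> (q < h)%N ->
  ((2 * q < h)%N || (2 * q == h)%N && (s < 0)) ->
  (mult ('i%C ^+ e * s%:C)%R <= h - e - q)%N.
Proof.
move=> e1 s1 qh qs; pose E := eigenspace F ('i%C ^+ e * s%:C).
pose S : 'M[C]_(D, h - e - q) := \matrix_(i, k) (val i == q.+1 + k)%:R.
suff K0 : (E :&: kermx S)%MS = 0.
  by rewrite /mult -/E -(mxrank_mul_ker E S) K0 mxrank0 addn0 rank_leq_col.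
apply/eqP/rowV0P => v; rewrite sub_capmx => /andP[/eigenspaceP Ev /sub_kermxP vS].
apply: (eigen_eq0 h_gt0 rho_gt0 rhoD e1 s1 qh qs Ev) => j /andP[qj jh].
have kP : (j - q.+1 < h - e - q)%N by lia.
have := congr1 (fun w : 'rV[C]_(h - e - q) => w 0 (Ordinal kP)) vS.
have Sj i : S i (Ordinal kP) = (i == j)%:R.
  rewrite mxE; congr (nat_of_bool _)%:R; apply/eqP/eqP => [E'|-> /=]; last by lia.
  by apply: ord_inj; move: E' => /=; lia.
rewrite !mxE (bigD1 j)//= Sj eqxx mulr1 big1 ?addr0// => i ij.
by rewrite Sj (negbTE ij) mulr0.
Qed.

Lemma mult_sum : (D <= mult 1%R + mult (- 1)%R + mult 'i%C + mult (- 'i%C)%R)%N.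
Proof.
apply: eigen4_sum.
by rewrite !(fourier_sqr h_gt0 rhoD) refl_sqr.
Qed.

(** The upper bounds add up to D, so all of them are attained. *)
Lemma mult_even p : h = (2 * p)%N ->
  [/\ mult 1 = p.+1, mult (- 1) = p, mult 'i%C = p & mult (- 'i%C) = p.-1].
Proof.
move=> hp; have := mult_sum.
have := @mult_le 0 p.-1 1 isT (expr1n _ _); have := @mult_le 0 p (- 1) isT.
have := @mult_le 1 p.-1 1 isT (expr1n _ _); have := @mult_le 1 p (- 1) isT.
rewrite sqrrN expr1n !expr0 !expr1 !mul1r rmorph1 rmorphN1 mulr1 mulrN1 ltrN10 ltr10.
move=> /(_ erefl) h1 h2 /(_ erefl) h3 h4 h5.
move: h1 h2 h3 h4 h5; move: (mult 1%R) (mult (- 1)%R) (mult 'i%C) (mult (- 'i%C)%R) => a b a' b'.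
rewrite hp eqxx orbT !andbF !orbF => h1 h2 h3 h4 sum.
have p0 : (0 < p)%N by lia.
have {}h1 : (b' <= p.-1)%N by have := h1 _ isT; lia.
have {}h2 : (a' <= p)%N by have := h2 _ _; lia.
have {}h3 : (b <= p)%N by have := h3 _ isT; lia.
have {}h4 : (a <= p.+1)%N by have := h4 _ _; lia.
by clear h_gt0 rhoD; split; lia.
Qed.

Lemma mult_odd p : h = (2 * p).+1 ->
  [/\ mult 1 = p.+1, mult (- 1) = p.+1, mult 'i%C = p & mult (- 'i%C) = p].
Proof.
move=> hp; have := mult_sum.
have := @mult_le 0 p 1 isT (expr1n _ _); have := @mult_le 0 p (- 1) isT.
have := @mult_le 1 p 1 isT (expr1n _ _); have := @mult_le 1 p (- 1) isT.
rewrite sqrrN expr1n !expr0 !expr1 !mul1r rmorph1 rmorphN1 mulr1 mulrN1.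
move=> /(_ erefl) h1 h2 /(_ erefl) h3 h4 h5.
move: h1 h2 h3 h4 h5; move: (mult 1%R) (mult (- 1)%R) (mult 'i%C) (mult (- 'i%C)%R) => a b a' b'.
have p2 : (2 * p < h)%N by rewrite hp.
rewrite p2 !orTb => h1 h2 h3 h4 sum.
have {}h1 : (b' <= p)%N by have := h1 _ isT; lia.
have {}h2 : (a' <= p)%N by have := h2 _ isT; lia.
have {}h3 : (b <= p.+1)%N by have := h3 _ isT; lia.
have {}h4 : (a <= p.+1)%N by have := h4 _ isT; lia.
by clear h_gt0 rhoD p2; split; lia.
Qed.

End Ranks.

Section GroundDim.
Variable R : realType.
Local Notation C := R[i].
Local Notation H := (heis R).
Variable h n : nat.
Hypothesis h_gt0 : (0 < h)%N.
Local Notation D := (2 * h)%N.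
Variable c : R.
Hypothesis cD : pi * D%:R / 2 * c = 2 * pi * n%:R.
Local Notation section := (section (R := R) D).
Local Notation T := (pi * D%:R / 2 : R).

Let D_gt0 : (0 < D)%N. Proof. by rewrite muln_gt0. Qed.

Lemma ground_landau chi f :
  landau c T 0 chi f <-> ground D f /\ turn_eigen c chi f.
Proof.
have T0 : 0 < T by rewrite divr_gt0// mulr_gt0 ?pi_gt0// ltr0n.
split=> [hf|[[sf fT fZ fl] fc]]; last exact: Zbar0_landau.
split; last exact: level_turn hf.
split; [exact: level_smooth hf|exact: level_t hf|exact: landau0_Zbar T0 hf|exact: level_lattice hf].
Qed.

Lemma has_dim_ground chi : exists rho : R, [/\ 0 < rho, rho ^+ 2 * D%:R = 1 &
  forall mu, 'i%C ^+ n * mu = chi ->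
  has_dim (landau c T 0 chi : set (H -> (C)^o)) (mult h rho mu)].
Proof.
have [rho [r0 rD hr]] := turn_section D_gt0 cD; exists rho; split=> // mu mu_chi.
pose F := fourier h rho.
have i0 : 'i%C ^+ n != 0 :> C by rewrite expf_neq0 ?imaginary_neq0.
have turnF (b : 'rV[C]_D) p : \sum_l b 0 l * section (Posz l) (turn (c / 4) p) =
    \sum_m ('i%C ^+ n * (b *m F) 0 m) * section (Posz m) p.
  under eq_bigr do rewrite hr mulr_sumr.
  rewrite exchange_big; apply: eq_bigr => m _; rewrite mxE mulr_sumr mulr_suml.
  by apply: eq_bigr => l _; rewrite !mxE; ring.
have eigenP (b : 'rV[C]_D) : (b <= eigenspace F mu)%MS <->
    landau c T 0 chi (fun p => \sum_l b 0 l * section (Posz l) p).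
  have gb : ground D (fun p => \sum_l b 0 l * section (Posz l) p).
    by apply: ground_comb => l; exact: ground_section.
  split=> [/eigenspaceP E|/ground_landau[_ fc]].
    apply/ground_landau; split=> // p; rewrite turnF E mulr_sumr; apply: eq_bigr => l _.
    by rewrite mxE (mulrA _ mu) mu_chi mulrA.
  apply/eigenspaceP/rowP => l; apply: (mulfI i0); rewrite [(mu *: b) 0 l]mxE (mulrA _ mu) mu_chi.
  apply/eqP; rewrite -subr_eq0; apply/eqP.
  apply: (sections_free D_gt0 (a := fun l => 'i%C ^+ n * (b *m F) 0 l - chi * b 0 l)) => p.
  under eq_bigr do rewrite mulrBl.
  rewrite sumrB -turnF fc mulr_sumr.
  by apply/eqP; rewrite subr_eq0; apply/eqP; apply: eq_bigr => j _; rewrite mulrA.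
pose B := row_base (eigenspace F mu).
exists (fun k p => \sum_l B k l * section (Posz l) p); split.
- move=> k; have := (eigenP (row k B)).1.
  rewrite (_ : (fun p => \sum_l (row k B) 0 l * _) = fun p => \sum_l B k l * section (Posz l) p).
    by apply; rewrite (submx_trans (row_sub _ _))// eq_row_base.
  by apply/funext => p; apply: eq_bigr => l _; rewrite mxE.
- move=> a; rewrite sum_funE => a0.
  have : (\row_k a k) *m B = 0.
    apply/rowP => l; rewrite [RHS]mxE.
    apply: (sections_free D_gt0 (a := fun l => ((\row_k a k) *m B) 0 l)) => p.
    have := congr1 (fun f : H -> C => f p) a0 => /= E; rewrite -[RHS]E.
    under [RHS]eq_bigr do rewrite mulr_sumr.
    rewrite exchange_big; apply: eq_bigr => j _; rewrite mxE mulr_suml.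
    by apply: eq_bigr => k _; rewrite mxE -[LHS]mulrA.
  move=> /eqP; rewrite mulmx_free_eq0 ?row_base_free// => /eqP a0' k.
  by have := congr1 (fun w : 'rV[C]_(mult h rho mu) => w 0 k) a0'; rewrite !mxE.
- move=> f hf; have [gf _] := (ground_landau chi f).1 hf.
  have [b fb] := sections_span D_gt0 gf.
  have : (\row_l b l <= eigenspace F mu)%MS.
    apply/eigenP; rewrite (_ : (fun p => _) = f)//.
    by rewrite fb; apply/funext => p; apply: eq_bigr => l _; rewrite mxE.
  rewrite -(eq_row_base (eigenspace F mu)) => /submxP[a ab].
  exists (fun k => a 0 k); rewrite sum_funE fb; apply/funext => p.
  under [RHS]eq_bigr do rewrite mulr_sumr.
  rewrite exchange_big; apply: eq_bigr => l _.
  have := congr1 (fun w : 'rV[C]_D => w 0 l) ab; rewrite !mxE => ->.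
  by rewrite mulr_suml; apply: eq_bigr => k _; rewrite -[LHS]mulrA.
Qed.

End GroundDim.

Local Opaque e_x e_y e_t cderive Xop Yop Zop Zbarop sumsq primitive mean zsum harm_series theta cmean section.

(** * The multiplicities for nonzero n *)

Section Count.
Variable R : realType.
Local Notation C := R[i].

Lemma cexp_quarter (n : nat) : cexp ('i%C * (pi * n%:R / 2)%:C) = 'i%C ^+ n :> C.
Proof.
have -> : 'i%C * (pi * n%:R / 2)%:C = ('i%C * (pi / 2)%:C) *+ n :> C.
  by rewrite -mulrnAr -rmorphMn; congr (_ * _%:C); rewrite -[RHS]mulr_natr; move: (pi : R) => a; ring.
rewrite cexpMn; congr (_ ^+ _).
by rewrite /cexp /= !mul0r !mul1r subr0 add0r expR0 !mul1r cos_pihalf sin_pihalf.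
Qed.

(** The angle pi (n - k) / 2 only matters through the eigenvalue i^(k - n). *)
Lemma cos_sin_quarter (n k : nat) (x : R) : x = pi * (n%:R - k%:R) / 2 ->
  (cos x +i* sin x) * 'i%C ^+ ((k + 3 * n) %% 4) = 1 :> C.
Proof.
move=> xE; have i4 : 'i%C ^+ 4 = 1 :> C by rewrite -[4%N]/(2 * 2)%N exprM sqr_i sqrrN expr1n.
rewrite expr_mod//.
have -> : cos x +i* sin x = cexp ('i%C * x%:C) :> C.
  by rewrite /cexp /= !mul0r !mul1r subr0 add0r expR0 !mul1r.
rewrite exprD mulrA -(cexp_quarter k) -cexpD -mulrDr -rmorphD.
have -> : x + pi * k%:R / 2 = pi * n%:R / 2 by rewrite xE; move: (pi : R) => a; field.
by rewrite cexp_quarter -exprD -mulSn exprM i4 expr1n.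
Qed.

Lemma mult_formula (h n k : nat) (rho : R) : (0 < h)%N -> 0 < rho ->
  rho ^+ 2 * (2 * h)%:R = 1 ->
  (((2 * h) %% 4 = 0)%N ->
    (mult h rho ('i%C ^+ ((k + 3 * n) %% 4)))%:R = 1 / 4 * ((2 * h)%:R + 2 * (-1) ^+ (n + k) +
      2 * cos (pi * (n%:R - k%:R) / 2) - 2 * sin (pi * (n%:R - k%:R) / 2)) :> R) /\
  (((2 * h) %% 4 = 2)%N ->
    (mult h rho ('i%C ^+ ((k + 3 * n) %% 4)))%:R = 1 / 4 * ((2 * h)%:R + 2 * (-1) ^+ (n + k)) :> R).
Proof.
move=> h0 r0 rD; have := cos_sin_quarter (erefl (pi * (n%:R - k%:R) / 2)).
move: (cos _) (sin _) => x y.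
have -> : (- 1) ^+ (n + k) = (- 1) ^+ ((k + 3 * n) %% 4) :> R.
  rewrite -signr_odd -[in RHS]signr_odd; congr (_ ^+ (nat_of_bool _)); lia.
have : ((k + 3 * n) %% 4 < 4)%N by rewrite ltn_mod.
have i2 : 'i%C ^+ 2 = - 1 :> C by rewrite sqr_i.
have i3 : 'i%C ^+ 3 = - 'i%C :> C by rewrite exprS i2 mulrN1.
have n3 : (- 1 : R) ^+ 3 = - 1 by rewrite exprS sqrrN expr1n mulr1.
move: ((k + 3 * n) %% 4)%N => j j4 /eqP E.
split=> hm.
  have [p hp] : exists p, h = (2 * p.+1)%N by exists (h %/ 2).-1; lia.
  have [m1 m2 m3 m4] := mult_even h0 r0 rD hp; rewrite !natrM.
  have p1 := @natr1 R p; have p2 := @natr1 R p.+1.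
  have hpR : h%:R = 2 * p.+1%:R :> R by rewrite hp natrM.
  case: j j4 E => [|[|[|[|//]]]] _;
    rewrite ?expr0 ?expr1 ?i2 ?i3 ?n3 ?sqrrN ?expr1n ?m1 ?m2 ?m3 ?m4 eq_complex /= => /andP[/eqP ex /eqP ey]; lra.
have [p hp] : exists p, h = (2 * p).+1 by exists (h %/ 2)%N; lia.
have [m1 m2 m3 m4] := mult_odd h0 r0 rD hp; rewrite !natrM.
have p1 := @natr1 R p; have hpR : h%:R = 2 * p%:R + 1 :> R by rewrite hp -natr1 natrM.
case: j j4 E => [|[|[|[|//]]]] _ _;
  rewrite ?expr0 ?expr1 ?i2 ?i3 ?n3 ?sqrrN ?expr1n ?m1 ?m2 ?m3 ?m4; lra.
Qed.

End Count.

Section PartA.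
Variable R : realType.
Local Notation C := R[i].
Local Notation H := (heis R).

(** The equations of a level have real coefficients, except for the factor i T. *)
Lemma level_conj (c T S : R) (f : H -> C) :
  level c T S 1 f -> level c (- T) S 1 (fun p => (f p)^*).
Proof.
move=> [sf fT fS [f1 f2] fc]; split.
- exact: smooth_conj.
- move=> p; rewrite cderive_conj// fT; move: (f p) => [a b]; cring.
- by move=> p; rewrite sumsq_conj// fS; move: (f p) => [a b]; cring.
- by split=> p; rewrite ?f1 ?f2.
- by move=> p; rewrite fc !mul1r.
Qed.

Lemma has_dim_level_conj (c T S : R) m :
  has_dim (level c T S 1 : set (H -> C^o)) m ->
  has_dim (level c (- T) S 1 : set (H -> C^o)) m.
Proof.
have cK : involutive (@conjc R) by move=> [a b]; rewrite /= opprK.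
apply: (has_dim_transfer (s := @conjc R) (s' := @conjc R)
  (Phi := fun (f : H -> C^o) p => (f p)^*)) => //.
- by rewrite /= oppr0.
- move=> a e he; rewrite !sum_funE; split; first exact: level_comb.
  by apply/funext => p; rewrite rmorph_sum; apply: eq_bigr => j _; rewrite rmorphM.
- exact: level_conj.
- move=> f _ f0; apply/funext => p; have := congr1 (fun g : H -> C => g p) f0 => /= /eqP.
  by rewrite fmorph_eq0 => /eqP.
- move=> g hg; exists (fun p => (g p)^*); last by apply/funext => p; rewrite cK.
  by have := level_conj hg; rewrite opprK.
Qed.

Lemma multiplicity_pos (N n k : nat) (c r : R) : (0 < N)%N -> ~~ odd N -> (0 < n)%N ->
  c = 4 / N%:R -> 0 < r ->
  exists m : nat,
    [/\ has_dim (level c (2 * pi * n%:R / c) (- (2 * r * ((4 * k%:R + 2) * pi * n%:R / (c * r)))) 1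
           : set (H -> C^o)) m,
        ((n * N) %% 4 = 0)%N -> m%:R = 1 / 4 * ((n * N)%N%:R + 2 * (-1) ^+ (n + k)
           + 2 * cos (pi * (n%:R - k%:R) / 2) - 2 * sin (pi * (n%:R - k%:R) / 2)) :> R &
        ((n * N) %% 4 = 2)%N -> m%:R = 1 / 4 * ((n * N)%N%:R + 2 * (-1) ^+ (n + k)) :> R].
Proof.
move=> N0 No n0 cE r0; have [h hE] : exists h, (n * N = 2 * h)%N.
  by exists (n * N./2)%N; rewrite -{1}[N]odd_double_half (negbTE No) add0n -mul2n mulnCA.
have h0 : (0 < h)%N by nia.
have NR : N%:R != 0 :> R by rewrite pnatr_eq0 -lt0n.
have c0 : 0 < c by rewrite cE divr_gt0// ltr0n.
have TE : 2 * pi * n%:R / c = pi * (2 * h)%:R / 2 :> R.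
  by rewrite -hE natrM cE; move: (pi : R) => a; field.
have cD : pi * (2 * h)%:R / 2 * c = 2 * pi * n%:R.
  by rewrite -TE divfK ?gt_eqF.
have [rho [rho0 rhoD hd]] := has_dim_ground h0 cD ('i%C ^+ k).
have [F1 F2] := mult_formula n k h0 rho0 rhoD; rewrite hE.
exists (mult h rho ('i%C ^+ ((k + 3 * n) %% 4))); split=> //.
have -> : - (2 * r * ((4 * k%:R + 2) * pi * n%:R / (c * r))) =
    - (2 * (2 * k%:R + 1) * (2 * pi * n%:R / c)).
  by move: (pi : R) => a; field; rewrite !gt_eqF.
rewrite TE; apply: has_dim_landau.
  by rewrite divr_gt0// mulr_gt0 ?pi_gt0// ltr0n; lia.
rewrite mulr1; apply: hd.
have i4 : 'i%C ^+ 4 = 1 :> C by rewrite -[4%N]/(2 * 2)%N exprM sqr_i sqrrN expr1n.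
by rewrite expr_mod// -exprD addnCA -mulSn exprD [X in _ * X]exprM i4 expr1n mulr1.
Qed.

Lemma multiplicity_nonzero (N k : nat) (n : int) (c r : R) : (0 < N)%N -> ~~ odd N -> n != 0 ->
  c = 4 / N%:R -> 0 < r ->
  exists m : nat,
       [/\ multiplicity (Gamma c) r
             ((4 * k%:R + 2) * pi * `|n|%:~R / (c * r))
             (2 * pi * n%:~R / (c * r)) m,
           (`|n| * N = 0 %[mod 4])%N ->
             m%:R = 1 / 4 * ((`|n| * N)%N%:R + 2 * (-1) ^ (n + k%:Z)
                    + 2 * cos (pi * (`|n|%:~R - k%:R) / 2)
                    - 2 * sin (pi * (`|n|%:~R - k%:R) / 2)) :> R &
           (`|n| * N = 2 %[mod 4])%N ->
             m%:R = 1 / 4 * ((`|n| * N)%N%:R + 2 * (-1) ^ (n + k%:Z)) :> R].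
Proof.
move=> N0 No n0 cE r0; have an0 : (0 < `|n|)%N by rewrite absz_gt0.
have c0 : 0 < c by rewrite cE divr_gt0// ltr0n.
have [m [hm m1 m2]] := multiplicity_pos k N0 No an0 cE r0.
have sE : (- 1) ^ (n + k%:Z) = (- 1) ^+ (`|n| + k) :> R.
  rewrite expfzDr ?oppr_eq0 ?oner_eq0// exprD; congr (_ * _).
  case: n {n0 an0 hm m1 m2} => j //; rewrite NegzE -exprnN -exprVn invrN1.
  by [].
have aE : `|n|%:~R = `|n|%N%:R :> R by rewrite -abszE -pmulrn.
exists m; rewrite sE aE; split=> //.
rewrite /multiplicity joint_eigenspaceE ?gt_eqF//.
have -> : r * (2 * pi * n%:~R / (c * r)) = 2 * pi * n%:~R / c.
  by move: (pi : R) => a; field; rewrite !gt_eqF.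
case: n n0 an0 hm {m1 m2 sE aE} => j _ _ hm; first by rewrite -pmulrn.
rewrite NegzE mulrNz -pmulrn; have := has_dim_level_conj hm.
by rewrite abszN absz_nat mulrN mulNr.
Qed.

End PartA.

Local Opaque e_x e_y e_t cderive Xop Yop Zop Zbarop sumsq primitive mean zsum harm_series theta cmean section.

(** * Plane waves and the flat Laplacian *)

Section DoubleMean.
Variable R : realType.
Local Notation C := R[i].
Local Notation H := (heis R).
Implicit Types (f g F : H -> C) (p v w : H) (x y t : R) (a b : int).
Local Notation e_x := (e_x R).
Local Notation e_y := (e_y R).
Local Notation e_t := (e_t R).

Definition periodic2 f := (forall p, f (1 *: e_x + p) = f p) /\ (forall p, f (1 *: e_y + p) = f p).

Lemma affine_shift v : affine_map (fun p => v + p) id.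
Proof.
have [X [Y T]] := (rsmooth_x R, (rsmooth_y R, rsmooth_t R)).
apply: affine_mapI => [h w p|||]; first by rewrite addrCA.
- by apply: rsmooth_add => //; exact: rsmooth_cst.
- by apply: rsmooth_add => //; exact: rsmooth_cst.
- by apply: rsmooth_add => //; exact: rsmooth_cst.
Qed.

Lemma periodic2_cderive v f : periodic2 f -> periodic2 (cderive v f).
Proof.
move=> [f1 f2]; split=> p.
  rewrite -(cderive_along f p (affine_shift (1 *: e_x)) (erefl v)).
  by congr (cderive v _ p); apply/funext => q; exact: f1.
rewrite -(cderive_along f p (affine_shift (1 *: e_y)) (erefl v)).
by congr (cderive v _ p); apply/funext => q; exact: f2.
Qed.

Lemma periodic2_mul f g : periodic2 f -> periodic2 g -> periodic2 (fun p => f p * g p).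
Proof. by move=> [f1 f2] [g1 g2]; split=> p; rewrite ?f1 ?g1 ?f2 ?g2. Qed.

Definition ymean F x : C := cmean (fun y => F (x, y, 0)).
Definition dmean F : C := cmean (ymean F).

Lemma ccontinuous_ymean F : smooth F -> ccontinuous (ymean F).
Proof.
move=> sF; have D x := is_derive_cmean x sF; split.
  by apply: is_derive_continuous => x; have [+ _] := D x; exact.
by apply: is_derive_continuous => x; have [_ +] := D x; exact.
Qed.

Lemma dmean_comb (u u' : C) F g : smooth F -> smooth g ->
  dmean (fun p => u * F p + u' * g p) = u * dmean F + u' * dmean g.
Proof.
move=> sF sg; rewrite -cmean_comb; try exact: ccontinuous_ymean.
by congr cmean; apply/funext => x; apply: cmean_comb; exact: ccontinuous_slice_y.
Qed.

Lemma dmeanZ (u : C) F : smooth F -> dmean (fun p => u * F p) = u * dmean F.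
Proof.
move=> sF; have := dmean_comb u 0 sF sF; under [X in dmean X]eq_fun do rewrite mul0r addr0.
by rewrite mul0r addr0.
Qed.

Lemma cmean0 : cmean (fun=> 0 : C) = 0.
Proof.
have c0 : ccontinuous (fun=> 0 : C) by split; exact: continuous_cstf.
by have := cmeanZ 0 c0; under [X in cmean X]eq_fun do rewrite mul0r; rewrite mul0r.
Qed.

Lemma dmean_dy F : smooth F -> periodic2 F -> dmean (cderive e_y F) = 0.
Proof.
move=> sF [_ F2]; rewrite -[RHS]cmean0; congr cmean; apply/funext => x.
by apply: cmean_dy => // y; rewrite -line_y F2.
Qed.

Lemma dmean_dx F : smooth F -> periodic2 F -> dmean (cderive e_x F) = 0.
Proof.
move=> sF [F1 _]; have D x := is_derive_cmean x sF.
have [c1 c2] := ccontinuous_ymean (smooth_cderive e_x sF).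
have per : ymean F 1 = ymean F 0.
  by congr cmean; apply/funext => y; rewrite -[1]addr0 -line_x F1.
Transparent cmean.
rewrite /dmean {1}/cmean.
Opaque cmean.
apply: complex_congr.
  rewrite (mean_deriv c1 (fun x => (D x).1)).
  by have /(congr1 (@complex.Re R)) := per; rewrite /ymean => ->; rewrite subrr.
rewrite (mean_deriv c2 (fun x => (D x).2)).
by have /(congr1 (@complex.Im R)) := per; rewrite /ymean => ->; rewrite subrr.
Qed.

Definition pwave a b p : C := cexp ('i%C * (2 * pi * (a%:~R * p.1.1 + b%:~R * p.1.2))%:C).

Lemma pwaveE a b x y t : pwave a b (x, y, t) = wavec a x * wavec b y.
Proof. by rewrite /pwave /wavec -cexpD; congr cexp; cring. Qed.

Lemma pwaveD a b a' b' p : pwave a b p * pwave a' b' p = pwave (a + a') (b + b') p.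
Proof. by case: p => [[x y] t]; rewrite !pwaveE !wavec_add; ring. Qed.

Let phase a b p : R := 2 * pi * (a%:~R * p.1.1 + b%:~R * p.1.2).

Let rsmooth_phase a b : rsmooth (phase a b).
Proof.
have [X Y] := (rsmooth_x R, rsmooth_y R).
apply: rsmooth_mul; first exact: rsmooth_cst.
by apply: rsmooth_add; apply: rsmooth_mul => //; exact: rsmooth_cst.
Qed.

Let derive_phase a b v p : 'D_v (phase a b) p = 2 * pi * (a%:~R * v.1.1 + b%:~R * v.1.2).
Proof.
have [X Y] := (rsmooth_x R, rsmooth_y R).
have D : phase a b = fun p => phase a b p by [].
have c1 := rsmooth_cst (2 * pi * a%:~R : R); have c2 := rsmooth_cst (2 * pi * b%:~R : R).
have -> : phase a b = fun p => cst (2 * pi * a%:~R) p * xcoord p + cst (2 * pi * b%:~R) p * ycoord p.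
  by apply/funext => q; rewrite /phase /cst /xcoord /ycoord; ring.
rewrite (derive_add _ _ (rsmooth_mul c1 X) (rsmooth_mul c2 Y)).
rewrite (derive_mul _ _ c1 X) (derive_mul _ _ c2 Y) derive_x derive_y !derive_cst.
by rewrite /cst; ring.
Qed.

Lemma smooth_pwave a b : smooth (pwave a b).
Proof.
apply: smooth_cexp; apply: smoothZ; apply: smooth_real; exact: rsmooth_phase.
Qed.

Lemma cderive_pwave a b v p : cderive v (pwave a b) p =
  'i%C * (2 * pi * (a%:~R * v.1.1 + b%:~R * v.1.2))%:C * pwave a b p.
Proof.
have sp : smooth (fun p => (phase a b p)%:C) by apply: smooth_real; exact: rsmooth_phase.
rewrite (cderive_cexp _ _ (smoothZ 'i%C sp)) (cderiveZ _ _ _ sp); congr (_ * _ * _).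
Transparent cderive.
rewrite /cderive /= -[RHS]/(_ +i* 0); apply: complex_congr; last exact: (derive_cst (0 : R)).
Opaque cderive.
exact: derive_phase.
Qed.

Lemma pwave_x a b p : cderive e_x (pwave a b) p = 'i%C * (2 * pi * a%:~R)%:C * pwave a b p.
Proof. by rewrite cderive_pwave e_xP /= mulr1 mulr0 addr0. Qed.

Lemma pwave_y a b p : cderive e_y (pwave a b) p = 'i%C * (2 * pi * b%:~R)%:C * pwave a b p.
Proof. by rewrite cderive_pwave e_yP /= mulr1 mulr0 add0r. Qed.

Lemma pwave_t a b p : cderive e_t (pwave a b) p = 0.
Proof. by rewrite cderive_pwave e_tP /= !mulr0 addr0 mulr0 mulr0 mul0r. Qed.

Lemma periodic2_pwave a b : periodic2 (pwave a b).
Proof. by split=> -[[x y] t]; rewrite ?line_x ?line_y !pwaveE wavec1. Qed.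

(** Integration by parts: the derivative of the product has mean zero. *)
Lemma dmean_pwave_x f a b : smooth f -> periodic2 f ->
  dmean (fun p => cderive e_x f p * pwave a b p) =
  - ('i%C * (2 * pi * a%:~R)%:C) * dmean (fun p => f p * pwave a b p).
Proof.
move=> sf pf; have sw := smooth_pwave a b; have sfw := smooth_mul sf sw.
have sdw := smooth_mul (smooth_cderive e_x sf) sw.
have := dmean_dx sfw (periodic2_mul pf (periodic2_pwave a b)).
have -> : cderive e_x (fun p => f p * pwave a b p) = fun p =>
    1 * (cderive e_x f p * pwave a b p) + 'i%C * (2 * pi * a%:~R)%:C * (f p * pwave a b p).
  by apply/funext => p; rewrite (cderive_mul _ _ sf sw) pwave_x mul1r mulrCA.
rewrite (dmean_comb _ _ sdw sfw) mul1r => /eqP; rewrite addr_eq0 => /eqP ->.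
by rewrite mulNr.
Qed.

Lemma dmean_pwave_y f a b : smooth f -> periodic2 f ->
  dmean (fun p => cderive e_y f p * pwave a b p) =
  - ('i%C * (2 * pi * b%:~R)%:C) * dmean (fun p => f p * pwave a b p).
Proof.
move=> sf pf; have sw := smooth_pwave a b; have sfw := smooth_mul sf sw.
have sdw := smooth_mul (smooth_cderive e_y sf) sw.
have := dmean_dy sfw (periodic2_mul pf (periodic2_pwave a b)).
have -> : cderive e_y (fun p => f p * pwave a b p) = fun p =>
    1 * (cderive e_y f p * pwave a b p) + 'i%C * (2 * pi * b%:~R)%:C * (f p * pwave a b p).
  by apply/funext => p; rewrite (cderive_mul _ _ sf sw) pwave_y mul1r mulrCA.
rewrite (dmean_comb _ _ sdw sfw) mul1r => /eqP; rewrite addr_eq0 => /eqP ->.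
by rewrite mulNr.
Qed.

Lemma cmean1 : cmean (fun=> 1 : C) = 1.
Proof.
Transparent cmean.
by rewrite /cmean !mean_cst.
Opaque cmean.
Qed.

Lemma dmean_pwave a b : dmean (pwave a b) = ((a == 0) && (b == 0))%:R.
Proof.
have s1 : smooth (fun _ : H => 1 : C) by exact: smooth_cst.
have p1 : periodic2 (fun _ : H => 1 : C) by [].
have one : (fun p => 1 * pwave a b p) = pwave a b by apply/funext => p; rewrite mul1r.
have zero : dmean (fun=> 0) = 0.
  by have := dmeanZ 0 s1; rewrite !mul0r.
have step v (m : int) : m != 0 -> dmean (fun p => cderive v (fun=> 1) p * pwave a b p) =
    - ('i%C * (2 * pi * m%:~R)%:C) * dmean (pwave a b) -> dmean (pwave a b) = 0.
  move=> m0; have -> : (fun p => cderive v (fun _ : H => 1 : C) p * pwave a b p) = fun=> 0.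
    by apply/funext => p; rewrite cderive_cst mul0r.
  rewrite zero => /esym/eqP; rewrite mulf_eq0 oppr_eq0 mulf_eq0 (negbTE (imaginary_neq0 R)) /=.
  by rewrite fmorph_eq0 !mulf_eq0 pnatr_eq0 (gt_eqF (pi_gt0 R)) intr_eq0 (negbTE m0) => /eqP.
have [a0|a0] := eqVneq a 0; last first.
  by apply: (step e_x a a0); rewrite (dmean_pwave_x a b s1 p1) one.
have [b0|b0] := eqVneq b 0; last first.
  by apply: (step e_y b b0); rewrite (dmean_pwave_y a b s1 p1) one.
rewrite /= -[RHS]cmean1; congr cmean; apply/funext => x; rewrite -[RHS]cmean1.
congr cmean; apply/funext => y; rewrite /pwave -[RHS]cexp0; congr cexp.
by rewrite a0 b0; cring.
Qed.

(** Uniqueness of Fourier coefficients in each variable in turn. *)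
Lemma dmean_eq0 f : smooth f -> periodic2 f ->
  (forall a b, dmean (fun p => f p * pwave a b p) = 0) -> forall x y, f (x, y, 0) = 0.
Proof.
move=> sf [f1 f2] f0 x; apply: (cfourier_eq0 (g := fun y => f (x, y, 0))).
- exact: ccontinuous_slice_y.
- by move=> y; rewrite -line_y f2.
move=> b; move: x; have sw := smooth_mul sf (smooth_pwave 0 b).
have E x : ymean (fun p => f p * pwave 0 b p) x = cmean (fun y => f (x, y, 0) * wavec b y).
  congr cmean; apply/funext => y; rewrite pwaveE; congr (_ * _).
  by rewrite /wavec -cexpD; congr cexp; cring.
under eq_forall do rewrite -E.
apply: cfourier_eq0; first exact: ccontinuous_ymean.
  by move=> x; congr cmean; apply/funext => y; rewrite !pwaveE wavec1 -line_x f1.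
move=> a; rewrite -[RHS](f0 a b); congr cmean; apply/funext => x.
rewrite mulrC -cmeanZ; last exact: (ccontinuous_slice_y x 0 sw).
congr cmean; apply/funext => y; rewrite !pwaveE mulrCA; congr (_ * _).
by rewrite /wavec -!cexpD; congr cexp; cring.
Qed.

Local Opaque dmean pwave.

Lemma flat_sumsq f p : smooth f -> t_eigen 0 f -> sumsq f p =
  (cderive e_x (cderive e_x f) p + cderive e_y (cderive e_y f) p) / 2.
Proof.
move=> sf fT; have t0 q : cderive e_t f q = 0 by rewrite fT mulr0 mul0r.
have tz v q : cderive e_t (cderive v f) q = 0.
  rewrite (cderive_comm _ _ _ sf) (_ : cderive e_t f = fun=> 0); last exact/funext.
  exact: cderive_cst.
Transparent Xop Yop.
have XE g : (forall q, cderive e_t g q = 0) -> Xop g = cderive e_x g.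
  by move=> g0; apply/funext => q; rewrite /Xop g0 mulr0 addr0.
have YE g : (forall q, cderive e_t g q = 0) -> Yop g = cderive e_y g.
  by move=> g0; apply/funext => q; rewrite /Yop g0 mulr0 subr0.
Opaque Xop Yop.
by rewrite (sumsqE p sf) (XE f t0) (YE f t0) (XE _ (tz e_x)) (YE _ (tz e_y)).
Qed.

(** Two integrations by parts show that the coefficient at (a, b) is multiplied by
    two different numbers unless S is the eigenvalue of the plane wave. *)
Lemma flat_coef_eq0 f S a b : smooth f -> t_eigen 0 f -> periodic2 f ->
  (forall p, sumsq f p = S%:C * f p) -> S <> - (2 * pi ^+ 2 * (a%:~R ^+ 2 + b%:~R ^+ 2)) ->
  dmean (fun p => f p * pwave a b p) = 0.
Proof.
move=> sf fT pf fS ne; have sw := smooth_pwave a b; have sfw := smooth_mul sf sw.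
have [dx dy] := (smooth_cderive e_x sf, smooth_cderive e_y sf).
have [ddx ddy] := (smooth_cderive e_x dx, smooth_cderive e_y dy).
have lap p : 1 * (cderive e_x (cderive e_x f) p * pwave a b p) +
    1 * (cderive e_y (cderive e_y f) p * pwave a b p) = (2 * S)%:C * (f p * pwave a b p).
  have n2 : 2 != 0 :> C by rewrite pnatr_eq0.
  have := congr1 (fun z => z * 2) (flat_sumsq p sf fT); rewrite /= (divfK n2) fS.
  move: (cderive _ _ _) (cderive _ _ _) (f p) (pwave _ _ _) => u v z w E.
  rewrite !mul1r -mulrDl -E rmorphM rmorph_nat.
  by ring.
have K : dmean (fun p => 1 * (cderive e_x (cderive e_x f) p * pwave a b p) +
    1 * (cderive e_y (cderive e_y f) p * pwave a b p)) =
    dmean (fun p => (2 * S)%:C * (f p * pwave a b p)).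
  by apply: (congr1 dmean); apply/funext => p; exact: lap.
have K1 := dmean_comb 1 1 (smooth_mul ddx sw) (smooth_mul ddy sw).
have K' := etrans (etrans (esym K1) K) (dmeanZ (2 * S)%:C sfw).
have X := etrans (dmean_pwave_x a b dx (periodic2_cderive e_x pf))
  (congr1 (fun z => - ('i%C * (2 * pi * a%:~R)%:C) * z) (dmean_pwave_x a b sf pf)).
have Y := etrans (dmean_pwave_y a b dy (periodic2_cderive e_y pf))
  (congr1 (fun z => - ('i%C * (2 * pi * b%:~R)%:C) * z) (dmean_pwave_y a b sf pf)).
have fin (A A' d u v s : C) : 1 * A + 1 * A' = s * d -> A = u * (u * d) -> A' = v * (v * d) ->
    (u * u + v * v - s) * d = 0.
  by move=> E EA EA'; rewrite mulrBl -E EA EA'; ring.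
have := fin _ _ _ _ _ _ K' X Y; move: (dmean _) => d E.
have : (- (2 * (2 * pi ^+ 2 * (a%:~R ^+ 2 + b%:~R ^+ 2) + S)))%:C * d == 0.
  rewrite -E; apply/eqP; congr (_ * _); move: (pi : R) => q; cring.
rewrite mulf_eq0 fmorph_eq0 oppr_eq0 mulf_eq0 pnatr_eq0 /= => /orP[/eqP h|/eqP//].
by case: ne; lra.
Qed.

End DoubleMean.

Local Opaque e_x e_y e_t cderive Xop Yop Zop Zbarop sumsq primitive mean zsum harm_series theta cmean section dmean pwave.

(** * Lattice points on a circle *)

Definition rot90 (z : int * int) : int * int := (- z.2, z.1).

Lemma rot90_4 z : iter 4 rot90 z = z.
Proof. by case: z => a b; rewrite /rot90 /= !opprK. Qed.

Section LatticePoints.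
Variables (R : realType) (M : R).
Hypothesis M_gt0 : 0 < M.

Let K : nat := Num.bound M.

(** The lattice points with a > 0 and b >= 0: one for each orbit of the quarter
    turn on the circle of squared radius M. *)
Definition quadrant : Type := {x : 'I_K * 'I_K | (0 < x.1)%N && ((x.1 ^ 2 + x.2 ^ 2)%N%:R == M)}.
HB.instance Definition _ := Finite.on quadrant.

Definition base (q : quadrant) : int * int := (Posz (val q).1, Posz (val q).2).
Definition lat (i : quadrant * 'I_4) : int * int := iter i.2 rot90 (base i.1).

Definition on_circle (z : int * int) : Prop := z.1%:~R ^+ 2 + z.2%:~R ^+ 2 = M.

Lemma on_circle_rot z : on_circle z -> on_circle (rot90 z).
Proof. by rewrite /on_circle /rot90 /= mulrNz sqrrN addrC. Qed.

Lemma on_circle_base q : on_circle (base q).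
Proof.
have /andP[_ /eqP qM] := valP q; rewrite /on_circle /base /= -!pmulrn -!natrX -natrD.
exact: qM.
Qed.

Lemma on_circle_iter j z : on_circle z -> on_circle (iter j rot90 z).
Proof. by move=> hz; elim: j => // j; exact: on_circle_rot. Qed.

Lemma base_gt0 q : (0 < (base q).1) /\ (0 <= (base q).2).
Proof. by have /andP[q0 _] := valP q; rewrite /base /=; split. Qed.

Lemma base_inj : injective base.
Proof.
move=> [[a b] h] [[a' b'] h'] /= [e1 e2]; apply: val_inj => /=.
by congr (_, _); apply: ord_inj.
Qed.

Lemma lat_inj : injective lat.
Proof.
clear M_gt0; move=> [q j] [q' j']; rewrite /lat /=.
have [q1 q2] := base_gt0 q; have [q1' q2'] := base_gt0 q'.
suff S : iter j rot90 (base q) = iter j' rot90 (base q') -> base q = base q' /\ j = j' :> nat.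
  by move=> /S[/base_inj -> jj]; congr (_, _); exact: ord_inj.
move: (base q) (base q') q1 q2 q1' q2' => [a b] [a' b'] /= q1 q2 q1' q2'.
case: j j' => [[|[|[|[|//]]]] hj] [[|[|[|[|//]]]] hj'] /= -[e1 e2];
  try (by exfalso; lia); by split => //; congr (_, _); lia.
Qed.

Lemma lat_surj z : on_circle z -> exists i, lat i = z.
Proof.
have step (a b : nat) : (0 < a)%N -> on_circle (Posz a, Posz b) ->
    exists q, base q = (Posz a, Posz b).
  rewrite /on_circle /= -!pmulrn -!natrX -natrD => a0 hM.
  have MK : M < K%:R by apply: archi_boundP; exact: ltW.
  rewrite -hM ltr_nat in MK.
  have aK : (a < K)%N by nia.
  have bK : (b < K)%N by nia.
  have hq : (0 < Ordinal aK)%N && ((Ordinal aK ^ 2 + Ordinal bK ^ 2)%N%:R == M).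
    by rewrite /= a0 hM eqxx.
  by exists (exist _ (Ordinal aK, Ordinal bK) hq).
case: z => a b hz.
have nz : ~ (a = 0 /\ b = 0).
  move=> [a0 b0]; move: hz M_gt0; rewrite /on_circle a0 b0 /= expr0n addr0 => <-.
  by rewrite ltxx.
have go (j : 'I_4) (k : nat) : iter k rot90 (iter j rot90 (a, b)) = (a, b) -> (k < 4)%N ->
    0 < (iter j rot90 (a, b)).1 -> 0 <= (iter j rot90 (a, b)).2 -> exists i, lat i = (a, b).
  move=> E k4 h1 h2; have := on_circle_iter j hz.
  move: (iter j rot90 (a, b)) E h1 h2 => [[a'|//] [b'|//]] E a0 _ hc.
  have [//|q hq] := step a' b' _ hc.
  by exists (q, Ordinal k4); rewrite /lat /= hq.
have [/andP[a0 b0]|h0] := boolP ((0 < a) && (0 <= b)).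
  by apply: (go ord0 0%N).
have [/andP[a1 b1]|h1] := boolP ((a <= 0) && (0 < b)).
  apply: (go (@Ordinal 4 3 isT) 1%N) => //=; [by rewrite /rot90 /= !opprK|lia|lia].
have [/andP[a2 b2]|h2] := boolP ((a < 0) && (b <= 0)).
  apply: (go (@Ordinal 4 2 isT) 2%N) => //=; [by rewrite /rot90 /= !opprK|lia|lia].
apply: (go (@Ordinal 4 1 isT) 3%N) => //=; [by rewrite /rot90 /= !opprK| |].
  by move: nz h0 h1 h2; lia.
by move: nz h0 h1 h2; lia.
Qed.

End LatticePoints.

Local Opaque e_x e_y e_t cderive Xop Yop Zop Zbarop sumsq primitive mean zsum harm_series theta cmean section dmean pwave.

(** * The multiplicities for n = 0 *)

Lemma sum_indicator (A : pzSemiRingType) (I : finType) (T : eqType) (a : I -> A) (g : I -> T) i :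
  injective g -> \sum_j a j * (g j == g i)%:R = a i.
Proof.
move=> gI; rewrite (bigD1 i)//= eqxx mulr1 big1 ?addr0// => j ji.
by rewrite (inj_eq gI) (negbTE ji) mulr0.
Qed.

Section FlatLevel.
Variable R : realType.
Local Notation C := R[i].
Local Notation H := (heis R).
Implicit Types (f : H -> C) (p : H) (z : int * int).
Variables (c M : R).
Hypothesis M_gt0 : 0 < M.
Local Notation S := (- (2 * pi ^+ 2 * M)).

Let W z p : C := pwave z.1 z.2 p.

Lemma pwave_rot z s p : W (rot90 z) (turn s p) = W z p.
Proof.
Transparent pwave.
rewrite /W /pwave /turn /=; congr cexp.
Opaque pwave.
by rewrite mulrNz; cring.
Qed.

Definition symwave z p : C := \sum_(j < 4) W (iter j rot90 z) p.

Lemma symwaveE z p : symwave z p =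
  W z p + W (rot90 z) p + W (rot90 (rot90 z)) p + W (rot90 (rot90 (rot90 z))) p.
Proof. by rewrite /symwave !big_ord_recl big_ord0 addr0 !addrA. Qed.

Let rotr z := rot90 (rot90 (rot90 z)).

Let rotrK z : rot90 (rotr z) = z. Proof. exact: rot90_4. Qed.

Lemma W_turn z s p : W z (turn s p) = W (rotr z) p.
Proof. by rewrite -[in LHS](rotrK z) pwave_rot. Qed.

Lemma symwave_turn z s p : symwave z (turn s p) = symwave z p.
Proof.
by rewrite !symwaveE !pwave_rot W_turn -addrA -addrA addrC -!addrA.
Qed.

Lemma symwave_rot z p : symwave (rot90 z) p = symwave z p.
Proof.
have := rot90_4 z; rewrite /= => r4.
by rewrite !symwaveE r4 addrC !addrA.
Qed.

Lemma symwave_iter j z p : symwave (iter j rot90 z) p = symwave z p.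
Proof. by elim: j => //= j IHj; rewrite symwave_rot. Qed.

Lemma smooth_W z : smooth (W z). Proof. exact: smooth_pwave. Qed.

Lemma W_t z : t_eigen 0 (W z).
Proof. by move=> p; rewrite /W pwave_t mulr0 mul0r. Qed.

Lemma W_sumsq z p : on_circle M z -> sumsq (W z) p = S%:C * W z p.
Proof.
move=> hz; rewrite (flat_sumsq _ (smooth_W z) (@W_t z)).
have -> : cderive (e_x R) (W z) = fun p => 'i%C * (2 * pi * z.1%:~R)%:C * W z p.
  by apply/funext => q; exact: pwave_x.
have -> : cderive (e_y R) (W z) = fun p => 'i%C * (2 * pi * z.2%:~R)%:C * W z p.
  by apply/funext => q; exact: pwave_y.
rewrite (cderiveZ _ _ _ (smooth_W z)) (cderiveZ _ _ _ (smooth_W z)) pwave_x pwave_y -/(W z p).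
rewrite -hz; move: (pi : R) (W z p) => a [d d'].
have -> : (2 : C)^-1 = (2^-1 : R)%:C by rewrite fmorphV rmorph_nat.
by cfield.
Qed.

Lemma flat_lattice f : smooth f -> t_eigen 0 f -> lattice_invariant f <-> periodic2 f.
Proof.
move=> sf fT; have ft x y t s : f (x, y, s + t) = f (x, y, t).
  by rewrite (t_eigenP x y t s sf fT) mul0r mulr0 cexp0 mul1r.
have ft0 x y t : f (x, y, t) = f (x, y, 0) by rewrite -[t]addr0 ft.
split=> -[f1 f2]; split=> -[[x y] t].
- by have := f1 (x, y, 0); rewrite line_x heis_mulE (ft0 (1 + x)) (add0r y) (ft0 (1 + x) y t) (ft0 x y t).
- by have := f2 (x, y, 0); rewrite line_y heis_mulE (ft0 (0 + x)) (add0r x) (ft0 x (1 + y) t) (ft0 x y t).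
- by have := f1 (x, y, 0); rewrite line_x heis_mulE (ft0 (1 + x) (0 + y)) (add0r y) (ft0 x y t).
- by have := f2 (x, y, 0); rewrite line_y heis_mulE (ft0 (0 + x)) (add0r x) (ft0 x y t).
Qed.

Lemma symwave_level z : on_circle M z -> level c 0 S 1 (symwave z).
Proof.
move=> hz; have E : symwave z = fun p => \sum_(j < 4) 1 * W (iter j rot90 z) p.
  by apply/funext => p; apply: eq_bigr => j _; rewrite mul1r.
have sW (j : 'I_4) : smooth (W (iter j rot90 z)) by exact: smooth_W.
have [ss st] := comb_sum (fun=> 1) (comb_cderive (e_t R)) sW.
have [_ sq] := comb_sum (fun=> 1) (@sumsq_comb R) sW.
have sE : smooth (symwave z) by rewrite E.
have tE : t_eigen 0 (symwave z).
  move=> p; rewrite {1}E st mulr0 mul0r big1// => j _.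
  by rewrite W_t mulr0 mul0r mulr0.
split=> //.
- move=> p; rewrite {1}E sq mulr_sumr; apply: eq_bigr => j _.
  by rewrite mul1r W_sumsq//; exact: on_circle_iter.
- apply/(flat_lattice sE tE); split=> p; apply: eq_bigr => j _.
    exact: (periodic2_pwave _ _ _).1.
  exact: (periodic2_pwave _ _ _).2.
- by move=> p; rewrite mul1r symwave_turn.
Qed.

Lemma dmean_sum (I : finType) (a : I -> C) (F : I -> H -> C) : (forall i, smooth (F i)) ->
  smooth (fun p => \sum_i a i * F i p) /\
  dmean (fun p => \sum_i a i * F i p) = \sum_i a i * dmean (F i).
Proof.
move=> sF.
have Z : dmean (fun _ : H => 0 : C) = 0.
  by have := dmeanZ 0 (smooth_cst (0 : C)); rewrite !mul0r.
elim: (index_enum I) => [|i s [IH1 IH2]].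
  split; first by under eq_fun do rewrite big_nil; exact: smooth_cst.
  by under [X in dmean X]eq_fun do rewrite big_nil; rewrite big_nil.
split; first by under eq_fun do rewrite big_cons; apply: smooth_add => //; exact: smoothZ.
under [X in dmean X]eq_fun do rewrite big_cons -[X in _ + X]mul1r.
by rewrite (dmean_comb _ _ (sF i) IH1) mul1r IH2 big_cons.
Qed.

Lemma dmean_W z w : dmean (fun p => W z p * W (- w.1, - w.2) p) = (z == w)%:R.
Proof.
have -> : (fun p => W z p * W (- w.1, - w.2) p) = pwave (z.1 - w.1) (z.2 - w.2).
  by apply/funext => p; exact: pwaveD.
by rewrite dmean_pwave !subr_eq0 -pair_eqE.
Qed.

(** The difference with the sum over the circle has no nonzero coefficient: those
    off the circle vanish by [flat_coef_eq0]. *)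
Lemma flat_expansion f : level c 0 S 1 f -> exists a : quadrant M * 'I_4 -> C,
  f = fun p => \sum_i a i * W (lat i) p.
Proof.
move=> [sf fT fS fl fc]; have pf := (flat_lattice sf fT).1 fl.
pose a (i : quadrant M * 'I_4) := dmean (fun p => f p * W (- (lat i).1, - (lat i).2) p); exists a.
pose s p := \sum_i a i * W (lat i) p.
have [ss _] := dmean_sum a (fun i => smooth_W (lat i)).
have ps : periodic2 s.
  split=> p; apply: eq_bigr => i _; congr (_ * _).
    exact: (periodic2_pwave _ _ _).1.
  exact: (periodic2_pwave _ _ _).2.
pose g p := 1 * f p + (- 1) * s p.
have sg : smooth g by apply: smooth_add; exact: smoothZ.
have pg : periodic2 g by split=> p; rewrite /g ?pf.1 ?pf.2 ?ps.1 ?ps.2.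
have g0 x y : g (x, y, 0) = 0.
  apply: dmean_eq0 => // u v; pose w : int * int := (- u, - v).
  have wE p : pwave u v p = W (- w.1, - w.2) p by rewrite /W /w /= !opprK.
  have -> : (fun p => g p * pwave u v p) = fun p =>
      1 * (f p * W (- w.1, - w.2) p) + (- 1) * (\sum_i a i * (W (lat i) p * W (- w.1, - w.2) p)).
    apply/funext => p; rewrite wE /g mulrDl !mulrA; congr (_ + _).
    by rewrite -mulrA mulr_suml; congr (_ * _); apply: eq_bigr => i _; rewrite mulrA.
  have sWW (i : quadrant M * 'I_4) : smooth (fun p => W (lat i) p * W (- w.1, - w.2) p).
    by apply: smooth_mul; exact: smooth_W.
  have [sS ES] := dmean_sum a sWW.
  rewrite (dmean_comb _ _ (smooth_mul sf (smooth_W _)) sS) mul1r mulN1r ES.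
  rewrite (eq_bigr (fun i => a i * (lat i == w)%:R)); last by move=> i _; congr (_ * _); exact: dmean_W.
  have [hw|hw] := pselect (on_circle M w).
    have [i iw] := lat_surj M_gt0 hw.
    rewrite -iw (sum_indicator a i (@lat_inj R M)).
    by rewrite /a iw subrr.
  rewrite (flat_coef_eq0 sf fT pf fS); last first.
    move=> E; apply: hw; rewrite /on_circle /w /= !mulrNz !sqrrN.
    have p0 : 2 * pi ^+ 2 != 0 :> R by rewrite mulf_neq0 ?pnatr_eq0// expf_neq0// gt_eqF ?pi_gt0.
    apply: (mulfI p0); apply: oppr_inj; rewrite E /=.
    by rewrite !mulrNz !sqrrN.
  rewrite big1 ?subr0// => i _; case: eqP => [E|_]; last by rewrite mulr0.
  case: hw; rewrite -E; apply: on_circle_iter; exact: on_circle_base.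
apply/funext => -[[x y] t]; have := t_eigenP x y 0 t sf fT.
rewrite addr0 mul0r mulr0 cexp0 mul1r => ->.
have -> : \sum_i a i * W (lat i) (x, y, t) = s (x, y, 0).
  by apply: eq_bigr => i _; rewrite /W !pwaveE.
by have := g0 x y; rewrite /g mul1r mulN1r => /eqP; rewrite subr_eq0 => /eqP.
Qed.

(** Averaging the expansion over the four powers of the turn replaces each plane
    wave by a symmetrised one, which only depends on the orbit. *)
Lemma flat_span f : level c 0 S 1 f -> exists a : quadrant M -> C,
  f = fun p => \sum_q a q * symwave (base q) p.
Proof.
move=> hf; have [a fa] := flat_expansion hf.
exists (fun q => 4^-1 * \sum_(j < 4) a (q, j)); apply/funext => p.
have fc q : f (turn (c / 4) q) = f q by rewrite (level_turn hf) mul1r.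
pose t1 := turn (c / 4) p; pose t2 := turn (c / 4) t1; pose t3 := turn (c / 4) t2.
have n4 : 4 != 0 :> C by rewrite pnatr_eq0.
apply: (mulfI n4).
transitivity (f p + f t1 + f t2 + f t3).
  by rewrite /t3 /t2 /t1 !fc; ring.
rewrite fa -!big_split mulr_sumr /=.
transitivity (\sum_i a i * symwave (lat i) p).
  apply: eq_bigr => i _; rewrite -!mulrDr; congr (_ * _).
  rewrite /t3 /t2 /t1 !W_turn symwaveE /rotr.
  have := rot90_4 (lat i); rewrite /= => r4; rewrite !r4.
  by rewrite -!addrA; congr (_ + _); rewrite [RHS]addrA [RHS]addrC; congr (_ + _); rewrite addrC.
rewrite (eq_bigr (fun i => a (i.1, i.2) * symwave (base i.1) p)); last first.
  by move=> [q j] _; rewrite /lat /= symwave_iter.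
rewrite -(pair_bigA _ (fun q j => a (q, j) * symwave (base q) p)) /=.
by apply: eq_bigr => q _; rewrite -mulr_suml mulrA mulrA mulfV ?mul1r.
Qed.

Lemma flat_free (a : quadrant M -> C) :
  (forall p, \sum_q a q * symwave (base q) p = 0) -> forall q, a q = 0.
Proof.
move=> a0 q; pose b (i : quadrant M * 'I_4) := a i.1.
have E p : \sum_i b i * W (lat i) p = 0.
  rewrite -[RHS](a0 p); under [RHS]eq_bigr do rewrite mulr_sumr.
  rewrite (pair_bigA _ (fun q (j : 'I_4) => a q * W (iter j rot90 (base q)) p)) /=.
  by [].
pose w := base q.
have sWW (i : quadrant M * 'I_4) : smooth (fun p => W (lat i) p * W (- w.1, - w.2) p).
  by apply: smooth_mul; exact: smooth_W.
have [_ ES] := dmean_sum b sWW; move: ES.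
have -> : (fun p => \sum_i b i * (W (lat i) p * W (- w.1, - w.2) p)) = fun p => 0 * 1.
  apply/funext => p.
  transitivity ((\sum_i b i * W (lat i) p) * W (- w.1, - w.2) p); last by rewrite E !mul0r.
  by rewrite mulr_suml; apply: eq_bigr => i _; rewrite mulrA.
rewrite (dmeanZ 0 (smooth_cst (1 : C))) mul0r.
rewrite (eq_bigr (fun i => b i * (lat i == lat (q, ord0))%:R)); last first.
  by move=> i _; congr (_ * _); exact: dmean_W.
by rewrite (sum_indicator b (q, ord0) (@lat_inj R M)).
Qed.

Lemma has_dim_flat : has_dim (level c 0 S 1 : set (H -> C^o)) #|{: quadrant M}|.
Proof.
exists (fun i p => symwave (base (enum_val i)) p); split.
- by move=> i; apply: symwave_level; exact: on_circle_base.
- move=> a; rewrite sum_funE => a0 i.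
  have := @flat_free (fun q => a (enum_rank q)) _ (enum_val i); rewrite enum_valK; apply=> p.
  have := congr1 (fun f : H -> C => f p) a0 => /= E; rewrite -[RHS]E.
  rewrite (reindex _ (onW_bij _ (enum_val_bij _))) /=.
  by apply: eq_bigr => j _; rewrite enum_valK.
- move=> f hf; have [a ->] := flat_span hf; exists (fun i => a (enum_val i)).
  rewrite sum_funE; apply/funext => p.
  by rewrite (reindex _ (onW_bij _ (enum_val_bij _))).
Qed.

End FlatLevel.

Section PartB.
Variable R : realType.
Local Notation C := R[i].

Lemma gauss_dualP (w : C) : dual_lattice (@gauss_lattice R) w <->
  exists a b : int, w = a%:~R +i* b%:~R.
Proof.
split=> [hw|[a [b ->]] z [u [v ->]]].
  have /intrP[a ha] : complex.Re w \is a Num.int.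
    have := hw 1; rewrite rmorph1 mulr1; apply; exists 1, 0.
    by rewrite mulr0z mul0r addr0.
  have /intrP[b hb] : complex.Im w \is a Num.int.
    have -> : complex.Im w = complex.Re (w * ('i%C : C)^*).
      by case: (w) => x y /=; ring.
    by apply: hw; exists 0, 1; rewrite mul1r add0r.
  by exists a, b; rewrite -ha -hb; case: (w).
have -> : complex.Re ((a%:~R +i* b%:~R : C) * (u%:~R + v%:~R * 'i%C)^*) = (a * u + b * v)%:~R :> R.
  by rewrite -(rmorph_int (real_complex R) u) -(rmorph_int (real_complex R) v) intrD !intrM /=; ring.
exact: intr_int.
Qed.

Local Open Scope card_scope.

Lemma E_card (r kappa : R) : 0 < r -> 0 < kappa ->
  E_ r kappa #= `I_(#|{: quadrant (kappa * r / pi ^+ 2)}| * 4).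
Proof.
move=> r0 k0; pose M := kappa * r / pi ^+ 2.
have p0 : 0 < pi ^+ 2 :> R by rewrite exprn_gt0 ?pi_gt0.
have M0 : 0 < M by rewrite divr_gt0// mulr_gt0.
pose F (i : 'I_#|{: quadrant M * 'I_4}|) : C :=
  (lat (enum_val i)).1%:~R +i* (lat (enum_val i)).2%:~R.
have onE (z : int * int) : pi ^+ 2 * Normc.normc (z.1%:~R +i* z.2%:~R : C) ^+ 2 / r = kappa <->
    on_circle M z.
  rewrite normc2E /on_circle /M /=; move: (pi : R) (pi_gt0 R) => P P0.
  by split=> [<-|->]; field; rewrite (gt_eqF r0) (gt_eqF P0).
have -> : E_ r kappa = F @` [set: _].
  apply/seteqP; split=> [w [/gauss_dualP[a [b ->]] h]|_ [i _ <-]].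
    have [i iab] := lat_surj M0 ((onE (a, b)).1 h).
    by exists (enum_rank i) => //; rewrite /F enum_rankK iab.
  split; first by apply/gauss_dualP; eexists; eexists; reflexivity.
  apply/onE; exact: on_circle_iter (on_circle_base _).
have F_inj : {in [set: 'I_#|{: quadrant M * 'I_4}|] &, injective F}.
  move=> i j _ _ [/intr_inj e1 /intr_inj e2]; apply: enum_val_inj; apply: lat_inj.
  by rewrite [LHS]surjective_pairing [RHS]surjective_pairing e1 e2.
rewrite (card_eql (inj_card_eq F_inj)) card_eq_sym card_prod card_ord.
exact: card_II.
Qed.

Lemma multiplicity_flat (c r kappa : R) : 0 < r -> 0 < kappa -> 
  exists q m : nat,
       [/\ E_ r kappa #= `I_q,
           multiplicity (Gamma c) r kappa 0 m &
           m%:R = q%:R / 4 :> R].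
Proof.
move=> r0 k0; pose M := kappa * r / pi ^+ 2.
have p0 : 0 < pi ^+ 2 :> R by rewrite exprn_gt0 ?pi_gt0.
have M0 : 0 < M by rewrite divr_gt0// mulr_gt0.
exists (#|{: quadrant M}| * 4)%N, #|{: quadrant M}|; split; first exact: E_card.
  rewrite /multiplicity joint_eigenspaceE ?gt_eqF// mulr0.
  have -> : - (2 * r * kappa) = - (2 * pi ^+ 2 * M).
    by rewrite /M; move: (pi : R) (pi_gt0 R) => P P0; field; rewrite gt_eqF.
  exact: has_dim_flat.
by rewrite natrM mulfK// pnatr_eq0.
Qed.

End PartB.

Local Close Scope complex_scope.
Local Open Scope card_scope.
Local Open Scope ring_scope.
Unset Implicit Arguments.

Theorem theorem6p3 (R : realType) (N : nat) (N_gt0 : (0 < N)%N)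
    (N_even : ~~ odd N) (c r : R) (c_def : c = 4 / N%:R) (r_gt0 : 0 < r)
    (Gamma_bieberbach : heisenberg_bieberbach (Gamma c)) :
  (forall (n : int) (k : nat), n != 0 ->
     exists m : nat,
       [/\ multiplicity (Gamma c) r
             ((4 * k%:R + 2) * pi * `|n|%:~R / (c * r))
             (2 * pi * n%:~R / (c * r)) m,
           (`|n| * N = 0 %[mod 4])%N ->
             m%:R = 1 / 4 * ((`|n| * N)%N%:R + 2 * (-1) ^ (n + k%:Z)
                    + 2 * cos (pi * (`|n|%:~R - k%:R) / 2)
                    - 2 * sin (pi * (`|n|%:~R - k%:R) / 2)) :> R &
           (`|n| * N = 2 %[mod 4])%N ->
             m%:R = 1 / 4 * ((`|n| * N)%N%:R + 2 * (-1) ^ (n + k%:Z)) :> R])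
  /\
  (forall kappa : R, 0 < kappa ->
     exists q m : nat,
       [/\ E_ r kappa #= `I_q,
           multiplicity (Gamma c) r kappa 0 m &
           m%:R = q%:R / 4 :> R]).
Proof.
split=> [n k n0|kappa k0]; last exact: multiplicity_flat.
exact: multiplicity_nonzero N_gt0 N_even n0 c_def r_gt0.
Qed.
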